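(* Let $d\ge 1$ and let $K=\overline{B}(0,1)\subseteq\mathbb{R}^d$ be the closed unit ball, with boundary $\partial K$. Let $\mathcal{Z}(K)=\{f\in C^1(K): \det Df(\alpha)\neq 0 \text{ and } \alpha\notin\partial K \text{ whenever } \alpha\in K \text{ is a zero of } f\}$. Then the operator that assigns to each $f\in\mathcal{Z}(K)$ its zero set and the cardinality of the zero set is computable. More precisely, there is an algorithm $\mathcal{E}'$ which, when given as input any $C^1$-name of any $f\in\mathcal{Z}(K)$ and any $n_0\in\mathbb{N}$, outputs an integer $n\ge n_0$, a nonnegative integer $\#_0(f)$, and a finite list $C$ of squares (hyper-cubes if $d\ge 3$) with rational vertices, such that: (1) $\#_0(f)$ is the exact number of zeros of $f$ in $K$; (2) each square in $C$ has side length $1/n$ and contains exactly one zero of $f$; furthermore $Zero(f)=\{x\in K: f(x)=0\}\subseteq\cup C$, which implies $d_H(Zero(f),\cup C)\le 1/n$, where $d_H$ is the Hausdorff distance and $\cup C$ the union of the squares in $C$.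
   Context: $C^1(K)$ denotes the set of continuously differentiable functions defined on some open subset of $\mathbb{R}^d$ containing $K$, with values in $\mathbb{R}^d$; $Df(x)$ is the Jacobian of $f$ at $x$. The paper takes the closed unit ball with respect to the maximum norm $\|\cdot\|_\infty$. For $f\in C^1(K)$, $\|f\|_{1,\infty}=\max_{x\in K}\|f(x)\|+\max_{x\in K}\|Df(x)\|$. A $C^1$-name of $f$ is a sequence $(P_k)$ of polynomial maps with rational coefficients with $\|f-P_k\|_{1,\infty}<2^{-k}$ on $K$ (for vector-valued $f$, a name consists of names of its components). The algorithm is a Turing machine reading the name as an infinite input sequence (type-2 computability). *)

(* Defs.v *)
From mathcomp Require Import all_boot all_order all_algebra.
From mathcomp Require Import all_classical all_reals all_analysis.
(* mpoly is not imported: its notations clash with those of the analysis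
   library. *)
From mathcomp Require mpoly.

Set Implicit Arguments.
Unset Strict Implicit.
Unset Printing Implicit Defensive.

Import Order.TTheory GRing.Theory Num.Theory.
Import numFieldNormedType.Exports.

Local Open Scope classical_set_scope.
Local Open Scope ring_scope.

(* Type-2 Turing machines: one read-only input tape holding an infinite binary
   sequence, [tm_tapes] two-way infinite work tapes, and one write-only output
   tape.  The input and output heads never move to the left. *)

Inductive move := MoveLeft | Stay | MoveRight.

Definition move_head (m : move) (h : int) : int :=
  match m with MoveLeft => h - 1 | Stay => h | MoveRight => h + 1 end.

Record action (state sym : finType) (k : nat) := Action {
  act_state : state;
  act_advance : bool;                     (* move the input head right? *)
  act_work : {ffun 'I_k -> sym * move};   (* symbol to write, then move *)
  act_output : option bool                (* symbol to append, if any *)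
}.

(* The transition table has finite domain; [None] means that the machine
   halts. *)
Record machine := Machine {
  tm_state : finType;
  tm_sym : finType;
  tm_tapes : nat;
  tm_start : tm_state;
  tm_blank : tm_sym;
  tm_delta : tm_state -> bool -> {ffun 'I_tm_tapes -> tm_sym} ->
             option (action tm_state tm_sym tm_tapes)
}.

Record config (M : machine) := Config {
  cf_state : tm_state M;
  cf_input : nat;
  cf_tape : 'I_(tm_tapes M) -> int -> tm_sym M;
  cf_head : 'I_(tm_tapes M) -> int;
  cf_output : seq bool
}.

Definition init_config (M : machine) : config M :=
  Config (tm_start M) 0%N (fun _ _ => tm_blank M) (fun _ => 0) [::].

Definition transition (M : machine) (p : nat -> bool) (c : config M) :=
  tm_delta (cf_state c) (p (cf_input c))
    [ffun t => cf_tape c t (cf_head c t)].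

Definition apply_action (M : machine) (c : config M)
    (a : action (tm_state M) (tm_sym M) (tm_tapes M)) : config M :=
  Config (act_state a)
    (cf_input c + act_advance a)%N
    (fun t z => if z == cf_head c t then (act_work a t).1 else cf_tape c t z)
    (fun t => move_head (act_work a t).2 (cf_head c t))
    (if act_output a is Some b then rcons (cf_output c) b else cf_output c).

Inductive reaches (M : machine) (p : nat -> bool) : config M -> Prop :=
| reaches_init : reaches p (init_config M)
| reaches_step c a : reaches p c -> transition p c = Some a ->
    reaches p (apply_action c a).

(* Started on the input [p], [M] halts with [w] on its output tape. *)
Definition halts_with (M : machine) (p : nat -> bool) (w : seq bool) : Prop :=
  exists c : config M,
    [/\ reaches p c, transition p c = None & cf_output c = w].

(* Binary codes of finite objects.  Every code is self-delimiting, so that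
   concatenated codes can be separated again. *)

Definition code_nat (n : nat) : seq bool := rcons (nseq n true) false.

Definition code_int (z : int) : seq bool := (z < 0) :: code_nat `|z|%N.

Definition code_rat (q : rat) : seq bool :=
  code_int (numq q) ++ code_int (denq q).

Definition code_seq (T : Type) (code : T -> seq bool) (s : seq T) : seq bool :=
  code_nat (size s) ++ flatten [seq code x | x <- s].

Definition code_fam (d : nat) (T : Type) (code : T -> seq bool)
    (v : 'I_d -> T) : seq bool :=
  flatten [seq code (v i) | i <- enum 'I_d].

(* The list of the monomials of [p], each followed by its coefficient. *)
Definition code_poly (d : nat) (p : mpoly.mpoly d rat) : seq bool :=
  code_seq (fun m : mpoly.multinom d =>
              code_fam code_nat (mpoly.fun_of_multinom m) ++
              code_rat (mpoly.mcoeff m p))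
           (mpoly.msupp p).

(* The infinite concatenation of the codes of [n0], [P 0], [P 1], ...  When
   [0 < d], each of these codes has length at least 1, so the [i]-th bit is
   reached within the codes of [n0], [P 0], ..., [P i.-1]. *)
Definition input_seq (d n0 : nat) (P : nat -> 'I_d -> mpoly.mpoly d rat) :
    nat -> bool :=
  fun i => nth false
    (code_nat n0 ++
     flatten [seq code_fam (@code_poly d) (P k) | k <- iota 0 i]) i.

(* The axis-parallel hypercube [corner + [0, side]^d]. *)
Definition cube (d : nat) := ('rV[rat]_d * rat)%type.
Definition corner (d : nat) (c : cube d) := c.1.
Definition side (d : nat) (c : cube d) := c.2.

Definition code_cube (d : nat) (c : cube d) : seq bool :=
  code_fam code_rat (corner c ord0) ++ code_rat (side c).

Definition output_word (d n N : nat) (C : seq (cube d)) : seq bool :=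
  code_nat n ++ code_nat N ++ code_seq (@code_cube d) C.

Definition cube_set (R : realType) (d : nat) (c : cube d) : set 'rV[R]_d :=
  [set x | forall i, ratr (corner c ord0 i) <= x ord0 i
                     <= ratr (corner c ord0 i + side c)].

Definition cubes_union (R : realType) (d : nat) (C : seq (cube d)) :
    set 'rV[R]_d :=
  [set x | exists2 c, c \in C & cube_set c x].

Definition boundary (T : topologicalType) (A : set T) : set T :=
  closure A `\` interior A.

(* The norm of ['rV[R]_d] is the maximum norm, hence so is this ball. *)
Definition unit_ball (R : realType) (d : nat) : set 'rV[R]_d :=
  closed_ball (0 : 'rV[R]_d) 1.

(* ['J f x] is the transpose of the usual Jacobian matrix, since vectors are
   rows; neither its determinant nor its norm is affected. *)
Definition C1_on (R : realType) (d m : nat) (U : set 'rV[R]_d)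
    (f : 'rV[R]_d -> 'rV[R]_m) : Prop :=
  forall x, U x -> differentiable f x /\ {for x, continuous (jacobian f)}.

(* The norm of a matrix is the maximum of the absolute values of its
   entries. *)
Definition C1_norm (R : realType) (d m : nat) (K : set 'rV[R]_d)
    (g : 'rV[R]_d -> 'rV[R]_m) : R :=
  sup [set `|g x| | x in K] + sup [set `|jacobian g x| | x in K].

Definition poly_fun (R : realType) (d : nat) (p : mpoly.mpoly d rat) :
    'rV[R]_d -> 'rV[R]_1 :=
  fun x => (mpoly.meval (x ord0) (mpoly.map_mpoly ratr p))%:M.

Definition is_C1_name (R : realType) (d m : nat) (K : set 'rV[R]_d)
    (f : 'rV[R]_d -> 'rV[R]_m) (P : nat -> 'I_m -> mpoly.mpoly d rat) : Prop :=
  forall k i, C1_norm K (fun x => col i (f x) - poly_fun (P k i) x) < 2 ^- k.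

Definition zeros (R : realType) (d m : nat) (D : set 'rV[R]_d)
    (f : 'rV[R]_d -> 'rV[R]_m) : set 'rV[R]_d :=
  [set x | D x /\ f x = 0].

(* The value is 0 when both sets are empty, and +oo when exactly one is. *)
Definition hausdorff_dist (R : realType) (V : normedModType R) (A B : set V) :
    \bar R :=
  let excess A B :=
    ereal_sup [set ereal_inf [set `|a - b|%:E | b in B] | a in A] in
  maxe 0%E (maxe (excess A B) (excess B A)).

(* Main.v *)
Require Import Defs.
From mathcomp Require Import all_boot all_order all_algebra.
From mathcomp Require Import all_classical all_reals all_analysis.
From mathcomp Require mpoly.
From mathcomp Require Import zify ring lra.

Set Implicit Arguments.
Unset Strict Implicit.
Unset Printing Implicit Defensive.

Import Order.TTheory GRing.Theory Num.Theory.
Import numFieldNormedType.Exports.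

Local Open Scope classical_set_scope.
Local Open Scope ring_scope.

(** The machine searches for a certificate: a finite part of the name, cubes of
    side [1 / n] with a rational matrix [A] for each of them, and a grid of mesh
    [1 / m].  A certificate is accepted when rational arithmetic on polynomials
    of the name shows that, on each cube, [x - A f x] is a contraction moving
    the center by at most a quarter of the side (so the cube contains exactly
    one zero, which is simple), that the cubes are disjoint and lie in the unit
    ball, and that every grid point either is so deep inside a cube that its
    [1 / m]-neighborhood is covered, or has a value of [f] too large for a zero
    at distance at most [1 / m].  Lipschitz bounds of polynomials on the unit
    ball are read off their coefficients.  Two polynomials of the name are used,
    one for the Jacobian matrix and one for the values: the first precision must
    be fixed before the size of the cubes, the second one after it.

    Certificates exist since the zeros are simple and interior, hence finite in
    number, [A] being an approximation of the inverse Jacobian matrix at a zero,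
    and since [|f|] is bounded away from 0 on the complement of the cubes.

    Acceptance is decided by a function on codes that is built by iteration from
    the successor function and a pairing function.  Such functions are computed
    by while programs over registers, and a Turing machine runs these programs,
    a register being the position of the head on a work tape. *)

(** * Register programs and their compilation to Turing machines *)

(** Nothing is ever parsed: a certificate contains a guess of the initial part of the name, and
    acceptance compares the code of the guess with the bits read. Since codes are self-delimiting, a
    guess that passes agrees with the name up to the encoding of signs. Thus only encoders have to
    be programmed, and arithmetic on unreduced fractions avoids gcd computations as well. The search
    stops at an accepted certificate that need not be the one whose existence is proved. So
    soundness is shown for every accepted certificate, and existence separately, with room to spare:
    near a zero the Newton map contracts by 1/4 where acceptance asks for 1/2, and the difference
    pays for the errors of the polynomials. The number of zeros comes out as the number of cubes:
    covering makes it an upper bound, disjointness of cubes that each contain a zero makes it a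
    lower bound. *)

Inductive prog :=
| Skip
| Inc (r : nat)
| Dec (r : nat)
| Read (r : nat)
| Out (b : bool)
| Seq (p q : prog)
| If (r : nat) (p q : prog)
| While (r : nat) (p : prog).

Definition upd (s : nat -> nat) (k v : nat) : nat -> nat :=
  fun j => if j == k then v else s j.

Inductive exec (w : nat -> bool) :
  prog -> (nat -> nat) -> nat -> seq bool ->
  (nat -> nat) -> nat -> seq bool -> Prop :=
| exec_skip s i o : exec w Skip s i o s i o
| exec_inc r s i o : exec w (Inc r) s i o (upd s r (s r).+1) i o
| exec_dec r s i o : exec w (Dec r) s i o (upd s r (s r).-1) i o
| exec_read r s i o : exec w (Read r) s i o (upd s r (s r + w i)%N) i.+1 o
| exec_out b s i o : exec w (Out b) s i o s i (rcons o b)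
| exec_seq p q s i o s' i' o' s'' i'' o'' :
    exec w p s i o s' i' o' -> exec w q s' i' o' s'' i'' o'' ->
    exec w (Seq p q) s i o s'' i'' o''
| exec_if_pos r p q s i o s' i' o' : (0 < s r)%N -> exec w p s i o s' i' o' ->
    exec w (If r p q) s i o s' i' o'
| exec_if_zero r p q s i o s' i' o' : s r = 0%N -> exec w q s i o s' i' o' ->
    exec w (If r p q) s i o s' i' o'
| exec_while_zero r p s i o : s r = 0%N -> exec w (While r p) s i o s i o
| exec_while_pos r p s i o s' i' o' s'' i'' o'' : (0 < s r)%N ->
    exec w p s i o s' i' o' -> exec w (While r p) s' i' o' s'' i'' o'' ->
    exec w (While r p) s i o s'' i'' o''.

Inductive instr :=
| IHalt
| IInc (r : nat)
| IDec (r : nat)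
| IRead (r : nat)
| IOut (b : bool)
| IJz (r l : nat)
| IJmp (l : nat).

Fixpoint compile (p : prog) (a : nat) : seq instr :=
  match p with
  | Skip => [::]
  | Inc r => [:: IInc r]
  | Dec r => [:: IDec r]
  | Read r => [:: IRead r]
  | Out b => [:: IOut b]
  | Seq p q => let c := compile p a in c ++ compile q (a + size c)
  | If r p q =>
      let c := compile p a.+1 in
      let c' := compile q (a + size c + 2) in
      IJz r (a + size c + 2) :: c ++ IJmp (a + size c + 2 + size c') :: c'
  | While r p =>
      let c := compile p a.+1 in
      IJz r (a + size c + 2) :: rcons c (IJmp a)
  end.

Definition instr_reg (x : instr) : nat :=
  match x with IInc r | IDec r | IRead r | IJz r _ => r | _ => 0%N end.

Section MachineOfCode.
Variable c : seq instr.
Let T := (\max_(x <- c) instr_reg x)%N.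
Let state : finType := option 'I_(size c).+1.
Let goto (l : nat) : state := Some (inord l).

(** The start state [None] writes the mark on cell 0 of every tape. Reading the mark is the test for
    zero, so [IDec] stays there, which gives the truncated predecessor. At address [size c] the
    default of [nth] is [IHalt]: running off the end of the code is the way to halt. *)
Definition code_delta (q : state) (b : bool) (x : {ffun 'I_T.+1 -> bool}) :
    option (action state bool T.+1) :=
  let act r m := [ffun t => (x t, if t == inord r then m else Stay)] in
  if q is Some l then
    match nth IHalt c l with
    | IHalt => None
    | IInc r => Some (Action (goto l.+1) false (act r MoveRight) None)
    | IDec r => Some (Action (goto l.+1) false
                  (act r (if x (inord r) then Stay else MoveLeft)) None)
    | IRead r => Some (Action (goto l.+1) true
                  (act r (if b then MoveRight else Stay)) None)
    | IOut b' => Some (Action (goto l.+1) false (act 0 Stay) (Some b'))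
    | IJz r l' => Some (Action (goto (if x (inord r) then l' else l.+1)) false
                  (act 0 Stay) None)
    | IJmp l' => Some (Action (goto l') false (act 0 Stay) None)
    end
  else Some (Action (goto 0) false [ffun => (true, Stay)] None).

(* A register is the position of the head on its tape, of which only cell 0
   carries a mark. *)
Definition machine_of_code : machine :=
  @Machine state bool T.+1 None false code_delta.

Definition represents (l : nat) (s : nat -> nat) (i : nat) (o : seq bool)
    (f : config machine_of_code) : Prop :=
  [/\ cf_state f = goto l, cf_input f = i, cf_output f = o,
      forall t, cf_head f t = s t :> int
    & forall t z, cf_tape f t z = (z == 0)].

Definition machine_at (w : nat -> bool) l s i o : Prop :=
  exists2 f, reaches w f & represents l s i o f.

Lemma machine_at_init w : machine_at w 0 (fun=> 0%N) 0 [::].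
Proof.
pose f0 := init_config machine_of_code.
pose a := Action (goto 0) false [ffun _ : 'I_T.+1 => (true, Stay)] None.
exists (@apply_action machine_of_code f0 a).
  by apply: reaches_step; first exact: reaches_init.
split=> //= [t|t z]; first by rewrite ffunE.
by rewrite ffunE; case: eqP.
Qed.

Lemma instr_reg_le l : (instr_reg (nth IHalt c l) <= T)%N.
Proof.
have [lt_l|ge_l] := ltnP l (size c); last by rewrite nth_default.
by rewrite /T (big_nth IHalt) big_mkord (leq_bigmax (Ordinal lt_l)).
Qed.

(** There are more tapes than the largest register of the code, so [inord] does not identify two
    registers. *)
Lemma inord_eq_reg l (t : 'I_T.+1) : let r := instr_reg (nth IHalt c l) in
  (t == inord r) = (t == r :> nat).
Proof. by move=> r; rewrite -val_eqE /= inordK // ltnS instr_reg_le. Qed.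

Definition instr_effect (x : instr) (l : nat) (w : nat -> bool)
    (s : nat -> nat) (i : nat) (o : seq bool) :
    nat * (nat -> nat) * nat * seq bool :=
  match x with
  | IHalt => (l, s, i, o)
  | IInc r => (l.+1, upd s r (s r).+1, i, o)
  | IDec r => (l.+1, upd s r (s r).-1, i, o)
  | IRead r => (l.+1, upd s r (s r + w i)%N, i.+1, o)
  | IOut b => (l.+1, s, i, rcons o b)
  | IJz r l' => (if s r == 0%N then l' else l.+1, s, i, o)
  | IJmp l' => (l', s, i, o)
  end.

Lemma machine_at_step w l s i o : (l < size c)%N -> nth IHalt c l <> IHalt ->
  machine_at w l s i o ->
  let e := instr_effect (nth IHalt c l) l w s i o in
  machine_at w e.1.1.1 e.1.1.2 e.1.2 e.2.
Proof.
move=> lt_l nh [[q fi ft fh fo] reach_f [/= fqE fiE foE fhE ftE]]; subst q fi fo.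
set f := Config _ _ _ _ _ in reach_f.
have lE : (inord l : 'I_(size c).+1) = l :> nat by rewrite inordK //; lia.
have syms : [ffun t : 'I_T.+1 => ft t (fh t)] = [ffun t : 'I_T.+1 => s t == 0%N].
  by apply/ffunP=> t; rewrite !ffunE ftE fhE.
have step a : code_delta (goto l) (w i) [ffun t : 'I_T.+1 => s t == 0%N] = Some a ->
    reaches w (@apply_action machine_of_code f a).
  by move=> aE; apply: reaches_step reach_f _; rewrite /transition /= syms.
have tE := @inord_eq_reg l; have rT := instr_reg_le l.
case xE: (nth IHalt c l) nh tE rT => [|r|r|r|b|r l'|l'] //= _ tE rT;
  (eexists; first by apply: step; rewrite /code_delta /= lE xE);
  (split=> /=; rewrite ?lE ?addn0 ?addn1 //);
  (* Every instruction writes back the symbol it has read, so the marks stay where they are. *)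
  try (by move=> t z; rewrite !ffunE /= ftE; case: eqP => // ->; rewrite fhE).
- by move=> t; rewrite !ffunE /= tE fhE /upd; case: eqP => [->|] //=; lia.
- move=> t; rewrite !ffunE /= tE fhE /upd inordK //.
  by case: eqP => [->|] //=; case: (s r) => [|m] //=; lia.
- move=> t; rewrite !ffunE /= tE fhE /upd.
  by case: eqP => [->|] //=; case: (w i) => /=; lia.
- by move=> t; rewrite !ffunE /= if_same fhE.
- by rewrite ffunE inordK.
- by move=> t; rewrite !ffunE /= if_same fhE.
- by move=> t; rewrite !ffunE /= if_same fhE.
Qed.

Definition code_at (a : nat) (d : seq instr) : Prop :=
  exists c1 c2, c = c1 ++ d ++ c2 /\ size c1 = a.

Lemma code_at_cat a d e : code_at a (d ++ e) ->
  code_at a d /\ code_at (a + size d) e.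
Proof.
move=> [c1 [c2 [cE <-]]]; split.
  by exists c1, (e ++ c2); rewrite cE !catA.
by exists (c1 ++ d), c2; rewrite size_cat cE !catA.
Qed.

Lemma code_at_cons a x e : code_at a (x :: e) -> x <> IHalt ->
  code_at a.+1 e /\ forall w s i o, machine_at w a s i o ->
    let e := instr_effect x a w s i o in machine_at w e.1.1.1 e.1.1.2 e.1.2 e.2.
Proof.
move=> [c1 [c2 [cE <-]]] nh; split.
  by exists (rcons c1 x), c2; rewrite size_rcons cE cat_rcons.
have xE : nth IHalt c (size c1) = x by rewrite cE nth_cat ltnn subnn.
have lt_a : (size c1 < size c)%N by rewrite cE !size_cat /= -addSnnS leq_addr.
by move=> w s i o; rewrite -xE in nh *; exact: machine_at_step.
Qed.

Lemma machine_at_eq w l l' s i o :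
  l = l' -> machine_at w l s i o -> machine_at w l' s i o.
Proof. by move->. Qed.

(** Induction on the run rather than on the program: after each round a loop is entered again at the
    same address [a], with the same hypothesis on its code. *)
Lemma machine_at_exec w p s i o s' i' o' : exec w p s i o s' i' o' ->
  forall a, code_at a (compile p a) -> machine_at w a s i o ->
  machine_at w (a + size (compile p a)) s' i' o'.
Proof.
elim=> {p s i o s' i' o'} /=.
- by move=> s i o a; rewrite addn0.
- by move=> r s i o a /code_at_cons[] // _ x /x; rewrite addn1.
- by move=> r s i o a /code_at_cons[] // _ x /x; rewrite addn1.
- by move=> r s i o a /code_at_cons[] // _ x /x; rewrite addn1.
- by move=> b s i o a /code_at_cons[] // _ x /x; rewrite addn1.
- move=> p q s i o s1 i1 o1 s2 i2 o2 _ IHp _ IHq a /code_at_cat[cp cq].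
  by move/(IHp _ cp)/(IHq _ cq); rewrite size_cat addnA.
- move=> r p q s i o s1 i1 o1 r_gt0 _ IHp a /code_at_cons[] //.
  move=> /code_at_cat[cp /code_at_cons[] // _ y] x /x /=.
  rewrite gtn_eqF // => /(IHp _ cp)/y /=.
  by apply: machine_at_eq; rewrite size_cat /=; lia.
- move=> r p q s i o s1 i1 o1 r0 _ IHq a /code_at_cons[] //.
  move=> /code_at_cat[_ /code_at_cons[] // cq _] x /x /=.
  rewrite r0 eqxx.
  have aE : (a.+1 + size (compile p a.+1)).+1 = (a + size (compile p a.+1) + 2)%N.
    lia.
  rewrite aE in cq; move=> /(IHq _ cq).
  by apply: machine_at_eq; rewrite size_cat /=; lia.
- move=> r p s i o r0 a /code_at_cons[] // _ x /x /=.
  by rewrite r0 eqxx; apply: machine_at_eq; rewrite size_rcons; lia.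
- move=> r p s i o s1 i1 o1 s2 i2 o2 r_gt0 _ IHp _ IHw a ca.
  have [] // := code_at_cons ca; rewrite -{1}cats1.
  move=> /code_at_cat[cp /code_at_cons[] // _ y] x /x /=.
  by rewrite gtn_eqF // => /(IHp _ cp)/y /(IHw _ ca).
Qed.

Lemma machine_at_halts w s i o : machine_at w (size c) s i o ->
  halts_with machine_of_code w o.
Proof.
move=> [f reach_f [fqE fiE foE _ _]]; exists f; split=> //.
by rewrite /transition /= fqE /code_delta /= inordK // nth_default.
Qed.

End MachineOfCode.

Definition machine_of_prog (p : prog) : machine := machine_of_code (compile p 0).

Lemma machine_of_progP p w s i o :
  exec w p (fun=> 0%N) 0 [::] s i o -> halts_with (machine_of_prog p) w o.
Proof.
move=> ex; apply: (@machine_at_halts _ w s i).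
apply: (machine_at_exec (a := 0) ex); last exact: machine_at_init.
by exists [::], [::]; rewrite cats0.
Qed.

(** * Functions computed by register programs *)

Section NatScope.
Local Open Scope nat_scope.

Fixpoint tri (n : nat) : nat := if n is m.+1 then tri m + n else 0.

Lemma leq_tri m n : m <= n -> tri m <= tri n.
Proof.
by move/subnK <-; elim: (n - m) => //= j /leq_trans; apply; rewrite leq_addr.
Qed.

Definition cpair (a b : nat) : nat := tri (a + b) + b.

(** One step of the walk along the antidiagonals. Inverting the Cantor pairing by iterating this
    step makes unpairing a counting loop, with no square root to compute. *)
Definition cstep (x : nat * nat) : nat * nat :=
  if x.1 is a.+1 then (a, x.2.+1) else (x.2.+1, 0).

Definition cunpair (n : nat) : nat * nat := iter n cstep (0, 0).

Lemma cpairK a b : cunpair (cpair a b) = (a, b).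
Proof.
have diag x y : iter y cstep (x + y, 0) = (x, y).
  by elim: y x => [|y IHy] x; rewrite ?addn0 // -addSnnS iterS IHy.
have corner n : iter (tri n) cstep (0, 0) = (n, 0).
  elim: n => //= n IHn; rewrite addnC iterD IHn iterS.
  by rewrite -[n]add0n diag.
by rewrite /cunpair /cpair addnC iterD corner diag.
Qed.

Lemma cunpairK n : cpair (cunpair n).1 (cunpair n).2 = n.
Proof.
have step x : cpair (cstep x).1 (cstep x).2 = (cpair x.1 x.2).+1.
  case: x => [[|a] b]; rewrite /cpair /cstep /=; last by rewrite !addnS /=; lia.
  by rewrite !addn0 ?add0n /=; lia.
by rewrite /cunpair; elim: n => //= n IHn; rewrite step IHn.
Qed.

Lemma leq_cpairr a b : b <= cpair a b.
Proof. exact: leq_addl. Qed.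

(* The registers above [k] are scratch space, zero before and after the run, so
   that programs compose like operations on a stack. *)
Definition computes (c : nat -> prog) (f : nat -> nat) : Prop :=
  forall w k s i o, (forall j, k < j -> s j = 0) ->
  exec w (c k) s i o (upd s k (f (s k))) i o.

Definition rcomp (f : nat -> nat) : Prop := exists c, computes c f.

Lemma exec_eq w p s i o s' s'' i' o' :
  exec w p s i o s' i' o' -> s' =1 s'' -> exec w p s i o s'' i' o'.
Proof. by move=> ex /funext <-. Qed.

(** * Loops on registers: clearing, moving, pairing, unpairing *)

Section Exec.
Variables (w : nat -> bool) (i : nat) (o : seq bool).
Local Notation run p s s' := (exec w p s i o s' i o).

(** A closed form [s t] of the state after [t] rounds replaces both invariant and variant in the
    verification of a loop. *)
Lemma exec_while_seq r p n (s : nat -> nat -> nat) :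
  (forall t, t < n -> 0 < s t r /\ run p (s t) (s t.+1)) -> s n r = 0 ->
  run (While r p) (s 0) (s n).
Proof.
move=> step s0; suff H m : m <= n -> run (While r p) (s (n - m)) (s n).
  by have := H _ (leqnn n); rewrite subnn.
elim: m => [_|m IHm lt_mn]; first by rewrite subn0; exact: exec_while_zero.
have [|gt0 ex] := step (n - m.+1); first by lia.
apply: (exec_while_pos gt0 ex); rewrite -subSn // subSS; exact: IHm (ltnW _).
Qed.

Ltac upd_solve := let j := fresh "j" in
  move=> j; rewrite /upd; repeat (case: eqP => /= ?; subst); try lia.

Definition Clear a := While a (Dec a).

Lemma exec_clear a s : run (Clear a) s (upd s a 0).
Proof.
pose st t := upd s a (s a - t).
have: run (Clear a) (st 0) (st (s a)).
  apply: exec_while_seq => [t lt_t|]; last by rewrite /st /upd eqxx subnn.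
  split; first by rewrite /st /upd eqxx; lia.
  by apply: exec_eq; first exact: exec_dec; rewrite /st; upd_solve.
have -> : st 0 = s by apply/funext; rewrite /st; upd_solve.
by move/exec_eq; apply; rewrite /st; upd_solve.
Qed.

Definition Move a b := While a (Seq (Dec a) (Inc b)).

Lemma exec_move a b s : a <> b ->
  run (Move a b) s (upd (upd s b (s b + s a)) a 0).
Proof.
move=> neq; pose st t := upd (upd s b (s b + t)) a (s a - t).
have: run (Move a b) (st 0) (st (s a)).
  apply: exec_while_seq => [t lt_t|]; last by rewrite /st /upd eqxx subnn.
  split; first by rewrite /st /upd eqxx; lia.
  apply: exec_eq; first by apply: exec_seq; [exact: exec_dec|exact: exec_inc].
  by rewrite /st; upd_solve.
have -> : st 0 = s by apply/funext; rewrite /st; upd_solve.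
by move/exec_eq; apply; rewrite /st; upd_solve.
Qed.

Definition Dup a b c := While a (Seq (Dec a) (Seq (Inc b) (Inc c))).

Lemma exec_split a b c s : a <> b -> a <> c -> b <> c ->
  run (Dup a b c) s (upd (upd (upd s b (s b + s a)) c (s c + s a)) a 0).
Proof.
move=> nab nac nbc.
pose st t := upd (upd (upd s b (s b + t)) c (s c + t)) a (s a - t).
have: run (Dup a b c) (st 0) (st (s a)).
  apply: exec_while_seq => [t lt_t|]; last by rewrite /st /upd eqxx subnn.
  split; first by rewrite /st /upd eqxx; lia.
  apply: exec_eq.
    apply: exec_seq; first exact: exec_dec.
    by apply: exec_seq; exact: exec_inc.
  by rewrite /st; upd_solve.
have -> : st 0 = s by apply/funext; rewrite /st; upd_solve.
by move/exec_eq; apply; rewrite /st; upd_solve.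
Qed.

(** Register [k] runs from [a + b] down to 1 and each of its values is added to [k.+2], which starts
    as [b]; the result is [tri (a + b) + b]. *)
Definition Pair k :=
  Seq (Dup k.+1 k k.+2)
      (Seq (While k (Seq (Dup k k.+1 k.+2) (Seq (Move k.+1 k) (Dec k))))
           (Move k.+2 k)).

Lemma exec_pair k s : (forall j, k.+1 < j -> s j = 0) ->
  run (Pair k) s (upd (upd s k (cpair (s k) (s k.+1))) k.+1 0).
Proof.
move=> sk; have s2 : s k.+2 = 0 by rewrite sk.
pose N := s k + s k.+1.
pose st t := upd (upd (upd s k.+1 0) k (N - t))
  k.+2 (s k.+1 + (tri N - tri (N - t))).
have loop : run (While k (Seq (Dup k k.+1 k.+2) (Seq (Move k.+1 k) (Dec k))))
    (st 0) (st N).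
  apply: exec_while_seq => [t lt_t|]; last by rewrite /st /upd; repeat (case: eqP => /= ?); lia.
  split; first by rewrite /st /upd; repeat (case: eqP => /= ?); lia.
  have triE : tri (N - t) = tri (N - t.+1) + (N - t) by rewrite -subnSK.
  have triN : tri (N - t) <= tri N by apply: leq_tri; lia.
  apply: exec_eq.
    apply: exec_seq; first by apply: exec_split; lia.
    apply: exec_seq; first by apply: exec_move; lia.
    exact: exec_dec.
  by rewrite /st; upd_solve.
apply: exec_eq.
  apply: exec_seq; first by apply: exec_split; lia.
  apply: exec_seq; last by apply: exec_move; lia.
  suff -> : upd (upd (upd s k (s k + s k.+1)) k.+2 (s k.+2 + s k.+1)) k.+1 0
            = st 0 by exact: loop.
  by apply/funext; rewrite /st !subn0 subnn addn0 /N; upd_solve.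
by rewrite /st subnn subn0 /cpair -/N; upd_solve.
Qed.

Definition Unpair k :=
  While k (Seq (Dec k) (If k.+1 (Seq (Dec k.+1) (Inc k.+2))
                                (Seq (Inc k.+2) (Move k.+2 k.+1)))).

Lemma exec_unpair k s : (forall j, k < j -> s j = 0) ->
  run (Unpair k) s (upd (upd (upd s k 0) k.+1 (cunpair (s k)).1)
                        k.+2 (cunpair (s k)).2).
Proof.
move=> sk; pose st t := upd (upd (upd s k (s k - t)) k.+1 (cunpair t).1)
                        k.+2 (cunpair t).2.
have: run (Unpair k) (st 0) (st (s k)).
  apply: exec_while_seq => [t lt_t|].
    split; first by rewrite /st /upd; repeat (case: eqP => /= ?); lia.
    apply: exec_seq; first exact: exec_dec.
    rewrite /st /cunpair iterS -/(cunpair t) /cstep.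
    case: (cunpair t) => [[|a] b] /=.
      apply: exec_if_zero; first by rewrite /upd; repeat (case: eqP => /= ?); lia.
      apply: exec_eq.
        by apply: exec_seq; [exact: exec_inc|apply: exec_move; lia].
      by upd_solve.
    apply: exec_if_pos; first by rewrite /upd; repeat (case: eqP => /= ?); lia.
    apply: exec_eq; first by apply: exec_seq; [exact: exec_dec|exact: exec_inc].
    by upd_solve.
  by rewrite /st /upd; repeat (case: eqP => /= ?); lia.
have -> : st 0 = s.
  by apply/funext; rewrite /st /cunpair /=; upd_solve; rewrite sk; lia.
by move/exec_eq; apply; rewrite /st; upd_solve.
Qed.

End Exec.

Ltac upd_solve := let j := fresh "j" in
  move=> j; rewrite /upd; repeat (case: eqP => /= ?; subst); try lia.

Lemma rcomp_ext f g : rcomp f -> f =1 g -> rcomp g.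
Proof. by move=> Cf /funext <-. Qed.

Lemma rcomp_id : rcomp id.
Proof.
by exists (fun=> Skip) => w k s i o _; apply: exec_eq (exec_skip _ _ _ _) _; upd_solve.
Qed.

Lemma rcomp_comp f g : rcomp f -> rcomp g -> rcomp (fun n => f (g n)).
Proof.
move=> [cf Hf] [cg Hg]; exists (fun k => Seq (cg k) (cf k)) => w k s i o sk.
apply: exec_eq.
  apply: exec_seq; first exact: Hg.
  by apply: Hf => j lt_kj; rewrite /upd; case: eqP; [lia|rewrite sk].
by upd_solve; rewrite ?eqxx.
Qed.

Lemma rcomp_succ : rcomp S.
Proof. by exists Inc => w k s i o _; exact: exec_inc. Qed.

Lemma rcomp_pred : rcomp predn.
Proof. by exists Dec => w k s i o _; exact: exec_dec. Qed.

Lemma rcomp_const n : rcomp (fun=> n).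
Proof.
elim: n => [|n IHn]; last exact: rcomp_comp rcomp_succ IHn.
by exists Clear => w k s i o _; exact: exec_clear.
Qed.

Lemma rcomp_fst : rcomp (fun n => (cunpair n).1).
Proof.
exists (fun k => Seq (Unpair k) (Seq (Move k.+1 k) (Clear k.+2))) => w k s i o sk.
apply: exec_eq.
  apply: exec_seq; first exact: exec_unpair.
  by apply: exec_seq; [apply: exec_move; lia|exact: exec_clear].
by upd_solve; rewrite sk; lia.
Qed.

Lemma rcomp_snd : rcomp (fun n => (cunpair n).2).
Proof.
exists (fun k => Seq (Unpair k) (Seq (Move k.+2 k) (Clear k.+1))) => w k s i o sk.
apply: exec_eq.
  apply: exec_seq; first exact: exec_unpair.
  by apply: exec_seq; [apply: exec_move; lia|exact: exec_clear].
by upd_solve; rewrite sk; lia.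
Qed.

(** The argument is copied to [k.+1] and [k.+2]. First [cf] runs on the upper copy and its result is
    moved below the other one, since [cg] requires zero registers above its own. *)
Lemma rcomp_pair f g : rcomp f -> rcomp g -> rcomp (fun n => cpair (f n) (g n)).
Proof.
move=> [cf Hf] [cg Hg].
exists (fun k => Seq (Dup k k.+1 k.+2) (Seq (cf k.+2) (Seq (Move k.+2 k)
  (Seq (cg k.+1) (Pair k))))) => w k s i o sk.
apply: exec_eq.
  apply: exec_seq; first by apply: exec_split; lia.
  apply: exec_seq; first by apply: Hf => j lt_j; rewrite /upd; repeat (case: eqP => /= ?); rewrite ?sk; lia.
  apply: exec_seq; first by apply: exec_move; lia.
  apply: exec_seq; first by apply: Hg => j lt_j; rewrite /upd; repeat (case: eqP => /= ?); rewrite ?sk; lia.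
  by apply: exec_pair => j lt_j; rewrite /upd; repeat (case: eqP => /= ?); rewrite ?sk; lia.
have [s1 s2] : s k.+1 = 0 /\ s k.+2 = 0 by rewrite !sk.
by upd_solve; rewrite ?s1 ?s2 ?add0n //; try lia.
Qed.

Lemma rcomp_iter f : rcomp f ->
  rcomp (fun n => iter (cunpair n).2 f (cunpair n).1).
Proof.
move=> [c Hc]; exists (fun k => Seq (Unpair k) (Seq (Move k.+2 k)
  (Seq (While k (Seq (Dec k) (c k.+1))) (Move k.+1 k)))) => w k s i o sk.
have [s1 s2] : s k.+1 = 0 /\ s k.+2 = 0 by rewrite !sk.
case nE : (cunpair (s k)) => [a b] /=.
pose st t := upd (upd s k (b - t)) k.+1 (iter t f a).
have loop : exec w (While k (Seq (Dec k) (c k.+1))) (st 0) i o (st b) i o.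
  apply: exec_while_seq => [t lt_t|]; last first.
    by rewrite /st /upd; repeat (case: eqP => /= ?); lia.
  split; first by rewrite /st /upd; repeat (case: eqP => /= ?); lia.
  apply: exec_eq; first apply: exec_seq; first exact: exec_dec.
    by apply: Hc => j lt_j; rewrite /st; rewrite /upd; repeat (case: eqP => /= ?); rewrite ?sk; lia.
  by rewrite /st; upd_solve.
apply: exec_eq.
  apply: exec_seq; first exact: exec_unpair.
  apply: exec_seq; first by apply: exec_move; lia.
  apply: exec_seq; last by apply: exec_move; lia.
  rewrite nE; set u := upd _ _ _; suff -> : u = st 0 by exact: loop.
  by apply/funext; rewrite /u /st; upd_solve.
by rewrite /st; upd_solve.
Qed.

Lemma rcomp_if f g h : rcomp f -> rcomp g -> rcomp h ->
  rcomp (fun n => if f n is 0 then h n else g n).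
Proof.
move=> [cf Hf] [cg Hg] [ch Hh].
exists (fun k => Seq (Dup k k.+1 k.+2) (Seq (cf k.+2) (Seq (Move k.+1 k)
  (If k.+2 (Seq (Clear k.+2) (cg k)) (ch k))))) => w k s i o sk.
have [s1 s2] : s k.+1 = 0 /\ s k.+2 = 0 by rewrite !sk.
apply: exec_seq; first by apply: exec_split; lia.
apply: exec_seq; first by apply: Hf => j lt_j; rewrite /upd; repeat (case: eqP => /= ?); rewrite ?sk; lia.
apply: exec_seq; first by apply: exec_move; lia.
set u := upd _ _ _.
have uE : u =1 upd s k.+2 (f (s k)).
  by rewrite /u; upd_solve; rewrite ?s1 ?s2 ?add0n //; try lia.
case fE : (f (s k)) uE => [|m] uE.
  apply: exec_if_zero; first by rewrite uE /upd eqxx.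
  have -> : u = s by apply/funext=> j; rewrite uE /upd; case: eqP => [->|].
  exact: Hh.
apply: exec_if_pos; first by rewrite uE /upd eqxx.
apply: exec_seq; first exact: exec_clear.
have -> : upd u k.+2 0 = s.
  by apply/funext=> j; rewrite {1}/upd uE /upd; case: eqP => [->|].
exact: Hg.
Qed.

End NatScope.

(** * Computable functions between coded types *)

Class Coded (T : Type) := MkCoded { enc : T -> nat; enc_inj : injective enc }.

#[export] Instance nat_Coded : Coded nat := MkCoded (@inj_id nat).

Lemma nat_of_bool_inj : injective nat_of_bool.
Proof. by move=> [] []. Qed.

#[export] Instance bool_Coded : Coded bool := MkCoded nat_of_bool_inj.

Lemma enc_pair_inj (A B : Type) (CA : Coded A) (CB : Coded B) :
  injective (fun x : A * B => cpair (enc x.1) (enc x.2)).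
Proof.
move=> [a b] [a' b'] /= /(congr1 cunpair); rewrite !cpairK => -[].
by move=> /(@enc_inj _ _ _ _) -> /(@enc_inj _ _ _ _) ->.
Qed.

#[export] Instance pair_Coded (A B : Type) (CA : Coded A) (CB : Coded B) :
  Coded (A * B) := MkCoded (@enc_pair_inj A B CA CB).

Definition enc_seq (T : Type) (CT : Coded T) : seq T -> nat :=
  foldr (fun x n => (cpair (enc x) n).+1) 0%N.

Lemma enc_seq_inj (T : Type) (CT : Coded T) : injective (enc_seq CT).
Proof.
elim=> [|x s IHs] [|y t] //= [] /(congr1 cunpair); rewrite !cpairK => -[].
by move=> /(@enc_inj _ _ _ _) -> /IHs ->.
Qed.

#[export] Instance seq_Coded (T : Type) (CT : Coded T) : Coded (seq T) :=
  MkCoded (@enc_seq_inj T CT).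

(** Only the values of [g] on codes matter, so no program has to recognize whether a number is a
    code. *)
Definition Comp (A B : Type) (CA : Coded A) (CB : Coded B) (f : A -> B) : Prop :=
  exists2 g, rcomp g & forall a, g (enc a) = enc (f a).
Arguments Comp {A B CA CB} f.

Create HintDb comp discriminated.
Hint Constants Opaque : comp.
Hint Variables Opaque : comp.

Section Comp.
Context {A B C T : Type} {CA : Coded A} {CB : Coded B} {CC : Coded C}
  {CT : Coded T}.
Implicit Types a : A.
Local Open Scope nat_scope.

Lemma Comp_ext (f g : A -> B) : Comp f -> f =1 g -> Comp g.
Proof. by move=> Cf /funext <-. Qed.

Lemma Comp_id : Comp (fun a => a).
Proof. by exists id; first exact: rcomp_id. Qed.

Lemma Comp_const (b : B) : Comp (fun a => b).
Proof. by exists (fun=> enc b); first exact: rcomp_const. Qed.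

Lemma Comp_comp (f : B -> C) (g : A -> B) :
  Comp f -> Comp g -> Comp (fun a => f (g a)).
Proof.
move=> [f' Cf ff] [g' Cg gg]; exists (fun n => f' (g' n)).
  exact: rcomp_comp.
by move=> a; rewrite gg ff.
Qed.

Lemma Comp_pair (f : A -> B) (g : A -> C) :
  Comp f -> Comp g -> Comp (fun a => (f a, g a)).
Proof.
move=> [f' Cf ff] [g' Cg gg]; exists (fun n => cpair (f' n) (g' n)).
  exact: rcomp_pair.
by move=> a; rewrite gg ff.
Qed.

Lemma Comp_fst (f : A -> B * C) : Comp f -> Comp (fun a => (f a).1).
Proof.
move=> [f' Cf ff]; exists (fun n => (cunpair (f' n)).1).
  exact: rcomp_comp rcomp_fst Cf.
by move=> a; rewrite ff cpairK.
Qed.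

Lemma Comp_snd (f : A -> B * C) : Comp f -> Comp (fun a => (f a).2).
Proof.
move=> [f' Cf ff]; exists (fun n => (cunpair (f' n)).2).
  exact: rcomp_comp rcomp_snd Cf.
by move=> a; rewrite ff cpairK.
Qed.

Lemma Comp_enc (f : A -> B) : Comp f -> Comp (fun a => enc (f a)).
Proof. by move=> [g Cg gf]; exists g. Qed.

Lemma Comp_succ (f : A -> nat) : Comp f -> Comp (fun a => (f a).+1).
Proof.
move=> [g Cg gf]; exists (fun n => (g n).+1); last by move=> a; rewrite gf.
exact: rcomp_comp rcomp_succ Cg.
Qed.

Lemma Comp_pred (f : A -> nat) : Comp f -> Comp (fun a => (f a).-1).
Proof.
move=> [g Cg gf]; exists (fun n => (g n).-1); last by move=> a; rewrite gf.
exact: rcomp_comp rcomp_pred Cg.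
Qed.

Lemma Comp_if (b : A -> bool) (f g : A -> B) :
  Comp b -> Comp f -> Comp g -> Comp (fun a => if b a then f a else g a).
Proof.
move=> [b' Cb bb] [f' Cf ff] [g' Cg gg].
exists (fun n => if b' n is 0 then g' n else f' n); first exact: rcomp_if.
by move=> a; rewrite bb ff gg /=; case: (b a).
Qed.

Lemma Comp_cons (f : A -> T) (g : A -> seq T) :
  Comp f -> Comp g -> Comp (fun a => f a :: g a).
Proof.
move=> [f' Cf ff] [g' Cg gg]; exists (fun n => (cpair (f' n) (g' n)).+1).
  exact: rcomp_comp rcomp_succ (rcomp_pair Cf Cg).
by move=> a; rewrite ff gg.
Qed.

(** The code of [x :: s] is the successor of the code of the pair [(x, s)], so one predecessor
    yields the argument of [h]. *)
Lemma Comp_match (l : A -> seq T) (z : A -> B) (h : A -> T -> seq T -> B) :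
  Comp l -> Comp z -> Comp (fun t : A * (T * seq T) => h t.1 t.2.1 t.2.2) ->
  Comp (fun a => if l a is x :: s then h a x s else z a).
Proof.
move=> [l' Cl ll] [z' Cz zz] [h' Ch hh].
exists (fun n => if l' n is 0 then z' n else h' (cpair n (l' n).-1)).
  apply: rcomp_if => //; apply: rcomp_comp Ch _; apply: rcomp_pair rcomp_id _.
  exact: rcomp_comp rcomp_pred Cl.
move=> a; rewrite ll zz; case: (l a) => [|x s] //=.
exact: (hh (a, (x, s))).
Qed.

(** Register programs iterate a function without parameters; the code of [a] is therefore carried
    along in the iterated pair. *)
Lemma Comp_iter (n : A -> nat) (F : A -> B -> B) (z : A -> B) :
  Comp n -> Comp (fun t : A * B => F t.1 t.2) -> Comp z ->
  Comp (fun a => iter (n a) (F a) (z a)).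
Proof.
move=> [n' Cn nn] [F' CF FF] [z' Cz zz].
pose st m := cpair (cunpair m).1 (F' m).
exists (fun m => (cunpair (iter (n' m) st (cpair m (z' m)))).2).
  apply: (rcomp_comp (f := fun k => (cunpair k).2)); first exact: rcomp_snd.
  apply: rcomp_ext (rcomp_comp (rcomp_iter _)
    (rcomp_pair (rcomp_pair rcomp_id Cz) Cn)) _; last first.
    by move=> m /=; rewrite cpairK.
  exact: rcomp_pair rcomp_fst CF.
move=> a; rewrite nn zz.
have -> : iter (n a) st (cpair (enc a) (enc (z a)))
    = cpair (enc a) (enc (iter (n a) (F a) (z a))).
  elim: (n a) => //= m ->; rewrite /st cpairK; congr cpair.
  by rewrite -(FF (a, _)).
by rewrite cpairK.
Qed.

End Comp.

Hint Resolve Comp_id Comp_const Comp_pair Comp_fst Comp_snd Comp_succ Comp_pred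
  Comp_if Comp_cons Comp_match Comp_iter : comp.
Ltac comp := solve [eauto 1000 with comp].

Section CompAt.
Context {A B C D : Type} {CA : Coded A} {CB : Coded B} {CC : Coded C}
  {CD : Coded D}.

(** Computability of [f] restated as a rule for any inner function, the form that proof search can
    apply anywhere inside a term. *)
Lemma Comp_at (f : A -> B) : Comp f ->
  forall X (CX : Coded X) (g : X -> A), Comp g -> Comp (fun x => f (g x)).
Proof. by move=> Cf X CX g Cg; exact: Comp_comp Cf Cg. Qed.

Lemma Comp_at2 (f : A -> B -> C) : Comp (fun t : A * B => f t.1 t.2) ->
  forall X (CX : Coded X) (g : X -> A) (h : X -> B), Comp g -> Comp h ->
  Comp (fun x => f (g x) (h x)).
Proof.
move=> Cf X CX g h Cg Ch.
exact: (Comp_comp (g := fun x => (g x, h x)) Cf (Comp_pair Cg Ch)).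
Qed.

Lemma Comp_at3 (f : A -> B -> C -> D) :
  Comp (fun t : A * (B * C) => f t.1 t.2.1 t.2.2) ->
  forall X (CX : Coded X) (g : X -> A) (h : X -> B) (k : X -> C),
  Comp g -> Comp h -> Comp k -> Comp (fun x => f (g x) (h x) (k x)).
Proof.
move=> Cf X CX g h k Cg Ch Ck.
exact: (Comp_comp (g := fun x => (g x, (h x, k x))) Cf
  (Comp_pair Cg (Comp_pair Ch Ck))).
Qed.

End CompAt.

(** * Arithmetic, Boolean operations and lists *)

Section CompNat.
Context {A B : Type} {CA : Coded A} {CB : Coded B}.
Implicit Types (f g : A -> nat) (b c : A -> bool).
Local Open Scope nat_scope.

Lemma Comp_add f g : Comp f -> Comp g -> Comp (fun a => f a + g a).
Proof.
move=> Cf Cg; apply: (Comp_ext (f := fun a => iter (g a) succn (f a))); first by comp.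
by move=> a /=; elim: (g a) => /= [|n ->]; rewrite ?addn0 ?addnS.
Qed.

Lemma Comp_sub f g : Comp f -> Comp g -> Comp (fun a => f a - g a).
Proof.
move=> Cf Cg; apply: (Comp_ext (f := fun a => iter (g a) predn (f a))); first by comp.
by move=> a /=; elim: (g a) => /= [|n ->]; rewrite ?subn0 ?subnS.
Qed.

Lemma Comp_leq f g : Comp f -> Comp g -> Comp (fun a => f a <= g a).
Proof.
move=> Cf Cg; have [h Ch hE] := Comp_sub Cf Cg.
exists (fun n => if h n is 0 then 1 else 0).
  by apply: rcomp_if => //; exact: rcomp_const.
by move=> a; rewrite hE /= /leq; case: (f a - g a).
Qed.

Lemma Comp_negb b : Comp b -> Comp (fun a => ~~ b a).
Proof.
move=> Cb; apply: (Comp_ext (f := fun a => if b a then false else true)).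
  by comp.
by move=> a; case: (b a).
Qed.

Lemma Comp_andb b c : Comp b -> Comp c -> Comp (fun a => b a && c a).
Proof. by move=> Cb Cc; rewrite /andb; comp. Qed.

Lemma Comp_orb b c : Comp b -> Comp c -> Comp (fun a => b a || c a).
Proof. by move=> Cb Cc; rewrite /orb; comp. Qed.

End CompNat.

Hint Resolve Comp_add Comp_sub Comp_leq Comp_negb Comp_andb Comp_orb : comp.

Section CompSeq.
Context {A B T : Type} {CA : Coded A} {CB : Coded B} {CT : Coded T}.
Local Open Scope nat_scope.

Lemma Comp_mul (f g : A -> nat) : Comp f -> Comp g -> Comp (fun a => f a * g a).
Proof.
move=> /Comp_at Cf /Comp_at Cg.
apply: (Comp_ext (f := fun a => iter (g a) (fun n => f a + n) 0)); first by comp.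
by move=> a /=; elim: (g a) => /= [|n ->]; rewrite ?muln0 ?mulnS.
Qed.
End CompSeq.

Hint Resolve Comp_mul : comp.

Section CompSeq.
Context {A B T : Type} {CA : Coded A} {CB : Coded B} {CT : Coded T}.
Local Open Scope nat_scope.

Lemma Comp_exp (f g : A -> nat) : Comp f -> Comp g -> Comp (fun a => f a ^ g a).
Proof.
move=> /Comp_at Cf /Comp_at Cg.
apply: (Comp_ext (f := fun a => iter (g a) (fun n => f a * n) 1)); first by comp.
by move=> a /=; elim: (g a) => //= n ->; rewrite expnS.
Qed.

Lemma Comp_eq (E : eqType) (CE : Coded E) (f g : A -> E) :
  Comp f -> Comp g -> Comp (fun a => f a == g a).
Proof.
move=> /Comp_enc Cf /Comp_enc Cg; apply: (Comp_ext (f := fun a =>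
  (enc (f a) <= enc (g a)) && (enc (g a) <= enc (f a)))); first by comp.
by move=> a; rewrite -eqn_leq; exact: inj_eq (@enc_inj _ _) _ _.
Qed.

(* These instances are stated on the plain types: proof search does not see
   through the canonical [eqType] structures. *)
Lemma Comp_eqn (f g : A -> nat) : Comp f -> Comp g -> Comp (fun a => f a == g a).
Proof. exact: Comp_eq. Qed.

Lemma Comp_eq_bits (f g : A -> seq bool) :
  Comp f -> Comp g -> Comp (fun a => f a == g a).
Proof. exact: Comp_eq. Qed.

Lemma leq_size_enc (s : seq T) : size s <= enc s.
Proof. by elim: s => //= x s /leq_trans; apply; exact: leq_cpairr. Qed.

(** A fold iterates a step that consumes the head of the list and rests on the empty list, so any
    number of rounds not below the length will do. The code of the list is such a number. *)
Lemma Comp_foldl (F : A -> B -> T -> B) (z : A -> B) (l : A -> seq T) :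
  Comp (fun t : A * (B * T) => F t.1 t.2.1 t.2.2) -> Comp z -> Comp l ->
  Comp (fun a => foldl (F a) (z a) (l a)).
Proof.
move=> /Comp_at3 CF Cz Cl; have Cl' := Comp_enc Cl.
pose st a (u : B * seq T) := if u.2 is x :: s then (F a u.1 x, s) else u.
apply: (Comp_ext (f := fun a => (iter (enc (l a)) (st a) (z a, l a)).1)).
  by rewrite /st; comp.
move=> a; move: (leq_size_enc (l a)); move: (enc (l a)) => n.
elim: n (l a) (z a) => [|n IHn] [|x s] y //= le_sn;
  by rewrite -iterS iterSr /= IHn.
Qed.

End CompSeq.

Hint Resolve Comp_foldl : comp.

Section CompSeq.
Context {A B T : Type} {CA : Coded A} {CB : Coded B} {CT : Coded T}.
Local Open Scope nat_scope.

Lemma Comp_rev (l : A -> seq T) : Comp l -> Comp (fun a => rev (l a)).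
Proof.
move=> Cl; apply: (Comp_ext (f := fun a => foldl (fun s x => x :: s) [::] (l a))).
  by comp.
move=> a; rewrite /rev; elim: (l a) [::] => //=.
Qed.

End CompSeq.

Hint Resolve Comp_rev : comp.

Section CompSeq.
Context {A B T : Type} {CA : Coded A} {CB : Coded B} {CT : Coded T}.
Local Open Scope nat_scope.

Lemma Comp_foldr (F : A -> T -> B -> B) (z : A -> B) (l : A -> seq T) :
  Comp (fun t : A * (T * B) => F t.1 t.2.1 t.2.2) -> Comp z -> Comp l ->
  Comp (fun a => foldr (F a) (z a) (l a)).
Proof.
move=> /Comp_at3 CF Cz Cl.
apply: (Comp_ext (f := fun a => foldl (fun y x => F a x y) (z a) (rev (l a)))).
  by comp.
by move=> a; rewrite foldl_rev.
Qed.

End CompSeq.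

Hint Resolve Comp_exp Comp_eqn Comp_eq_bits Comp_foldr : comp.

Section CompSeq.
Context {A B T : Type} {CA : Coded A} {CB : Coded B} {CT : Coded T}.
Local Open Scope nat_scope.

Lemma Comp_cat (l m : A -> seq T) :
  Comp l -> Comp m -> Comp (fun a => l a ++ m a).
Proof.
move=> Cl Cm; apply: (Comp_ext (f := fun a => foldr cons (m a) (l a))); first by comp.
by move=> a; elim: (l a) => //= x s ->.
Qed.
End CompSeq.

Hint Resolve Comp_cat : comp.

Section CompSeq.
Context {A B T : Type} {CA : Coded A} {CB : Coded B} {CT : Coded T}.
Local Open Scope nat_scope.

Lemma Comp_map (F : A -> T -> B) (l : A -> seq T) :
  Comp (fun t : A * T => F t.1 t.2) -> Comp l ->
  Comp (fun a => [seq F a x | x <- l a]).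
Proof.
move=> /Comp_at2 CF Cl.
apply: (Comp_ext (f := fun a => foldr (fun x s => F a x :: s) [::] (l a))).
  by comp.
by move=> a; elim: (l a) => //= x s ->.
Qed.

Lemma Comp_filter (F : A -> T -> bool) (l : A -> seq T) :
  Comp (fun t : A * T => F t.1 t.2) -> Comp l ->
  Comp (fun a => [seq x <- l a | F a x]).
Proof.
move=> /Comp_at2 CF Cl.
apply: (Comp_ext (f := fun a =>
  foldr (fun x s => if F a x then x :: s else s) [::] (l a))).
  by comp.
by move=> a; elim: (l a) => //= x s ->.
Qed.

Lemma Comp_flatten (l : A -> seq (seq T)) : Comp l -> Comp (fun a => flatten (l a)).
Proof. by move=> Cl; rewrite /flatten; comp. Qed.

Lemma Comp_all (F : A -> T -> bool) (l : A -> seq T) :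
  Comp (fun t : A * T => F t.1 t.2) -> Comp l -> Comp (fun a => all (F a) (l a)).
Proof.
move=> /Comp_at2 CF Cl.
apply: (Comp_ext (f := fun a => foldr (fun x b => F a x && b) true (l a))).
  by comp.
by move=> a; elim: (l a) => //= x s ->.
Qed.

Lemma Comp_has (F : A -> T -> bool) (l : A -> seq T) :
  Comp (fun t : A * T => F t.1 t.2) -> Comp l -> Comp (fun a => has (F a) (l a)).
Proof.
move=> /Comp_at2 CF Cl.
apply: (Comp_ext (f := fun a => foldr (fun x b => F a x || b) false (l a))).
  by comp.
by move=> a; elim: (l a) => //= x s ->.
Qed.

Lemma Comp_size (l : A -> seq T) : Comp l -> Comp (fun a => size (l a)).
Proof.
move=> Cl; apply: (Comp_ext (f := fun a => foldr (fun=> succn) 0 (l a))); first by comp.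
by move=> a; elim: (l a) => //= x s ->.
Qed.

Lemma Comp_drop (n : A -> nat) (l : A -> seq T) :
  Comp n -> Comp l -> Comp (fun a => drop (n a) (l a)).
Proof.
move=> Cn Cl.
have /Comp_at Cb : Comp (fun s : seq T => behead s) by rewrite /behead; comp.
apply: (Comp_ext (f := fun a => iter (n a) behead (l a))); first by comp.
move=> a; elim: (n a) (l a) => [|k IHk] s; rewrite ?drop0 // iterSr IHk.
by case: s.
Qed.

End CompSeq.

Hint Resolve Comp_size Comp_drop : comp.

Section CompSeq.
Context {A B T : Type} {CA : Coded A} {CB : Coded B} {CT : Coded T}.
Local Open Scope nat_scope.

Lemma Comp_take (n : A -> nat) (l : A -> seq T) :
  Comp n -> Comp l -> Comp (fun a => take (n a) (l a)).
Proof.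
move=> Cn Cl.
apply: (Comp_ext (f := fun a => rev (drop (size (l a) - n a) (rev (l a))))).
  by comp.
by move=> a; rewrite -rev_take revK.
Qed.

Lemma Comp_nth (x0 : T) (l : A -> seq T) (n : A -> nat) :
  Comp l -> Comp n -> Comp (fun a => nth x0 (l a) (n a)).
Proof.
move=> Cl Cn; apply: (Comp_ext (f := fun a => head x0 (drop (n a) (l a)))).
  by rewrite /head; comp.
by move=> a; rewrite -nth0 nth_drop addn0.
Qed.

Lemma Comp_iota (m n : A -> nat) : Comp m -> Comp n -> Comp (fun a => iota (m a) (n a)).
Proof.
move=> Cm Cn; apply: (Comp_ext (f := fun a =>
   (iter (n a) (fun t => (t.1.-1, t.1.-1 :: t.2)) (m a + n a, [::])).2)).
  by comp.
move=> a; rewrite -[RHS]cats0; move: [::].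
elim: (n a) => [|k IHk] s //; rewrite iterSr addnS -[k.+1]addn1 iotaD -catA.
exact: IHk.
Qed.

Lemma Comp_nseq (n : A -> nat) (x : A -> T) :
  Comp n -> Comp x -> Comp (fun a => nseq (n a) (x a)).
Proof.
move=> Cn /Comp_at Cx; apply: (Comp_ext (f := fun a => iter (n a) (cons (x a)) [::])).
  by comp.
by move=> a; elim: (n a) => //= k ->.
Qed.

Lemma Comp_rcons (l : A -> seq T) (x : A -> T) :
  Comp l -> Comp x -> Comp (fun a => rcons (l a) (x a)).
Proof.
move=> Cl Cx; apply: (Comp_ext (f := fun a => l a ++ [:: x a])); first by comp.
by move=> a; rewrite cats1.
Qed.

End CompSeq.

Hint Resolve Comp_map Comp_filter Comp_flatten Comp_all Comp_has
  Comp_take Comp_nth Comp_iota Comp_nseq Comp_rcons : comp.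

(** * Unbounded search on the input stream *)

Section Search.
Variables (cG : nat -> prog).
Local Open Scope nat_scope.

(* Register 0 is the flag of the search loop, register 1 receives an input bit,
   register 2 holds the code of the reversed list of the bits read so far and
   register 3 the list of the outputs found for it. *)
Definition Print :=
  While 3 (Seq (Dec 3) (Seq (Unpair 3)
    (Seq (If 4 (Seq (Dec 4) (Out true)) (Out false)) (Move 5 3)))).

Definition Search :=
  While 0 (Seq (Dup 2 3 4) (Seq (Move 4 2) (Seq (cG 3)
    (If 3 (Dec 0) (Seq (Read 1) (Seq (Pair 1) (Seq (Move 1 2) (Inc 2)))))))).

Definition SearchPrint :=
  Seq (Inc 0) (Seq Search (Seq (Dec 3) (Seq (Unpair 3)
    (Seq (Clear 5) (Seq (Move 4 3) Print))))).

Ltac reg_solve := move=> j; rewrite /upd; repeat (case: eqP => /= ?; subst); try lia.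

Lemma exec_print w (s : nat -> nat) i o (u : seq bool) :
  (forall j, 3 < j -> s j = 0) -> s 3 = enc u ->
  exec w Print s i o (upd s 3 0) i (o ++ u).
Proof.
elim: u s o => [|b u IHu] s o sk s3.
  rewrite cats0; have -> : upd s 3 0 = s by apply/funext; reg_solve.
  exact: exec_while_zero.
apply: (@exec_while_pos _ _ _ _ _ _ (upd s 3 (enc u)) i (rcons o b)).
- by rewrite s3.
- apply: exec_seq; first exact: exec_dec.
  apply: exec_seq; first by apply: exec_unpair => j lt_j; rewrite /upd gtn_eqF // sk.
  have E : cunpair (upd s 3 (s 3).-1 3) = (enc b, enc u).
    by rewrite /upd eqxx s3 /= cpairK.
  rewrite E /=; set s' := upd _ 5 _.
  apply: (@exec_seq _ _ _ _ _ _ (upd s' 4 0) i (rcons o b)).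
    case: b @s' {E s3} => s'.
      apply: exec_if_pos => //; apply: exec_seq; first exact: exec_dec.
      exact: exec_out.
    apply: exec_if_zero => //; have -> : upd s' 4 0 = s'.
      by apply/funext; rewrite /s'; reg_solve.
    exact: exec_out.
  apply: exec_eq; first by apply: exec_move.
  by rewrite /s'; reg_solve; rewrite ?sk.
- rewrite -cat_rcons; have -> : upd s 3 0 = upd (upd s 3 (enc u)) 3 0.
    by apply/funext; reg_solve.
  by apply: IHu => // j lt_j; rewrite /upd gtn_eqF // sk.
Qed.

Variables (g : nat -> nat) (G : seq bool -> seq (seq bool)).
Hypotheses (cGg : computes cG g) (gG : forall s : seq bool, g (enc s) = enc (G s)).
Variable w : nat -> bool.
Let word t : seq bool := rev (mkseq w t).
Let regs (f t : nat) (v : seq (seq bool)) : nat -> nat :=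
  upd (upd (upd (fun=> 0) 0 f) 2 (enc (word t))) 3 (enc v).

(** Induction on the number [m] of bits left before a length at which [G] is known to succeed; the
    search may succeed earlier, at a length [s]. *)
Lemma exec_search m t : G (word (t + m)) <> [::] ->
  exists s u l, G (word s) = u :: l /\
    exec w Search (regs 1 t [::]) t [::] (regs 0 s (u :: l)) s [::].
Proof.
(* One round up to the test on register 3, common to the rounds that stop and those that go on. *)
have body t' r i : exec w (If 3 (Dec 0)
      (Seq (Read 1) (Seq (Pair 1) (Seq (Move 1 2) (Inc 2)))))
      (regs 1 t' (G (word t'))) t' [::] r i [::] ->
    exec w (Seq (Dup 2 3 4) (Seq (Move 4 2) (Seq (cG 3)
    (If 3 (Dec 0) (Seq (Read 1) (Seq (Pair 1) (Seq (Move 1 2) (Inc 2))))))))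
    (regs 1 t' [::]) t' [::] r i [::].
  move=> ex; apply: exec_seq; first exact: exec_split.
  apply: exec_seq; first exact: exec_move.
  set s := upd _ 4 0; have sE : s = upd (regs 1 t' [::]) 3 (enc (word t')).
    by apply/funext; rewrite /s /regs; reg_solve.
  apply: exec_seq.
    by apply: cGg => j lt_j; rewrite sE /regs /upd; repeat (case: eqP => /= ?); lia.
  rewrite sE; set s' := upd _ 3 _; suff -> : s' = regs 1 t' (G (word t')) by [].
  by apply/funext; rewrite /s' /regs; reg_solve; exact: gG.
elim: m t => [|m IHm] t; rewrite ?addn0 -?addSnnS => Gt.
  case GE : (G (word t)) Gt => [|u l] // _; exists t, u, l; split=> //.
  apply: (@exec_while_pos _ _ _ _ _ _ (regs 0 t (u :: l)) t [::]) => //.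
    apply: body; rewrite GE; apply: exec_if_pos => //.
    by apply: exec_eq; [exact: exec_dec|rewrite /regs; reg_solve].
  exact: exec_while_zero.
case GE : (G (word t)) => [|u l]; last first.
  exists t, u, l; split=> //.
  apply: (@exec_while_pos _ _ _ _ _ _ (regs 0 t (u :: l)) t [::]) => //.
    apply: body; rewrite GE; apply: exec_if_pos => //.
    by apply: exec_eq; [exact: exec_dec|rewrite /regs; reg_solve].
  exact: exec_while_zero.
have [s [u [l [Gs ex]]]] := IHm _ Gt; exists s, u, l; split=> //.
apply: (@exec_while_pos _ _ _ _ _ _ (regs 1 t.+1 [::]) t.+1 [::]) => //.
apply: body; rewrite GE; apply: exec_if_zero => //.
apply: exec_eq.
  apply: exec_seq; first exact: exec_read.
  apply: exec_seq.
    by apply: exec_pair => j lt_j; rewrite /regs /upd; repeat (case: eqP => /= ?); lia.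
  apply: exec_seq; first exact: exec_move.
  exact: exec_inc.
(* Words are kept reversed so that reading a bit is a [cons]: one pairing and one successor. *)
have wordS : word t.+1 = w t :: word t by rewrite /word mkseqS rev_rcons.
by rewrite /regs wordS /=; reg_solve.
Qed.

Lemma exec_search_print m : G (word m) <> [::] ->
  exists s u l, G (word s) = u :: l /\
    exists r, exec w SearchPrint (fun=> 0) 0 [::] r s u.
Proof.
move=> /(@exec_search m 0)[s [u [l [Gs ex]]]]; exists s, u, l; split=> //.
eexists; apply: exec_seq; first exact: exec_inc.
apply: exec_seq.
  set r := upd _ _ _; suff -> : r = regs 1 0 [::] by exact: ex.
  by apply/funext; rewrite /r /regs; reg_solve.
apply: exec_seq; first exact: exec_dec.
apply: exec_seq.
  by apply: exec_unpair => j lt_j; rewrite /regs /upd; repeat (case: eqP => /= ?); lia.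
apply: exec_seq; first exact: exec_clear.
apply: exec_seq; first exact: exec_move.
apply: (@exec_print _ _ _ [::] u).
  by move=> j lt_j; rewrite /regs /upd; repeat (case: eqP => /= ?); lia.
by rewrite /regs /upd /= cpairK.
Qed.

End Search.

Lemma search_machine (G : seq bool -> seq (seq bool)) : Comp G ->
  exists M : machine, forall w : nat -> bool,
    (exists s, G (rev (mkseq w s)) <> [::]) ->
    exists s u l, G (rev (mkseq w s)) = u :: l /\ halts_with M w u.
Proof.
move=> [g [cG cGg] gG]; exists (machine_of_prog (SearchPrint cG)) => w [m Gm].
have [s [u [l [Gs [r ex]]]]] := exec_search_print cGg gG Gm.
by exists s, u, l; split=> //; exact: machine_of_progP ex.
Qed.

(** * The certificate checker *)

(* The triple [((a, b), c)] stands for the rational number [(a - b) / (c + 1)]. *)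
Notation Q := (nat * nat * nat)%type.

Section Checker.
Variable d : nat.
Local Open Scope nat_scope.

Definition qadd (a b : Q) : Q :=
  ((a.1.1 * b.2.+1 + b.1.1 * a.2.+1, a.1.2 * b.2.+1 + b.1.2 * a.2.+1),
   (a.2.+1 * b.2.+1).-1).
Definition qmul (a b : Q) : Q :=
  ((a.1.1 * b.1.1 + a.1.2 * b.1.2, a.1.1 * b.1.2 + a.1.2 * b.1.1),
   (a.2.+1 * b.2.+1).-1).
Definition qopp (a : Q) : Q := ((a.1.2, a.1.1), a.2).
Definition qle (a b : Q) : bool :=
  a.1.1 * b.2.+1 + b.1.2 * a.2.+1 <= b.1.1 * a.2.+1 + a.1.2 * b.2.+1.
Definition qabs (a : Q) : Q := if a.1.2 <= a.1.1 then a else qopp a.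
Definition qnat (n : nat) : Q := ((n, 0), 0).
Definition qinv (n : nat) : Q := ((1, 0), n.-1).
Definition qsum (s : seq Q) : Q := foldr qadd (qnat 0) s.
Definition qprod (s : seq Q) : Q := foldr qmul (qnat 1) s.
Definition qexp (a : Q) (n : nat) : Q := iter n (qmul a) (qnat 1).

(* Sign, numerator and denominator, in the order of [code_rat].  Signs are
   numbers rather than booleans so that every number encodes a certificate. *)
Definition code_rawrat (r : nat * nat * nat) : seq bool :=
  (0 < r.1.1) :: code_nat r.1.2 ++ false :: code_nat r.2.
Definition qraw (r : nat * nat * nat) : Q :=
  if 0 < r.1.1 then ((0, r.1.2), r.2.-1) else ((r.1.2, 0), r.2.-1).

Notation rawpoly := (seq (seq nat * (nat * nat * nat))).
Definition code_rawpoly (p : rawpoly) : seq bool :=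
  code_seq (fun m => flatten [seq code_nat e | e <- m.1] ++ code_rawrat m.2) p.
Definition rawpoly_ok (p : rawpoly) : bool := all (fun m => size m.1 == d) p.

Notation ratpoly := (seq (seq nat * Q)).
Definition qpoly_of_raw (p : rawpoly) : ratpoly := [seq (m.1, qraw m.2) | m <- p].
Definition qmono (e : seq nat) (x : seq Q) : Q :=
  qprod [seq qexp (nth (qnat 0) x i) (nth 0 e i) | i <- iota 0 d].
Definition qeval (p : ratpoly) (x : seq Q) : Q :=
  qsum [seq qmul m.2 (qmono m.1 x) | m <- p].
(** If variable [j] has exponent 0, truncated subtraction leaves the monomial as it is, and the
    factor [nth 0 m.1 j] cancels it. *)
Definition qderiv (j : nat) (p : ratpoly) : ratpoly :=
  [seq ([seq nth 0 m.1 i - (if i == j then 1 else 0) | i <- iota 0 d],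
        qmul (qnat (nth 0 m.1 j)) m.2) | m <- p].
(** A product of [D] coordinates of absolute value at most 1 is [D]-Lipschitz for the maximum norm,
    so the coefficients weighted by total degrees give a Lipschitz constant on the unit ball. *)
Definition qlip (p : ratpoly) : Q :=
  qsum [seq qmul (qabs m.2) (qnat (sumn [seq nth 0 m.1 i | i <- iota 0 d])) | m <- p].

(* The corner with coordinates [+- (2 a + 1) / 2 ^ e], followed by the
   preconditioning matrix.  Odd numerators make these fractions reduced. *)
Notation qcube := (seq (nat * nat) * seq (seq Q))%type.
Definition qcorner (e : nat) (c : qcube) (i : nat) : Q :=
  let b := nth (0, 0) c.1 i in
  if 0 < b.1 then ((0, b.2 * 2 + 1), (2 ^ e).-1)
  else ((b.2 * 2 + 1, 0), (2 ^ e).-1).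
Definition qcenter (e n : nat) (c : qcube) : seq Q :=
  [seq qadd (qcorner e c i) (qinv (2 * n)) | i <- iota 0 d].
Definition qentry (c : qcube) (i l : nat) : Q := nth (qnat 0) (nth [::] c.2 i) l.

Definition cube_in_ball (e n : nat) (c : qcube) : bool :=
  all (fun i => qle (qopp (qnat 1)) (qcorner e c i) &&
                qle (qadd (qcorner e c i) (qinv n)) (qnat 1)) (iota 0 d).

(** The first term is the defect of the matrix as an inverse of the approximate Jacobian at the
    center. The second covers the rest of the cube: [2 ^- k] for the name, and half a side times a
    Lipschitz constant for the distance to the center. With entries at most [1 / (2 d)], the [d]
    terms of each coordinate add up to the contraction factor 1/2. *)
Definition newton_jacobian (k : nat) (P : seq rawpoly) (e n : nat) (c : qcube) : bool :=
  all (fun i : nat => all (fun j : nat =>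
    qle (qadd
      (qabs (qadd (qnat (if i == j then 1 else 0)) (qopp (qsum
         [seq qmul (qentry c i l)
            (qeval (qderiv j (qpoly_of_raw (nth [::] P l))) (qcenter e n c))
         | l <- iota 0 d]))))
      (qsum [seq qmul (qabs (qentry c i l)) (qadd (qinv (2 ^ k))
          (qmul (qinv (2 * n)) (qlip (qderiv j (qpoly_of_raw (nth [::] P l))))))
         | l <- iota 0 d]))
      (qinv (2 * d)))
    (iota 0 d)) (iota 0 d).

(** Why [1 / (4 n)]: contraction by 1/2 brings the image of the cube within a quarter of the side
    from the image of the center; if the center itself moves by at most another quarter, the cube is
    mapped into itself. *)
Definition newton_value (k : nat) (P : seq rawpoly) (e n : nat) (c : qcube) : bool :=
  all (fun i => qle (qadd
      (qabs (qsum [seq qmul (qentry c i l)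
            (qeval (qpoly_of_raw (nth [::] P l)) (qcenter e n c))
         | l <- iota 0 d]))
      (qsum [seq qmul (qabs (qentry c i l)) (qinv (2 ^ k)) | l <- iota 0 d]))
      (qinv (4 * n)))
    (iota 0 d).

(** Positions are compared rather than elements: a cube listed twice fails the test, so that
    [size C] can serve as the number of zeros. *)
Definition cubes_separated (e n : nat) (C : seq qcube) : bool :=
  all (fun t : nat => all (fun u : nat => (t == u) || has (fun i =>
      ~~ qle (qabs (qadd (qcorner e (nth ([::], [::]) C t) i)
                   (qopp (qcorner e (nth ([::], [::]) C u) i)))) (qinv n))
    (iota 0 d)) (iota 0 (size C))) (iota 0 (size C)).

Definition grid_line (m : nat) : seq Q :=
  [seq ((t, m), m.-1) | t <- iota 0 (2 * m).+1].
Definition grid (m : nat) : seq (seq Q) :=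
  iter d (fun L => flatten [seq [seq a :: l | l <- L] | a <- grid_line m]) [:: [::]].

Definition grid_point_ok (k : nat) (P : seq rawpoly) (m e n : nat)
    (C : seq qcube) (g : seq Q) : bool :=
  has (fun l => ~~ qle (qabs (qeval (qpoly_of_raw (nth [::] P l)) g))
      (qadd (qinv (2 ^ k)) (qmul (qlip (qpoly_of_raw (nth [::] P l))) (qinv m))))
    (iota 0 d) ||
  has (fun c => all (fun i =>
      qle (qadd (qabs (qadd (nth (qnat 0) g i)
                            (qopp (nth (qnat 0) (qcenter e n c) i)))) (qinv m))
          (qinv (2 * n)))
    (iota 0 d)) C.

(* [((n0, P), ((k1, k2), ((n, m), (e, C))))], where [P] starts the name of the
   function, its members number [k1] and [k2] approximate the Jacobian matrix
   and the values of the function, and [1 / m] is the mesh of the grid. *)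
Notation certificate := ((nat * seq (seq rawpoly)) *
  ((nat * nat) * ((nat * nat) * (nat * seq qcube))))%type.

Definition code_input (x : nat * seq (seq rawpoly)) : seq bool :=
  code_nat x.1 ++ flatten [seq flatten [seq code_rawpoly p | p <- v] | v <- x.2].

(** The code of a monomial does not record its number of exponents, nor that of a polynomial map its
    number of components; fixing both to [d] makes concatenated codes uniquely readable. *)
Definition input_ok (x : nat * seq (seq rawpoly)) : bool :=
  all (fun v => (size v == d) && all rawpoly_ok v) x.2.

Definition checked (n0 : nat) (P1 P2 : seq rawpoly) (k1 k2 n m e : nat)
    (C : seq qcube) : bool :=
  [&& 0 < n, n0 <= n, 0 < m,
      all (fun c => [&& cube_in_ball e n c, newton_jacobian k1 P1 e n c
                      & newton_value k2 P2 e n c]) C,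
      cubes_separated e n C & all (grid_point_ok k2 P2 m e n C) (grid m)].

Definition check (w : seq bool) (y : certificate) : bool :=
  let x := y.1 in let k := y.2.1 in let n := y.2.2.1.1 in
  let m := y.2.2.1.2 in let e := y.2.2.2.1 in let C := y.2.2.2.2 in
  [&& take (size (code_input x)) (rev w) == code_input x,
      input_ok x, k.1 < size x.2, k.2 < size x.2 &
      checked x.1 (nth [::] x.2 k.1) (nth [::] x.2 k.2) k.1 k.2 n m e C].

Definition code_qcube (e n : nat) (c : qcube) : seq bool :=
  flatten [seq (0 < (nth (0, 0) c.1 i).1) ::
     code_nat ((nth (0, 0) c.1 i).2 * 2 + 1) ++ false :: code_nat (2 ^ e)
     | i <- iota 0 d] ++
  false :: code_nat 1 ++ false :: code_nat n.

Definition output_of (y : certificate) : seq bool :=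
  let n := y.2.2.1.1 in let e := y.2.2.2.1 in let C := y.2.2.2.2 in
  code_nat n ++ code_nat (size C) ++ code_seq (code_qcube e n) C.

(** * Computability of the checker *)

Lemma Comp_qadd0 : Comp (fun t => qadd t.1 t.2). Proof. by rewrite /qadd; comp. Qed.
Definition Comp_qadd := Comp_at2 Comp_qadd0.
Lemma Comp_qmul0 : Comp (fun t => qmul t.1 t.2). Proof. by rewrite /qmul; comp. Qed.
Definition Comp_qmul := Comp_at2 Comp_qmul0.
Lemma Comp_qle0 : Comp (fun t => qle t.1 t.2). Proof. by rewrite /qle; comp. Qed.
Definition Comp_qle := Comp_at2 Comp_qle0.
Lemma Comp_qopp0 : Comp qopp. Proof. by rewrite /qopp; comp. Qed.
Definition Comp_qopp := Comp_at Comp_qopp0.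
Hint Resolve Comp_qadd Comp_qmul Comp_qle Comp_qopp : comp.
Lemma Comp_qabs0 : Comp qabs. Proof. by rewrite /qabs; comp. Qed.
Definition Comp_qabs := Comp_at Comp_qabs0.
Lemma Comp_qnat0 : Comp qnat. Proof. by rewrite /qnat; comp. Qed.
Definition Comp_qnat := Comp_at Comp_qnat0.
Lemma Comp_qinv0 : Comp qinv. Proof. by rewrite /qinv; comp. Qed.
Definition Comp_qinv := Comp_at Comp_qinv0.
Lemma Comp_qsum0 : Comp qsum. Proof. by rewrite /qsum; comp. Qed.
Definition Comp_qsum := Comp_at Comp_qsum0.
Lemma Comp_qprod0 : Comp qprod. Proof. by rewrite /qprod; comp. Qed.
Definition Comp_qprod := Comp_at Comp_qprod0.
Lemma Comp_qexp0 : Comp (fun t => qexp t.1 t.2). Proof. by rewrite /qexp; comp. Qed.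
Definition Comp_qexp := Comp_at2 Comp_qexp0.
Hint Resolve Comp_qabs Comp_qnat Comp_qinv Comp_qsum Comp_qprod Comp_qexp : comp.

Section CompChecker.
Context {X : Type} {CX : Coded X}.

Lemma Comp_code_nat (n : X -> nat) : Comp n -> Comp (fun x => code_nat (n x)).
Proof. by move=> /Comp_at Cn; rewrite /code_nat; comp. Qed.
Hint Resolve Comp_code_nat : comp.

Lemma Comp_code_seq (T : Type) (CT : Coded T) (F : X -> T -> seq bool)
    (s : X -> seq T) :
  Comp (fun t : X * T => F t.1 t.2) -> Comp s ->
  Comp (fun x => code_seq (F x) (s x)).
Proof. by move=> /Comp_at2 CF /Comp_at Cs; rewrite /code_seq; comp. Qed.

Lemma Comp_code_rawrat (r : X -> nat * nat * nat) :
  Comp r -> Comp (fun x => code_rawrat (r x)).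
Proof. by move=> /Comp_at Cr; rewrite /code_rawrat; comp. Qed.

Lemma Comp_qraw (r : X -> nat * nat * nat) : Comp r -> Comp (fun x => qraw (r x)).
Proof. by move=> /Comp_at Cr; rewrite /qraw; comp. Qed.

Lemma Comp_qmono (e : X -> seq nat) (x : X -> seq Q) :
  Comp e -> Comp x -> Comp (fun t => qmono (e t) (x t)).
Proof. by move=> /Comp_at Ce /Comp_at Cx; rewrite /qmono; comp. Qed.

Lemma Comp_qlip (p : X -> ratpoly) : Comp p -> Comp (fun x => qlip (p x)).
Proof. by move=> /Comp_at Cp; rewrite /qlip /sumn; comp. Qed.

Lemma Comp_qderiv (j : X -> nat) (p : X -> ratpoly) :
  Comp j -> Comp p -> Comp (fun x => qderiv (j x) (p x)).
Proof. by move=> /Comp_at Cj /Comp_at Cp; rewrite /qderiv; comp. Qed.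

Lemma Comp_qcorner (e : X -> nat) (c : X -> qcube) (i : X -> nat) :
  Comp e -> Comp c -> Comp i -> Comp (fun x => qcorner (e x) (c x) (i x)).
Proof.
by move=> /Comp_at Ce /Comp_at Cc /Comp_at Ci; rewrite /qcorner; cbv zeta; comp.
Qed.

Lemma Comp_qentry (c : X -> qcube) (i l : X -> nat) :
  Comp c -> Comp i -> Comp l -> Comp (fun x => qentry (c x) (i x) (l x)).
Proof. by move=> /Comp_at Cc /Comp_at Ci /Comp_at Cl; rewrite /qentry; comp. Qed.

Lemma Comp_input_ok (x : X -> nat * seq (seq rawpoly)) :
  Comp x -> Comp (fun t => input_ok (x t)).
Proof. by move=> /Comp_at Cx; rewrite /input_ok /rawpoly_ok; comp. Qed.

End CompChecker.
Hint Resolve Comp_code_nat Comp_code_seq Comp_code_rawrat Comp_qraw Comp_qmono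
  Comp_qlip Comp_qderiv Comp_qcorner Comp_qentry Comp_input_ok : comp.

Section CompChecker.
Context {X : Type} {CX : Coded X}.

Lemma Comp_qpoly_of_raw (p : X -> rawpoly) :
  Comp p -> Comp (fun x => qpoly_of_raw (p x)).
Proof. by move=> /Comp_at Cp; rewrite /qpoly_of_raw; comp. Qed.

Lemma Comp_qeval (p : X -> ratpoly) (x : X -> seq Q) :
  Comp p -> Comp x -> Comp (fun t => qeval (p t) (x t)).
Proof. by move=> /Comp_at Cp /Comp_at Cx; rewrite /qeval; comp. Qed.

Lemma Comp_code_input (x : X -> nat * seq (seq rawpoly)) :
  Comp x -> Comp (fun t => code_input (x t)).
Proof. by move=> /Comp_at Cx; rewrite /code_input /code_rawpoly; comp. Qed.

Lemma Comp_qcenter (e n : X -> nat) (c : X -> qcube) :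
  Comp e -> Comp n -> Comp c -> Comp (fun x => qcenter (e x) (n x) (c x)).
Proof. by move=> /Comp_at Ce /Comp_at Cn /Comp_at Cc; rewrite /qcenter; comp. Qed.

Lemma Comp_grid_line (m : X -> nat) : Comp m -> Comp (fun x => grid_line (m x)).
Proof. by move=> /Comp_at Cm; rewrite /grid_line; comp. Qed.

End CompChecker.
Hint Resolve Comp_qpoly_of_raw Comp_qeval Comp_code_input Comp_qcenter
  Comp_grid_line : comp.

Section CompChecker.
Context {X : Type} {CX : Coded X}.
Variables (k m e n : X -> nat) (P : X -> seq rawpoly) (c : X -> qcube)
  (C : X -> seq qcube) (g : X -> seq Q).

Lemma Comp_grid : Comp m -> Comp (fun x => grid (m x)).
Proof. by move=> /Comp_at Cm; rewrite /grid; comp. Qed.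

Lemma Comp_cube_in_ball : Comp e -> Comp n -> Comp c ->
  Comp (fun x => cube_in_ball (e x) (n x) (c x)).
Proof.
by move=> /Comp_at Ce /Comp_at Cn /Comp_at Cc; rewrite /cube_in_ball; comp.
Qed.

Lemma Comp_newton_jacobian : Comp k -> Comp P -> Comp e -> Comp n -> Comp c ->
  Comp (fun x => newton_jacobian (k x) (P x) (e x) (n x) (c x)).
Proof.
move=> /Comp_at Ck /Comp_at CP /Comp_at Ce /Comp_at Cn /Comp_at Cc.
by rewrite /newton_jacobian; comp.
Qed.

Lemma Comp_newton_value : Comp k -> Comp P -> Comp e -> Comp n -> Comp c ->
  Comp (fun x => newton_value (k x) (P x) (e x) (n x) (c x)).
Proof.
move=> /Comp_at Ck /Comp_at CP /Comp_at Ce /Comp_at Cn /Comp_at Cc.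
by rewrite /newton_value; comp.
Qed.

Lemma Comp_cubes_separated : Comp e -> Comp n -> Comp C ->
  Comp (fun x => cubes_separated (e x) (n x) (C x)).
Proof.
by move=> /Comp_at Ce /Comp_at Cn /Comp_at CC; rewrite /cubes_separated; comp.
Qed.

Lemma Comp_grid_point_ok :
  Comp k -> Comp P -> Comp m -> Comp e -> Comp n -> Comp C -> Comp g ->
  Comp (fun x => grid_point_ok (k x) (P x) (m x) (e x) (n x) (C x) (g x)).
Proof.
move=> /Comp_at Ck /Comp_at CP /Comp_at Cm /Comp_at Ce /Comp_at Cn /Comp_at CC.
by move=> /Comp_at Cg; rewrite /grid_point_ok; comp.
Qed.

Lemma Comp_code_qcube : Comp e -> Comp n -> Comp c ->
  Comp (fun x => code_qcube (e x) (n x) (c x)).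
Proof.
by move=> /Comp_at Ce /Comp_at Cn /Comp_at Cc; rewrite /code_qcube; comp.
Qed.

End CompChecker.
Hint Resolve Comp_grid Comp_cube_in_ball Comp_newton_jacobian Comp_newton_value
  Comp_cubes_separated Comp_grid_point_ok Comp_code_qcube : comp.

Lemma Comp_check : Comp (fun t : seq bool * certificate => check t.1 t.2).
Proof.
by rewrite /check /checked; cbv zeta; comp.
Qed.

Lemma Comp_output_of : Comp output_of.
Proof. by rewrite /output_of; cbv zeta; comp. Qed.

End Checker.

(** * Codes of the input and of certificates *)

Notation rawpoly := (seq (seq nat * (nat * nat * nat))).
Notation ratpoly := (seq (seq nat * Q)).
Notation qcube := (seq (nat * nat) * seq (seq Q))%type.
Notation certificate := ((nat * seq (seq rawpoly)) *
  ((nat * nat) * ((nat * nat) * (nat * seq qcube))))%type.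

Definition enc_surj (T : Type) (CT : Coded T) : Prop := forall n, exists x : T, enc x = n.

Lemma enc_surj_nat : enc_surj nat_Coded.
Proof. by move=> n; exists n. Qed.

Lemma enc_surj_pair (A B : Type) (CA : Coded A) (CB : Coded B) :
  enc_surj CA -> enc_surj CB -> enc_surj (pair_Coded CA CB).
Proof.
move=> sA sB n; have [[a aE] [b bE]] := (sA (cunpair n).1, sB (cunpair n).2).
by exists (a, b); rewrite /= aE bE cunpairK.
Qed.

Lemma enc_surj_seq (T : Type) (CT : Coded T) : enc_surj CT -> enc_surj (seq_Coded CT).
Proof.
move=> sT; elim/ltn_ind=> -[|n] IHn; first by exists [::].
have [x xE] := sT (cunpair n).1.
have [|s sE] := IHn (cunpair n).2; first by rewrite -{2}[n]cunpairK ltnS leq_cpairr.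
by exists (x :: s); rewrite /= xE; move: sE => /= ->; rewrite cunpairK.
Qed.

(** Since [enc] is a bijection on certificates, decoding is the identity on codes, and enumerating
    certificates amounts to counting. *)
Lemma certificate_of_nat : exists2 dec : nat -> certificate,
  Comp dec & forall y, dec (enc y) = y.
Proof.
have surj : enc_surj (_ : Coded certificate).
  by repeat first [apply: enc_surj_pair | apply: enc_surj_seq | exact: enc_surj_nat].
have [dec decE] := boolp.choice surj.
exists dec; last by move=> y; apply: enc_inj; rewrite decE.
by exists id; [exact: rcomp_id|move=> n; rewrite decE].
Qed.

Lemma check_extend d (w : nat -> bool) s t (y : certificate) : (s <= t)%N ->
  check d (rev (mkseq w s)) y -> check d (rev (mkseq w t)) y.
Proof.
move=> le_st; rewrite /check !revK => /and5P[/eqP pre -> -> -> ->].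
rewrite !andbT; have le_u : (size (code_input y.1) <= s)%N.
  by rewrite -[in leqLHS]pre size_take_min size_mkseq geq_minr.
apply/eqP; rewrite -[RHS]pre; apply: (@eq_from_nth _ false).
  by rewrite !size_takel ?size_mkseq // (leq_trans le_u).
move=> i; rewrite size_takel ?size_mkseq ?(leq_trans le_u) // => lt_i.
by rewrite !nth_take // !nth_mkseq //; lia.
Qed.

(** Dovetailing: the number of bits read also bounds the codes that are tried. Each round is finite,
    every certificate is tried from some round on, and by [check_extend] a certificate once
    acceptable still is then. *)
Lemma checker_machine d : exists M : machine, forall w : nat -> bool,
  (exists y s, check d (rev (mkseq w s)) y) ->
  exists y s, check d (rev (mkseq w s)) y /\ halts_with M w (output_of d y).
Proof.
have [dec Cdec decK] := certificate_of_nat.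
pose G (w : seq bool) :=
  [seq output_of d (dec n) | n <- iota 0 (size w) & check d w (dec n)].
have CG : Comp G.
  have /Comp_at C1 := Cdec; have /Comp_at2 C2 := Comp_check d.
  have /Comp_at C3 := Comp_output_of d.
  by rewrite /G; comp.
have [M MP] := search_machine CG; exists M => w [y [s ys]].
have [|t [u [l [GE halt]]]] := MP w.
  exists (s + (enc y).+1)%N; apply/eqP; rewrite -size_eq0 size_map size_filter.
  rewrite -lt0n -has_count; apply/hasP; exists (enc y).
    by rewrite mem_iota size_rev size_mkseq; lia.
  by rewrite decK; apply: check_extend ys; lia.
have : u \in G (rev (mkseq w t)) by rewrite GE mem_head.
move=> /mapP[n]; rewrite mem_filter => /andP[chk _] uE.
by exists (dec n), t; rewrite -uE.
Qed.

(** * Unique readability of the input *)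

Section SelfDelimiting.
Variable d : nat.
Local Open Scope nat_scope.

Lemma code_nat_cat m n s t :
  code_nat m ++ s = code_nat n ++ t -> m = n /\ s = t.
Proof.
rewrite /code_nat !cat_rcons; elim: m n => [|m IHm] [|n] //= []; first by [].
by move=> /IHm[-> ->].
Qed.

(** The map [f] is needed because a code fixes raw data only up to its meaning: all positive sign
    numbers are coded alike. *)
Lemma flatten_code_cat (T S : Type) (ok : pred T) (code : T -> seq bool) (f : T -> S) :
  (forall x y s t, ok x -> ok y -> code x ++ s = code y ++ t -> f x = f y /\ s = t) ->
  forall (l m : seq T) s t, size l = size m -> all ok l -> all ok m ->
  flatten (map code l) ++ s = flatten (map code m) ++ t ->
  map f l = map f m /\ s = t.
Proof.
move=> inj; elim=> [|x l IHl] [|y m] s t //= [sz] /andP[okx okl] /andP[oky okm].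
by rewrite -!catA => /(inj _ _ _ _ okx oky)[-> /(IHl _ _ _ sz okl okm)[-> ->]].
Qed.

Lemma code_rawrat_cat r r' s t : code_rawrat r ++ s = code_rawrat r' ++ t ->
  qraw r = qraw r' /\ s = t.
Proof.
rewrite /code_rawrat /qraw /= -!catA /= => -[-> /code_nat_cat[-> []]].
by move=> /code_nat_cat[-> ->].
Qed.

Lemma code_rawpoly_cat (p q : rawpoly) s t : rawpoly_ok d p -> rawpoly_ok d q ->
  code_rawpoly p ++ s = code_rawpoly q ++ t ->
  qpoly_of_raw p = qpoly_of_raw q /\ s = t.
Proof.
move=> okp okq; rewrite /code_rawpoly /code_seq -!catA => /code_nat_cat[szpq].
apply: flatten_code_cat szpq okp okq => -[e r] [e' r'] u v /= /eqP sze /eqP sze'.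
rewrite -!catA => eq_code.
have [||||ee' rr'] := @flatten_code_cat _ _ predT code_nat id _ e e' _ _ _ _ _ eq_code.
- by move=> x y ? ? _ _; exact: code_nat_cat.
- by rewrite sze.
- exact: all_predT.
- exact: all_predT.
move: ee'; rewrite !map_id => ->.
by have [-> ->] := code_rawrat_cat rr'.
Qed.

Lemma code_input_cat x x' s t : input_ok d x -> input_ok d x' -> size x.2 = size x'.2 ->
  code_input x ++ s = code_input x' ++ t ->
  x.1 = x'.1 /\ map (map qpoly_of_raw) x.2 = map (map qpoly_of_raw) x'.2.
Proof.
move=> okx okx' sz; rewrite /code_input -!catA => /code_nat_cat[-> eq_code].
split=> //; have inj := @flatten_code_cat _ _
  (fun v => (size v == d) && all (rawpoly_ok d) v) _ (map qpoly_of_raw) _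
  x.2 x'.2 _ _ sz okx okx' eq_code.
apply: (proj1 (inj _)) => v v' u u' /andP[/eqP szv okv] /andP[/eqP szv' okv'].
exact: (flatten_code_cat code_rawpoly_cat (etrans szv (esym szv')) okv okv').
Qed.

Definition raw_of_rat (c : rat) : nat * nat * nat :=
  (nat_of_bool (numq c < 0)%R, `|numq c|, `|denq c|).

Lemma code_raw_of_rat c : code_rawrat (raw_of_rat c) = code_rat c.
Proof.
rewrite /code_rawrat /code_rat /code_int /= lt0b.
by have -> : (denq c < 0)%R = false by rewrite ltNge ltW ?denq_gt0.
Qed.

Definition raw_of_poly (p : mpoly.mpoly d rat) : rawpoly :=
  [seq ([seq mpoly.fun_of_multinom m i | i <- enum 'I_d],
        raw_of_rat (mpoly.mcoeff m p)) | m : mpoly.multinom d <- mpoly.msupp p].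

Lemma code_raw_of_poly p : code_rawpoly (raw_of_poly p) = code_poly p.
Proof.
rewrite /code_rawpoly /code_seq /raw_of_poly size_map -map_comp; congr (_ ++ flatten _).
apply: eq_map => m /=; rewrite code_raw_of_rat -map_comp; congr (_ ++ _).
Qed.

Definition raw_input (n0 : nat) (P : nat -> 'I_d -> mpoly.mpoly d rat) (K : nat) :
    nat * seq (seq rawpoly) :=
  (n0, [seq [seq raw_of_poly (P k i) | i <- enum 'I_d] | k <- iota 0 K]).

Lemma raw_input_ok n0 P K : input_ok d (raw_input n0 P K).
Proof.
rewrite /input_ok /= all_map; apply/allP=> k _ /=.
rewrite size_map size_enum_ord eqxx all_map; apply/allP=> i _ /=.
rewrite /rawpoly_ok all_map; elim: (mpoly.msupp _) => //= m l ->.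
by rewrite size_map size_enum_ord eqxx.
Qed.

Lemma code_raw_input n0 P K : code_input (raw_input n0 P K) =
  code_nat n0 ++ flatten [seq code_fam (@code_poly d) (P k) | k <- iota 0 K].
Proof.
rewrite /code_input /= -map_comp; congr (_ ++ flatten _).
apply: eq_map => k /=; rewrite -map_comp /code_fam; congr flatten.
by apply: eq_map => i /=; rewrite code_raw_of_poly.
Qed.

Hypothesis d_gt0 : 0 < d.

(** [input_seq] reads bit [i] in the code of the first [i] members. These codes extend one another,
    and the one with [i] members is longer than [i] because [0 < d] makes the code of each member
    nonempty. *)
Lemma input_seq_prefix n0 P K :
  let u := code_input (raw_input n0 P K) in mkseq (input_seq n0 P) (size u) = u.
Proof.
pose X k := code_input (raw_input n0 P k).
have XE k j : X (k + j) = X k ++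
    flatten [seq code_fam (@code_poly d) (P i) | i <- iota k j].
  by rewrite /X !code_raw_input iotaD map_cat flatten_cat catA.
have sizeX k : k < size (X k).
  elim: k => [|k IHk]; first by rewrite /X code_raw_input /= cats0 size_rcons.
  have := XE k 1; rewrite addn1 => ->; rewrite size_cat /= cats0.
  have code_gt0 : 0 < size (code_fam (@code_poly d) (P k)).
    rewrite /code_fam; case E: (enum 'I_d) => [|i l] /=.
      by have := size_enum_ord d; rewrite E => /esym/eqP; rewrite gtn_eqF.
    by rewrite /code_poly /code_seq !size_cat size_rcons.
  by lia.
move=> u; apply: (@eq_from_nth _ false); first by rewrite size_mkseq.
move=> i; rewrite size_mkseq => lt_i; rewrite nth_mkseq // /input_seq.
rewrite -code_raw_input -/(X i) /u -/(X K).
have ltX : i < size (X K) by exact: lt_i.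
have [le_iK|/ltnW le_Ki] := leqP i K.
  by rewrite -(subnKC le_iK) XE nth_cat sizeX.
by have -> : X i = X (K + (i - K)) by [rewrite subnKC]; rewrite XE nth_cat ltX.
Qed.

(** The guess and the true data with as many members both have codes that are prefixes of the input.
    Extended to a common length these become equal words, and unique readability applies. *)
Lemma check_input n0 P s (y : certificate) :
  check d (rev (mkseq (input_seq n0 P) s)) y ->
  y.1.1 = n0 /\ map (map qpoly_of_raw) y.1.2 =
    [seq [seq qpoly_of_raw (raw_of_poly (P k i)) | i <- enum 'I_d]
    | k <- iota 0 (size y.1.2)].
Proof.
rewrite /check revK => /and5P[/eqP pre ok _ _ _].
pose x' := raw_input n0 P (size y.1.2); pose w := input_seq n0 P.
have preY : mkseq w (size (code_input y.1)) = code_input y.1.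
  rewrite -{2}pre; have := congr1 size pre; rewrite size_take_min size_mkseq => /minn_idPl.
  move=> le_s; apply: (@eq_from_nth _ false).
    by rewrite size_takel !size_mkseq.
  by move=> i; rewrite size_mkseq => lt_i; rewrite nth_take // !nth_mkseq // (leq_trans lt_i).
have preX : mkseq w (size (code_input x')) = code_input x' by exact: input_seq_prefix.
have mkseqD a b : mkseq w (a + b) = mkseq w a ++ map w (iota a b).
  by rewrite /mkseq iotaD map_cat add0n.
have := mkseqD (size (code_input y.1)) (size (code_input x')).
rewrite preY addnC mkseqD preX => /esym eq_code.
have sz : size y.1.2 = size x'.2 by rewrite size_map size_iota.
have [-> ->] := code_input_cat ok (raw_input_ok n0 P (size y.1.2)) sz eq_code.
by split=> //=; rewrite -map_comp; apply: eq_map => k /=; rewrite -map_comp.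
Qed.

End SelfDelimiting.

(** * Values of the checked quantities *)

Section Values.
Variable R : realFieldType.
Implicit Types (a b : Q) (s : seq Q).

Definition qv a : R := (a.1.1%:R - a.1.2%:R) / a.2.+1%:R.

Lemma qvE (a b c : nat) : qv ((a, b), c) = (a%:R - b%:R) / c.+1%:R.
Proof. by []. Qed.

Lemma qvD a b : qv (qadd a b) = qv a + qv b.
Proof.
case: a b => [[a1 a2] a3] [[b1 b2] b3].
rewrite /qadd !qvE prednK ?muln_gt0 // /fst /snd !natrD !natrM; field.
by rewrite !nat1r !pnatr_eq0.
Qed.

Lemma qvM a b : qv (qmul a b) = qv a * qv b.
Proof.
case: a b => [[a1 a2] a3] [[b1 b2] b3].
rewrite /qmul !qvE prednK ?muln_gt0 // /fst /snd !natrD !natrM; field.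
by rewrite !nat1r !pnatr_eq0.
Qed.

Lemma qvN a : qv (qopp a) = - qv a.
Proof. by rewrite /qv /= -mulNr opprB. Qed.

Lemma qv_le a b : qle a b = (qv a <= qv b).
Proof.
case: a b => [[a1 a2] a3] [[b1 b2] b3].
rewrite /qle !qvE /fst /snd ler_pdivrMr ?ltr0n // mulrAC ler_pdivlMr ?ltr0n //.
rewrite -(ler_nat R) !natrD !natrM -subr_ge0 -[RHS]subr_ge0.
by congr (0 <= _); ring.
Qed.

Lemma qv_norm a : qv (qabs a) = `|qv a|.
Proof.
rewrite /qabs; case: leqP => [le|/ltnW le]; rewrite ?qvN /qv normrM normfV normr_nat.
  by rewrite ger0_norm // subr_ge0 ler_nat.
by rewrite ler0_norm ?mulNr // subr_le0 ler_nat.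
Qed.

Lemma qv_nat n : qv (qnat n) = n%:R.
Proof. by rewrite /qv /= subr0 divr1. Qed.

Lemma qv_inv n : (0 < n)%N -> qv (qinv n) = n%:R^-1.
Proof. by move=> n_gt0; rewrite /qv /= subr0 mul1r prednK. Qed.

Lemma qv_sum s : qv (qsum s) = \sum_(a <- s) qv a.
Proof. by elim: s => [|a s IHs]; rewrite ?big_nil ?qv_nat // big_cons qvD IHs. Qed.

Lemma qv_prod s : qv (qprod s) = \prod_(a <- s) qv a.
Proof. by elim: s => [|a s IHs]; rewrite ?big_nil ?qv_nat // big_cons qvM IHs. Qed.

Lemma qv_exp a n : qv (qexp a n) = qv a ^+ n.
Proof. by elim: n => [|n IHn]; rewrite ?qv_nat // exprS -IHn -qvM. Qed.

Lemma qv_sum_iota d (F : nat -> Q) :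
  qv (qsum [seq F i | i <- iota 0 d]) = \sum_(i < d) qv (F i).
Proof. by rewrite qv_sum big_map -{1}[d]subn0 big_mkord. Qed.

Lemma qv_prod_iota d (F : nat -> Q) :
  qv (qprod [seq F i | i <- iota 0 d]) = \prod_(i < d) qv (F i).
Proof. by rewrite qv_prod big_map -{1}[d]subn0 big_mkord. Qed.

End Values.

Lemma qv_dense (R : realType) (x e : R) : 0 < e -> exists q, `|qv R q - x| < e.
Proof.
move=> e_gt0; pose n := Num.truncn e^-1; pose z := Num.floor (x * n.+1%:R).
have n_gt : e^-1 < n.+1%:R by rewrite /n truncnS_gt // invr_ge0 ltW.
have valz (k : int) : exists a b : nat, (a%:R - b%:R : R) = k%:~R.
  by case: k => k; [exists k, 0%N|exists 0%N, k.+1];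
    rewrite ?subr0 // NegzE sub0r mulrNz.
have [a [b abz]] := valz z; exists ((a, b), n); rewrite /qv /= abz.
have /andP[zle zlt] := floor_itv (x * n.+1%:R).
rewrite -[x in X in `|X|](mulfK (x := n.+1%:R)) ?pnatr_eq0 // -mulrBl normrM.
rewrite normfV normr_nat ltr_pdivrMr ?ltr0n //; apply: (@le_lt_trans _ _ 1).
  rewrite distrC ger0_norm ?subr_ge0 // lerBlDr ltW //.
  by move: zlt; rewrite intrD addrC.
by rewrite mulrC -ltr_pdivrMr // div1r.
Qed.

(** * Polynomials with rational coefficients *)

Section Polynomials.
Variables (R : realType) (d : nat).
Local Notation qv := (qv R).
Implicit Types (p : ratpoly) (x y : 'rV[R]_d) (e : seq nat).

Definition mono e x : R := \prod_(i < d) x 0 i ^+ nth 0%N e i.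
Definition pv p x : R := \sum_(m <- p) qv m.2 * mono m.1 x.
Definition degree e : nat := (\sum_(i < d) nth 0%N e i)%N.
Definition lip p : R := \sum_(m <- p) `|qv m.2| * (degree m.1)%:R.

Lemma qv_eval p (s : seq Q) x : (forall i : 'I_d, qv (nth (qnat 0) s i) = x 0 i) ->
  qv (qeval d p s) = pv p x.
Proof.
move=> sx; rewrite /qeval qv_sum big_map; apply: eq_bigr => m _.
rewrite qvM qv_prod_iota; congr (_ * _); apply: eq_bigr => i _.
by rewrite qv_exp sx.
Qed.

Lemma qv_lip p : qv (qlip d p) = lip p.
Proof.
rewrite /qlip qv_sum big_map; apply: eq_bigr => m _.
rewrite qvM qv_norm qv_nat; congr (_ * _%:R).
by rewrite sumnE big_map -{1}[d]subn0 big_mkord.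
Qed.

Lemma lip_ge0 p : 0 <= lip p.
Proof. by apply: sumr_ge0 => m _; rewrite mulr_ge0. Qed.

Lemma expr_lipschitz (a b : R) n : `|a| <= 1 -> `|b| <= 1 ->
  `|a ^+ n - b ^+ n| <= n%:R * `|a - b|.
Proof.
move=> a1 b1; rewrite subrXX normrM mulrC ler_wpM2r //.
rewrite (le_trans (ler_norm_sum _ _ _)) // -[leRHS]mulr1n -[in leRHS](card_ord n).
rewrite -sum1_card natr_sum; apply: ler_sum => i _.
by rewrite normrM !normrX mulr_ile1 // exprn_ile1.
Qed.

Lemma prod_lipschitz (I : Type) (r : seq I) (a b : I -> R) :
  (forall i, `|a i| <= 1) -> (forall i, `|b i| <= 1) ->
  `|\prod_(i <- r) a i - \prod_(i <- r) b i| <= \sum_(i <- r) `|a i - b i|.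
Proof.
move=> a1 b1; elim: r => [|i r IHr]; first by rewrite !big_nil subrr normr0.
rewrite !big_cons; have -> (u v u' v' : R) : u * v - u' * v' = (u - u') * v + u' * (v - v').
  by ring.
rewrite (le_trans (ler_normD _ _)) // lerD // normrM.
  rewrite ler_piMr //; elim: r {IHr} => [|j r IHr]; rewrite ?big_nil ?normr1 //.
  by rewrite big_cons normrM mulr_ile1.
by rewrite (le_trans _ IHr) // ler_piMl.
Qed.

Lemma pv_lipschitz p x y (h : R) :
  (forall i, `|x 0 i| <= 1) -> (forall i, `|y 0 i| <= 1) ->
  (forall i, `|x 0 i - y 0 i| <= h) -> `|pv p x - pv p y| <= lip p * h.
Proof.
move=> x1 y1 xy; rewrite /pv -sumrB (le_trans (ler_norm_sum _ _ _)) //.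
rewrite mulr_suml; apply: ler_sum => m _; rewrite -mulrBr normrM -mulrA.
rewrite ler_wpM2l // natr_sum mulr_suml.
have le1 (z : 'rV[R]_d) (k : 'I_d -> nat) :
    (forall i, `|z 0 i| <= 1) -> forall i : 'I_d, `|z 0 i ^+ k i| <= 1.
  by move=> z1 i; rewrite normrX exprn_ile1.
have := @prod_lipschitz _ (index_enum 'I_d) (fun i => x 0 i ^+ nth 0%N m.1 i)
  (fun i => y 0 i ^+ nth 0%N m.1 i) (le1 x _ x1) (le1 y _ y1).
move/le_trans; apply.
apply: ler_sum => i _; apply: le_trans (expr_lipschitz _ (x1 i) (y1 i)) _.
by rewrite ler_wpM2l.
Qed.

Lemma qv_raw_of_rat (c : rat) : qv (qraw (raw_of_rat c)) = ratr c.
Proof.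
rewrite /qv /qraw /raw_of_rat /= lt0b.
have den_gt0 : (0 < `|denq c|)%N by rewrite absz_gt0 denq_eq0.
rewrite -[c in RHS]divq_num_den rmorph_div /= ?unitfE ?intr_eq0 ?denq_eq0 //.
rewrite !ratr_int; case: ltP => num_c; rewrite /= prednK //.
  have -> : (`|denq c|%N)%:R = (denq c)%:~R :> R by rewrite -[RHS]/(_%:~R) -{2}[denq c]gez0_abs // ltW // denq_gt0.
  by rewrite sub0r -{2}[numq c]opprK -[- numq c]lez0_abs ?ltW // mulrNz.
have -> : (`|denq c|%N)%:R = (denq c)%:~R :> R by rewrite -[RHS]/(_%:~R) -{2}[denq c]gez0_abs // ltW // denq_gt0.
by rewrite subr0 -{2}[numq c]gez0_abs.
Qed.

Lemma pv_raw_of_poly (P : mpoly.mpoly d rat) x :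
  pv (qpoly_of_raw (raw_of_poly P)) x = poly_fun P x 0 0.
Proof.
rewrite /poly_fun !mxE /= mulr1n /pv /qpoly_of_raw /raw_of_poly -map_comp big_map.
rewrite /mpoly.map_mpoly /mpoly.mmap.
rewrite (big_morph _ (mpoly.mevalD (x ord0)) (mpoly.meval0 (x ord0))) /=.
apply: eq_bigr => m _; rewrite mpoly.mevalM mpoly.mevalC qv_raw_of_rat.
congr (_ * _); rewrite mpoly.mmap1_id mpoly.mevalX; apply: eq_bigr => i _.
by rewrite (nth_map i) ?size_enum_ord // nth_ord_enum.
Qed.

End Polynomials.

(** * Partial derivatives *)

Section MatrixNorm.
Variable R : realType.

Lemma mx_norm_le m n (M : 'M[R]_(m, n)) (c : R) :
  0 <= c -> (forall i j, `|M i j| <= c) -> `|M| <= c.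
Proof.
move=> c_ge0 Mc; rewrite [leLHS]/Num.Def.normr /= mx_normrE.
by apply/bigmax_leP; split=> // -[i j] _; exact: Mc.
Qed.

Lemma coord_le_norm m n (M : 'M[R]_(m, n)) i j : `|M i j| <= `|M|.
Proof.
rewrite [leRHS]/Num.Def.normr /= mx_normrE.
by apply/bigmax_geP; right; exists (i, j).
Qed.

End MatrixNorm.

(** * Differentials in a fixed direction *)

Section Differential.
Variables (R : realType) (V : normedModType R) (x v : V).
Implicit Types (f g : V -> R) (a b : R).

(** One predicate serves for partial derivatives, [v] being a unit vector, and for derivatives along
    a segment, with the real line as [V] and [v = 1]. *)
Definition has_diff f a : Prop :=
  differentiable f x /\ 'd f x v = a.

Lemma has_diff_cst a : has_diff (fun=> a) 0.
Proof. by split; [exact: differentiable_cst|rewrite diff_cst]. Qed.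

Lemma has_diffD f g a b : has_diff f a -> has_diff g b ->
  has_diff (fun y => f y + g y) (a + b).
Proof.
move=> [df <-] [dg <-]; split; first exact: (differentiableD df dg).
exact: (congr1 (@^~ _) (diffD df dg)).
Qed.

Lemma has_diffM f g a b : has_diff f a -> has_diff g b ->
  has_diff (fun y => f y * g y) (f x * b + g x * a).
Proof.
move=> [df <-] [dg <-]; split; first exact: (differentiableM df dg).
exact: (congr1 (@^~ _) (diffM df dg)).
Qed.

Lemma has_diffX f a n : has_diff f a ->
  has_diff (fun y => f y ^+ n) (n%:R * f x ^+ n.-1 * a).
Proof.
move=> fa; elim: n => [|n IHn].
  by rewrite !mul0r; exact: has_diff_cst.
have -> : (fun y => f y ^+ n.+1) = (fun y => f y * f y ^+ n).
  by apply/funext=> y; rewrite exprS.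
have := has_diffM fa IHn; congr has_diff; case: n {IHn} => [|n] /=.
  by rewrite expr0; ring.
by rewrite -natr1 exprS; ring.
Qed.

Lemma has_diff_coord m n (h : V -> 'M[R]_(m, n)) k l :
  differentiable h x -> has_diff (fun y => h y k l) ('d h x v k l).
Proof.
have @c : {linear 'M[R]_(m, n) -> R}.
  by exists (fun N : 'M[R]_(_, _) => N k l); do 2![eexists]; do ?[constructor];
     rewrite ?mxE// => ? *; rewrite ?mxE//; move=> ?; rewrite !mxE.
move=> dh; have dc := differentiable_coord (h x) k l.
split; first exact: (differentiable_comp dh dc).
rewrite (congr1 (@^~ _) (diff_comp dh dc)) /=.
by rewrite (_ : (fun N : 'M[R]_(m, n) => N k l) = c) // diff_lin //; exact: coord_continuous.
Qed.

Lemma has_diff_sum (I : Type) (r : seq I) (f : I -> V -> R) (a : I -> R) :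
  (forall i, has_diff (f i) (a i)) ->
  has_diff (fun y => \sum_(i <- r) f i y) (\sum_(i <- r) a i).
Proof.
move=> fa; elim: r => [|i r IHr].
  rewrite big_nil; under eq_fun do rewrite big_nil; exact: has_diff_cst.
rewrite big_cons; under eq_fun do rewrite big_cons; exact: has_diffD.
Qed.

End Differential.

Section Partial.
Variables (R : realType) (d : nat) (x : 'rV[R]_d) (j : 'I_d).
Local Notation has_partial := (has_diff x (delta_mx 0 j)).

Lemma has_partial_var i : has_partial (fun y => y 0 i) (i == j)%:R.
Proof.
have di : differentiable (idfun : 'rV[R]_d -> 'rV[R]_d) x by [].
by have := has_diff_coord (delta_mx 0 j) 0 i di; rewrite diff_val mxE eqxx.
Qed.

Lemma has_partial_prod0 (r : seq 'I_d) (e : 'I_d -> nat) :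
  has_partial (fun y => \prod_(i <- r | i != j) y 0 i ^+ e i) 0.
Proof.
elim: r => [|i r IHr].
  under eq_fun do rewrite big_nil; exact: has_diff_cst.
under eq_fun do rewrite big_cons; case: eqP => [//|/eqP/negbTE ij] /=.
have := has_diffM (has_diffX (e i) (has_partial_var i)) IHr.
by rewrite ij !mulr0 addr0.
Qed.

Lemma has_partial_mono (e : seq nat) : has_partial (@mono R d e)
  ((nth 0%N e j)%:R * mono [seq nth 0%N e i - (if i == j then 1 else 0) | i <- iota 0 d]%N x).
Proof.
have := has_diffM (has_diffX (nth 0%N e j) (has_partial_var j))
  (has_partial_prod0 (index_enum 'I_d) (fun i => nth 0%N e i)).
rewrite eqxx mulr1 mulr0 add0r.
have -> : (fun y : 'rV[R]_d => y 0 j ^+ nth 0%N e j *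
    \prod_(i | i != j) y 0 i ^+ nth 0%N e i) = @mono R d e.
  by apply/funext=> y; rewrite /mono [RHS](bigD1 j).
congr has_diff; rewrite mulrC -mulrA; congr (_ * _).
have nthE (i : 'I_d) : nth 0%N [seq nth 0%N e i - (if i == j then 1 else 0)
    | i <- iota 0 d]%N i = (nth 0%N e i - (i == j))%N.
  by rewrite (nth_map 0%N) ?size_iota // nth_iota // add0n -val_eqE; case: eqP.
rewrite /mono [RHS](bigD1 j) //= nthE eqxx subn1; congr (_ * _).
by apply: eq_bigr => i /negbTE ij; rewrite nthE ij subn0.
Qed.

Lemma has_partial_pv (p : ratpoly) : has_partial (pv p) (pv (qderiv d j p) x).
Proof.
rewrite /pv /qderiv big_map.
apply: (@has_diff_sum _ _ _ _ _ p (fun m y => qv R m.2 * mono m.1 y)) => m.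
have := has_diffM (has_diff_cst _ _ (qv R m.2)) (has_partial_mono m.1).
by rewrite mulr0 addr0; congr has_diff; rewrite qvM qv_nat mulrCA mulrA.
Qed.

Lemma jacobianE m (h : 'rV[R]_d -> 'rV[R]_m) l :
  jacobian h x j l = 'd h x (delta_mx 0 j) 0 l.
Proof. by rewrite /jacobian mxE. Qed.

Lemma jacobian_scalar (f : 'rV[R]_d -> R) a : has_partial f a ->
  jacobian (fun y => (f y)%:M : 'rV[R]_1) x j 0 = a.
Proof.
move=> [df <-]; rewrite jacobianE.
have -> : (fun y => (f y)%:M : 'rV[R]_1) = (fun y => f y *: (1%:M : 'M[R]_1)).
  by apply/funext=> y; rewrite scale_scalar_mx mulr1.
by rewrite (congr1 (@^~ _) (diffZl _ df)) !mxE eqxx mulr1.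
Qed.

End Partial.

(** * The unit ball and names of functions on it *)

Section Ball.
Variables (R : realType) (d : nat).
Local Notation K := (@unit_ball R d).
Implicit Types (x y : 'rV[R]_d).

Lemma unit_ballP x : K x <-> forall i, `|x 0 i| <= 1.
Proof.
rewrite /unit_ball closed_ballE //= /closed_ball_ /= sub0r normrN; split=> [x1 i|x1].
  exact: le_trans (coord_le_norm _ _ _) x1.
by apply: mx_norm_le => // i j; rewrite ord1.
Qed.

Lemma unit_ball0 : K 0.
Proof. by apply/unit_ballP => i; rewrite mxE normr0. Qed.

Lemma compact_unit_ball : compact K.
Proof.
apply: bounded_closed_compact; last exact: closed_ball_closed.
exists 1; split=> // M /ltW M1 x /unit_ballP x1.
by apply: (le_trans _ M1); apply: mx_norm_le => // i j; rewrite ord1.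
Qed.

Lemma bounded_on_unit_ball (u : 'rV[R]_d -> R) :
  (forall x, K x -> {for x, continuous u}) -> exists B, forall x, K x -> `|u x| <= B.
Proof.
move=> cu; have K0 : K !=set0 by exists 0; exact: unit_ball0.
have [|c _ umax] := @EVT_max_rV _ _ (fun x => `|u x|) K K0 compact_unit_ball.
  apply: continuous_in_subspaceT => x; rewrite inE => /cu cux.
  exact: (continuous_comp cux (@norm_continuous _ _ _)).
by exists `|u c| => x Kx; apply: umax; rewrite inE.
Qed.

Lemma sup_image_ge (u : 'rV[R]_d -> R) B x : K x ->
  (forall y, K y -> u y <= B) -> u x <= sup [set u y | y in K].
Proof.
move=> Kx uB; apply: sup_upper_bound; last by exists x.
split; first by exists (u x), x.
by exists B => _ [y Ky <-]; exact: uB.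
Qed.

(** A supremum bounds its set only when the set is bounded above, so continuity on the compact ball
    has to be invoked before the norm gives pointwise estimates. *)
Lemma C1_norm_ge (h : 'rV[R]_d -> R) (dh : 'I_d -> 'rV[R]_d -> R) (c : R) :
  (forall x, K x -> differentiable h x) ->
  (forall x j, K x -> has_diff x (delta_mx 0 j) h (dh j x)) ->
  (forall x j, K x -> {for x, continuous (dh j)}) ->
  C1_norm K (fun x => (h x)%:M : 'rV[R]_1) < c ->
  forall x, K x -> `|h x| <= c /\ forall j, `|dh j x| <= c.
Proof.
move=> dfh hdh cdh; set g := fun x => _; move=> hc x Kx.
have [B hB] := bounded_on_unit_ball (fun y Ky => differentiable_continuous (dfh y Ky)).
have /boolp.choice[D hD] j : exists B, forall y, K y -> `|dh j y| <= B.
  by apply: bounded_on_unit_ball => y; exact: cdh.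
have normg y : `|g y| = `|h y|.
  apply/eqP; rewrite eq_le mx_norm_le //=; last first.
    by move=> i k; rewrite !ord1 mxE eqxx.
  by have := coord_le_norm (g y) 0 0; rewrite mxE eqxx.
have Jg y j k : K y -> jacobian g y j k = dh j y.
  by move=> Ky; rewrite ord1; exact: jacobian_scalar (hdh _ _ Ky).
have le1 : `|h x| <= sup [set `|g y| | y in K].
  rewrite -normg; apply: (@sup_image_ge (fun y => `|g y|) B) => // y Ky.
  by rewrite normg; exact: hB.
have le2 : `|jacobian g x| <= sup [set `|jacobian g y| | y in K].
  apply: (@sup_image_ge (fun y => `|jacobian g y|) (\sum_j D j)) => // y Ky.
  have D_ge0 j : 0 <= D j by apply: le_trans (hD j _ Ky).
  apply: mx_norm_le; first by apply: sumr_ge0.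
  move=> j k; rewrite Jg // (bigD1 j) //= -[leLHS]addr0 lerD ?hD //.
  by apply: sumr_ge0 => i _.
move: hc; rewrite /C1_norm => /ltW hc; split.
  by apply: le_trans hc; rewrite -[leLHS]addr0 lerD // (le_trans _ le2).
move=> j; apply: le_trans hc; rewrite -(Jg _ _ 0 Kx) -[leLHS]add0r lerD //.
  by rewrite (le_trans _ le1).
exact: le_trans (coord_le_norm _ _ _) le2.
Qed.

End Ball.

Section Name.
Variables (R : realType) (d : nat) (U : set 'rV[R]_d) (f : 'rV[R]_d -> 'rV[R]_d).
Local Notation K := (@unit_ball R d).
Variable P : nat -> 'I_d -> mpoly.mpoly d rat.
Hypotheses (KU : K `<=` U) (fC1 : C1_on U f) (fP : is_C1_name K f P).

Definition name_poly k i : ratpoly := qpoly_of_raw (raw_of_poly (P k i)).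

Lemma continuous_jacobian x i j : K x -> {for x, continuous (fun y => jacobian f y j i)}.
Proof.
move=> /KU/fC1[_ cJ].
exact: (continuous_comp cJ (@coord_continuous _ _ _ _ _ _)).
Qed.

Lemma name_approx k i x : K x ->
  `|f x 0 i - pv (name_poly k i) x| <= 2 ^- k /\
  forall j, `|jacobian f x j i - pv (qderiv d j (name_poly k i)) x| <= 2 ^- k.
Proof.
have hE : (fun y => col i (f y) - poly_fun (P k i) y) =
    (fun y => (f y 0 i - pv (name_poly k i) y)%:M : 'rV[R]_1).
  apply/funext=> y; apply/matrixP=> a b.
  by rewrite !ord1 pv_raw_of_poly !mxE eqxx mulr1n.
have diff_h y j : K y -> has_diff y (delta_mx 0 j)
    (fun y => f y 0 i - pv (name_poly k i) y)
    (jacobian f y j i - pv (qderiv d j (name_poly k i)) y).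
  move=> /KU/fC1[df _]; rewrite jacobianE.
  have := has_diffD (has_diff_coord (delta_mx 0 j) 0 i df)
    (has_diffM (has_diff_cst _ _ (-1)) (has_partial_pv y j (name_poly k i))).
  rewrite mulr0 addr0 mulN1r; congr has_diff.
  by apply/funext=> z; rewrite mulN1r.
have dpv (p : ratpoly) y : differentiable (@pv R d p) y.
  rewrite /pv; elim: p => [|m p IHp].
    under eq_fun do rewrite big_nil; exact: differentiable_cst.
  under eq_fun do rewrite big_cons.
  apply: (differentiableD _ IHp); apply: (differentiableM (differentiable_cst _ _)).
  rewrite /mono; elim: (index_enum _) => [|l r IHr].
    under eq_fun do rewrite big_nil; exact: differentiable_cst.
  under eq_fun do rewrite big_cons.
  apply: (differentiableM _ IHr).
  have dl := differentiable_coord y 0 l.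
  exact: (has_diffX (nth 0%N m.1 l) (conj dl (erefl ('d _ y 0)))).1.
have dfi y : K y -> differentiable (fun z => f z 0 i) y.
  move=> Ky; have [df _] := fC1 (KU Ky).
  exact: (differentiable_comp df (differentiable_coord _ _ _)).
apply: (C1_norm_ge (h := fun y => f y 0 i - pv (name_poly k i) y)
  (dh := fun j y => jacobian f y j i - pv (qderiv d j (name_poly k i)) y)).
- by move=> y Ky; exact: (differentiableB (dfi y Ky) (dpv _ _)).
- by move=> y j Ky; exact: diff_h.
- move=> y j Ky; apply: (continuousB (f := fun y => jacobian f y j i)).
    exact: continuous_jacobian.
  exact: differentiable_continuous (dpv _ _).
- by rewrite -hE.
Qed.

End Name.

(** * Newton's method *)

Lemma mx_continuous (R : realType) (T : topologicalType) m n
    (g : T -> 'M[R]_(m, n)) x :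
  (forall i j, {for x, continuous (fun y => g y i j)}) -> {for x, continuous g}.
Proof.
move=> cg; apply/cvgrPdist_le => /= e e0.
have : \forall y \near x, forall i j, `|g x i j - g y i j| <= e.
  apply: filter_forall => i; apply: filter_forall => j.
  by move: (cg i j) => /cvgrPdist_le /(_ e e0).
apply: filterS => y gy; apply: mx_norm_le => [|i j]; first exact: ltW.
by rewrite !mxE.
Qed.

Section Newton.
Variables (R : realType) (d : nat).
Implicit Types (f : 'rV[R]_d -> 'rV[R]_d) (A : 'M[R]_d) (S : set 'rV[R]_d).

(* Vectors are rows: the preconditioner [A] acts on the right. *)
Definition newton f A (x : 'rV[R]_d) : 'rV[R]_d := x - f x *m A.

(** The matrix is the derivative of [newton f A] at [x]; entries of size [e / d] bound its operator
    norm for the maximum norm by [e]. *)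
Definition newton_bound f A (e : R) (x : 'rV[R]_d) : Prop :=
  forall j i, `|(1%:M - jacobian f x *m A) j i| <= e / d%:R.

Lemma mulmx_bound (v : 'rV[R]_d) (M : 'M[R]_d) (e : R) : 0 <= e ->
  (forall j i, `|M j i| <= e / d%:R) -> `|v *m M| <= e * `|v|.
Proof.
move=> e_ge0 Me; apply: mx_norm_le => [|a i]; first by rewrite mulr_ge0.
rewrite mxE (le_trans (ler_norm_sum _ _ _)) //.
have d_gt0 : (0 < d)%N by case: (d) i => // -[].
have -> : e * `|v| = \sum_(j < d) (`|v| * (e / d%:R)).
  rewrite sumr_const card_ord -mulr_natr; field.
  by rewrite pnatr_eq0 -lt0n.
by apply: ler_sum => j _; rewrite normrM ler_pM ?coord_le_norm.
Qed.

Lemma has_diff_newton_line f A (y v : 'rV[R]_d) (t : R) i :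
  differentiable f (y + t *: v) ->
  has_diff t 1 (fun s => newton f A (y + s *: v) 0 i)
    ((v *m (1%:M - jacobian f (y + t *: v) *m A)) 0 i).
Proof.
set g := fun s : R => y + s *: v; rewrite -/(g t) => df.
have dg : is_diff t g ( *:%R ^~ v).
  have : is_diff t (cst y + *:%R ^~ v) (0 + *:%R ^~ v) by exact: is_diffD.
  by rewrite add0r.
have dg1 : 'd g t (1 : R) = v.
  by rewrite (congr1 (@^~ (1 : R)) (diff_val (is_diff_def := dg))) scale1r.
have fg l : has_diff t 1 (fun s => f (g s) 0 l) ((v *m jacobian f (g t)) 0 l).
  have dg' : differentiable g t by [].
  have := has_diff_coord (1 : R) 0 l (differentiable_comp dg' df).
  have -> : 'd (f \o g) t (1 : R) = 'd f (g t) ('d g t (1 : R)).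
    exact: (congr1 (@^~ (1 : R)) (diff_comp dg' df)).
  by rewrite dg1 /jacobian mul_rV_lin1.
have gi : has_diff t 1 (fun s => g s 0 i) (v 0 i).
  have dg' : differentiable g t by [].
  have := has_diff_coord (1 : R) 0 i dg'.
  by rewrite dg1.
have := has_diffD gi (has_diffM (has_diff_cst t 1 (-1)) (has_diff_sum (index_enum _)
  (fun l => has_diffM (has_diff_cst t 1 (A l i)) (fg l)))).
rewrite !mulr0 addr0; congr has_diff.
  apply/funext=> s; rewrite /newton !mxE mulN1r; congr (_ - _).
  by apply: eq_bigr => l _; rewrite mulrC.
rewrite mulmxBr mulmx1 mulmxA !mxE mulN1r; congr (_ - _).
by apply: eq_bigr => l _; rewrite mulr0 addr0 mulrC.
Qed.

(** The mean value theorem is scalar, so it is applied to each coordinate along the segment. The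
    intermediate point depends on the coordinate, which the maximum norm tolerates. *)
Lemma newton_contraction f A S :
  (forall x y (t : R), S x -> S y -> 0 <= t <= 1 -> S (y + t *: (x - y))) ->
  (forall x, S x -> differentiable f x) ->
  (forall x, S x -> newton_bound f A 2^-1 x) ->
  forall x y, S x -> S y -> `|newton f A x - newton f A y| <= 2^-1 * `|x - y|.
Proof.
move=> convS dS bS x y Sx Sy; apply: mx_norm_le => [|a i]; rewrite ?mulr_ge0 //.
rewrite {a}ord1.
pose g (s : R) : R := newton f A (y + s *: (x - y)) 0 i.
pose dg (s : R) : R := ((x - y) *m (1%:M - jacobian f (y + s *: (x - y)) *m A)) 0 i.
have gd (t : R) : 0 <= t <= 1 -> has_diff t 1 g (dg t).
  by move=> t01; apply: has_diff_newton_line; apply: dS; exact: convS.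
have gder (t : R) : t \in `]0, 1[ -> is_derive t 1 g (dg t).
  rewrite in_itv /= => /andP[/ltW t0 /ltW t1].
  have [|dgt <-] := gd t; first by rewrite t0.
  by apply: DeriveDef; [exact: diff_derivable|rewrite deriveE].
have gcont : {within `[0, 1], continuous g}.
  apply: continuous_in_subspaceT => t; rewrite inE /= in_itv /= => t01.
  by have [/differentiable_continuous] := gd t t01.
have [c c01] := MVT_segment ler01 gder gcont.
have -> : g 1 - g 0 = (newton f A x - newton f A y) 0 i.
  by rewrite /g scale1r scale0r addr0 [y + _]addrC subrK !mxE.
rewrite subr0 mulr1 => ->; rewrite /dg.
apply: (le_trans (coord_le_norm _ _ _)); apply: mulmx_bound => //.
by apply: bS; apply: convS => //; move: c01; rewrite in_itv.
Qed.

(** A vector [u] killed by the product satisfies [|u| <= |u| / 2]. Invertibility of [A] is what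
    turns a fixed point of the Newton map into a zero of [f]. *)
Lemma newton_unit f A x : newton_bound f A 2^-1 x -> A \in unitmx.
Proof.
move=> bx; suff : (jacobian f x *m A) \in unitmx by rewrite unitmx_mul => /andP[].
rewrite -row_free_unit -kermx_eq0; apply/eqP/row_matrixP=> k.
set u := row k _; rewrite row0.
have u0 : u *m (jacobian f x *m A) = 0.
  by rewrite /u -row_mul mulmx_ker row0.
have half_ge0 : 0 <= 2^-1 :> R by [].
have := mulmx_bound u half_ge0 bx; rewrite mulmxBr mulmx1 u0 subr0.
by rewrite -subr_le0 -{1}[`|u|]mul1r -mulrBl => h; apply/normr0_eq0/eqP; rewrite eq_le normr_ge0 andbT; lra.
Qed.

Lemma newton_fixed f A x : f x = 0 -> newton f A x = x.
Proof. by move=> fx; rewrite /newton fx mul0mx subr0. Qed.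

Lemma newton_zero_unique f A S :
  (forall x y (t : R), S x -> S y -> 0 <= t <= 1 -> S (y + t *: (x - y))) ->
  (forall x, S x -> differentiable f x) ->
  (forall x, S x -> newton_bound f A 2^-1 x) ->
  forall x y, S x -> S y -> f x = 0 -> f y = 0 -> x = y.
Proof.
move=> convS dS bS x y Sx Sy fx fy; apply/eqP; rewrite -subr_eq0 -normr_le0.
have := newton_contraction convS dS bS Sx Sy.
rewrite !newton_fixed //; lra.
Qed.

Lemma closed_box_convex (q : 'rV[R]_d) (r : R) (x y : 'rV[R]_d) (t : R) :
  `|x - q| <= r -> `|y - q| <= r -> 0 <= t <= 1 -> `|y + t *: (x - y) - q| <= r.
Proof.
move=> xr yr /andP[t0 t1].
have -> : y + t *: (x - y) - q = t *: (x - q) + (1 - t) *: (y - q).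
  by rewrite scalerBl scale1r !scalerBr; apply/matrixP=> i j; rewrite !mxE; ring.
rewrite (le_trans (ler_normD _ _)) // !normrZ (ger0_norm t0) ger0_norm ?subr_ge0 //.
have := ler_wpM2l t0 xr; have t1' : 0 <= 1 - t by rewrite subr_ge0.
have := ler_wpM2l t1' yr; nra.
Qed.

(* A minimizer of [|x - newton x|] is a fixed point, since the iteration halves
   this distance. *)
Lemma newton_zero f A (q : 'rV[R]_d) (r : R) : 0 < r ->
  (forall x, `|x - q| <= r -> differentiable f x) ->
  (forall x, `|x - q| <= r -> newton_bound f A 2^-1 x) ->
  `|f q *m A| <= r / 2 ->
  exists x, [/\ `|x - q| <= r, f x = 0
    & forall y, `|y - q| <= r -> f y = 0 -> y = x].
Proof.
move=> r_gt0 dS bS fq; pose S := [set x : 'rV[R]_d | `|x - q| <= r].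
have convS x y (t : R) : S x -> S y -> 0 <= t <= 1 -> S (y + t *: (x - y)).
  exact: closed_box_convex.
have ctr := newton_contraction convS dS bS.
have Sq : S q by rewrite /S /= subrr normr0 ltW.
have inS x : S x -> S (newton f A x).
  move=> Sx; have := ctr _ _ Sx Sq; have : `|x - q| <= r by [].
  have -> : S (newton f A x) = (`|newton f A x - q| <= r) :> Prop by [].
  have -> : newton f A x - q = (newton f A x - newton f A q) - f q *m A.
    by rewrite /newton -[RHS]addrA -opprD subrK.
  move=> h1 h2; have := ler_normB (newton f A x - newton f A q) (f q *m A); lra.
have cS : compact S.
  apply: bounded_closed_compact.
    exists (`|q| + r); split=> [|M ltM x Sx]; first exact: num_real.
    apply: le_trans (ltW ltM); rewrite -{1}[x](subrK q).
    by rewrite (le_trans (ler_normD _ _)) // addrC lerD2l.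
  have -> : S = closed_ball_ Num.norm q r.
    by apply/seteqP; split=> x; rewrite /S /closed_ball_ /= distrC.
  exact: closed_closed_ball_.
have cont x : S x -> {for x, continuous (fun y => `|f y *m A|)}.
  move=> /dS df; apply: (@continuous_comp _ _ _ (fun y => f y *m A) Num.norm); last first.
    exact: norm_continuous.
  apply: mx_continuous => a i; rewrite {a}ord1.
  have -> : (fun y => (f y *m A) 0 i) = (fun y => \sum_l A l i * f y 0 l).
    by apply/funext=> y; rewrite mxE; apply: eq_bigr => l _; rewrite mulrC.
  have dl l := has_diffM (has_diff_cst x 0 (A l i)) (has_diff_coord 0 0 l df).
  exact/differentiable_continuous/(has_diff_sum (index_enum _) dl).1.
have S0 : S !=set0 by exists q.
have [|c] := @EVT_min_rV _ _ (fun x => `|f x *m A|) S S0 cS.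
  by apply: continuous_in_subspaceT => x; rewrite inE; exact: cont.
rewrite inE => Sc cmin; exists c.
have newtonE x : `|f x *m A| = `|x - newton f A x|.
  by rewrite /newton opprB addrCA subrr addr0.
have fc0 : f c *m A = 0.
  have := cmin (newton f A c); rewrite inE => /(_ (inS _ Sc)).
  have := ctr _ _ Sc (inS _ Sc); rewrite -!newtonE => h1 h2.
  by apply/eqP; rewrite -normr_le0; lra.
have fc : f c = 0 by rewrite -(mulmxK (newton_unit (bS _ Sc)) (f c)) fc0 mul0mx.
split=> // y Sy fy; exact: newton_zero_unique convS dS bS _ _ Sy Sc fy fc.
Qed.

End Newton.

(** * Meaning of the checks *)

Section Meaning.
Variables (R : realType) (d : nat).
Local Notation qv := (qv R).

Lemma all_iotaP (F : pred nat) : all F (iota 0 d) <-> forall i : 'I_d, F i.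
Proof.
split=> [/allP h i|h]; first by apply: h; rewrite mem_iota /=.
by apply/allP=> i; rewrite mem_iota /= => lt_i; exact: (h (Ordinal lt_i)).
Qed.

Lemma has_iotaP (F : pred nat) : has F (iota 0 d) <-> exists i : 'I_d, F i.
Proof.
split=> [/hasP[i]|[i Fi]].
  by rewrite mem_iota /= => lt_i Fi; exists (Ordinal lt_i).
by apply/hasP; exists (val i); rewrite ?mem_iota /=.
Qed.

Definition rcorner e (c : qcube) : 'rV[R]_d := \row_i qv (qcorner e c i).
Definition rcenter e n (c : qcube) : 'rV[R]_d :=
  \row_i (qv (qcorner e c i) + (2 * n)%:R^-1).
(** Transposed: the checks multiply on the left, [newton] on the right. *)
Definition rmatrix (c : qcube) : 'M[R]_d := \matrix_(l, i) qv (qentry c i l).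

Lemma qv_center e n c (i : 'I_d) : (0 < n)%N ->
  qv (nth (qnat 0) (qcenter d e n c) i) = rcenter e n c 0 i.
Proof.
move=> n_gt0; rewrite (nth_map 0%N) ?size_iota // nth_iota // add0n mxE.
by rewrite qvD qv_inv ?muln_gt0.
Qed.

Lemma cube_in_ballP e n c : (0 < n)%N ->
  cube_in_ball d e n c <-> forall i : 'I_d,
    -1 <= rcorner e c 0 i /\ rcorner e c 0 i + n%:R^-1 <= 1.
Proof.
move=> n_gt0; rewrite /cube_in_ball; split=> [/all_iotaP h i|h].
  by have := h i; rewrite !(qv_le R) qvD qvN qv_inv // !qv_nat mxE => /andP[].
apply/all_iotaP => i; have := h i.
by rewrite !(qv_le R) qvD qvN qv_inv // !qv_nat mxE => -[-> ->].
Qed.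

Definition jacobian_ok (p : 'I_d -> ratpoly) k e n c (i j : 'I_d) : bool :=
  `|(i == j)%:R - \sum_l rmatrix c l i * pv (qderiv d j (p l)) (rcenter e n c)| +
  \sum_l `|rmatrix c l i| * (2 ^- k + (2 * n)%:R^-1 * lip R d (qderiv d j (p l)))
  <= (2 * d)%:R^-1.

Definition value_ok (p : 'I_d -> ratpoly) k e n c (i : 'I_d) : bool :=
  `|\sum_l rmatrix c l i * pv (p l) (rcenter e n c)| +
  \sum_l `|rmatrix c l i| * 2 ^- k <= (4 * n)%:R^-1.

Section Polynomials.
Variables (Ps : seq rawpoly) (p : 'I_d -> ratpoly).
Hypothesis PsE : forall l : 'I_d, qpoly_of_raw (nth [::] Ps l) = p l.

Lemma newton_jacobianP k e n c : (0 < n)%N -> (0 < d)%N ->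
  newton_jacobian d k Ps e n c <-> forall i j, jacobian_ok p k e n c i j.
Proof.
move=> n_gt0 d_gt0.
suff FE (i j : 'I_d) : qle (qadd
      (qabs (qadd (qnat (if val i == val j then 1 else 0)) (qopp (qsum
         [seq qmul (qentry c i l)
            (qeval d (qderiv d j (qpoly_of_raw (nth [::] Ps l))) (qcenter d e n c))
         | l <- iota 0 d]))))
      (qsum [seq qmul (qabs (qentry c i l)) (qadd (qinv (2 ^ k))
          (qmul (qinv (2 * n)) (qlip d (qderiv d j (qpoly_of_raw (nth [::] Ps l))))))
         | l <- iota 0 d]))
      (qinv (2 * d)) = jacobian_ok p k e n c i j.
  rewrite /newton_jacobian; split=> [/all_iotaP h i j|h].
    by have /all_iotaP/(_ j) := h i; rewrite FE.
  by apply/all_iotaP => i; apply/all_iotaP => j; rewrite FE; exact: h.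
rewrite (qv_le R) qvD qv_norm qvD qvN qv_nat !qv_sum_iota qv_inv ?muln_gt0 // /jacobian_ok.
rewrite val_eqE.
congr (`|_ - _| + _ <= _).
  apply: eq_bigr => l _; rewrite qvM mxE PsE; congr (_ * _).
  by apply: qv_eval => a; exact: qv_center.
apply: eq_bigr => l _; rewrite qvM qv_norm mxE qvD qvM !qv_inv ?muln_gt0 ?expn_gt0 //.
by rewrite PsE qv_lip natrX.
Qed.

Lemma newton_valueP k e n c : (0 < n)%N ->
  newton_value d k Ps e n c <-> forall i, value_ok p k e n c i.
Proof.
move=> n_gt0.
suff FE (i : 'I_d) : qle (qadd
      (qabs (qsum [seq qmul (qentry c i l)
            (qeval d (qpoly_of_raw (nth [::] Ps l)) (qcenter d e n c))
         | l <- iota 0 d]))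
      (qsum [seq qmul (qabs (qentry c i l)) (qinv (2 ^ k)) | l <- iota 0 d]))
      (qinv (4 * n)) = value_ok p k e n c i.
  rewrite /newton_value; split=> [/all_iotaP h i|h]; first by have := h i; rewrite FE.
  by apply/all_iotaP => i; rewrite FE; exact: h.
rewrite (qv_le R) qvD qv_norm !qv_sum_iota qv_inv ?muln_gt0 // /value_ok.
congr (`|_| + _ <= _).
  apply: eq_bigr => l _; rewrite qvM mxE PsE; congr (_ * _).
  by apply: qv_eval => a; exact: qv_center.
by apply: eq_bigr => l _; rewrite qvM qv_norm mxE qv_inv ?expn_gt0 // natrX.
Qed.

Lemma grid_point_okP k m e n (C : seq qcube) (g : seq Q) (x : 'rV[R]_d) :
  (0 < n)%N -> (0 < m)%N -> (forall i : 'I_d, qv (nth (qnat 0) g i) = x 0 i) ->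
  grid_point_ok d k Ps m e n C g <->
    (exists l, 2 ^- k + lip R d (p l) * m%:R^-1 < `|pv (p l) x|) \/
    (exists2 c, c \in C & forall i,
       `|x 0 i - rcenter e n c 0 i| + m%:R^-1 <= (2 * n)%:R^-1).
Proof.
move=> n_gt0 m_gt0 gx.
have FE (l : 'I_d) : ~~ qle (qabs (qeval d (qpoly_of_raw (nth [::] Ps l)) g))
      (qadd (qinv (2 ^ k)) (qmul (qlip d (qpoly_of_raw (nth [::] Ps l))) (qinv m)))
    = (2 ^- k + lip R d (p l) * m%:R^-1 < `|pv (p l) x|).
  rewrite (qv_le R) qvD qvM qv_norm !qv_inv ?expn_gt0 // PsE qv_lip natrX -ltNge.
  by rewrite (qv_eval _ gx).
have GE (c : qcube) (i : 'I_d) : qle (qadd (qabs (qadd (nth (qnat 0) g i)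
        (qopp (nth (qnat 0) (qcenter d e n c) i)))) (qinv m)) (qinv (2 * n))
    = (`|x 0 i - rcenter e n c 0 i| + m%:R^-1 <= (2 * n)%:R^-1).
  by rewrite (qv_le R) qvD qv_norm qvD qvN gx qv_center // !qv_inv ?muln_gt0.
split=> [/orP[/has_iotaP[l]|/hasP[c cC /all_iotaP h]]|[[l]|[c cC h]]].
- by rewrite FE; left; exists l.
- by right; exists c => // i; rewrite -GE; exact: h.
- by rewrite -FE => h; apply/orP; left; apply/has_iotaP; exists l.
apply/orP; right; apply/hasP; exists c => //.
by apply/all_iotaP => i; rewrite GE.
Qed.

End Polynomials.

Lemma cubes_separatedP e n (C : seq qcube) : (0 < n)%N ->
  cubes_separated d e n C <-> forall t u, (t < size C)%N -> (u < size C)%N -> t <> u ->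
    exists i : 'I_d, n%:R^-1 <
      `|rcorner e (nth ([::], [::]) C t) 0 i - rcorner e (nth ([::], [::]) C u) 0 i|.
Proof.
move=> n_gt0.
have FE t u (i : 'I_d) : ~~ qle (qabs (qadd (qcorner e (nth ([::], [::]) C t) i)
       (qopp (qcorner e (nth ([::], [::]) C u) i)))) (qinv n) =
   (n%:R^-1 < `|rcorner e (nth ([::], [::]) C t) 0 i -
                rcorner e (nth ([::], [::]) C u) 0 i|).
  by rewrite (qv_le R) qv_norm qvD qvN qv_inv // -ltNge !mxE.
rewrite /cubes_separated; split=> [/allP h t u lt_t lt_u /eqP tu|h].
  have /allP/(_ u) : all (fun v : nat => (t == v) || has (fun i =>
      ~~ qle (qabs (qadd (qcorner e (nth ([::], [::]) C t) i)
                   (qopp (qcorner e (nth ([::], [::]) C v) i)))) (qinv n))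
    (iota 0 d)) (iota 0 (size C)) by apply: h; rewrite mem_iota.
  rewrite mem_iota /= => /(_ lt_u).
  by rewrite (negbTE tu) /= => /has_iotaP[i]; rewrite FE; exists i.
apply/allP=> t; rewrite mem_iota /= => lt_t.
apply/allP=> u; rewrite mem_iota /= => lt_u.
have [//|/eqP tu] := eqVneq t u.
by apply/has_iotaP; have [i] := h t u lt_t lt_u tu; rewrite -FE; exists i.
Qed.

Lemma mem_grid m (g : seq Q) :
  (g \in grid d m) = (size g == d) && all (mem (grid_line m)) g.
Proof.
rewrite /grid; elim: (d) g => [|k IHk] g; first by case: g.
rewrite iterS; apply/allpairsP/andP => [[[a l] [/= am]]|].
  by rewrite IHk => /andP[/eqP <- lm] ->; rewrite /= eqxx am lm.
by case: g => [[]|a l] //= [szl /andP[am lm]]; exists (a, l); rewrite IHk -eqSS szl.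
Qed.

Lemma grid_coord m g : (0 < m)%N -> g \in grid d m -> forall i : 'I_d,
  `|qv (nth (qnat 0) g i)| <= 1.
Proof.
move=> m_gt0; rewrite mem_grid => /andP[/eqP szg /allP gm] i.
have /gm/mapP[t] : nth (qnat 0) g i \in g by rewrite mem_nth ?szg.
rewrite mem_iota /= add0n ltnS => le_t ->; rewrite qvE prednK //.
rewrite normrM normfV normr_nat ler_pdivrMr ?ltr0n // mul1r ler_norml.
have : t%:R <= (2 * m)%:R :> R by rewrite ler_nat.
by have := ler0n R t; rewrite natrM; lra.
Qed.

Lemma grid_cover m (x : 'rV[R]_d) : (0 < m)%N -> (forall i, `|x 0 i| <= 1) ->
  exists2 g, g \in grid d m & forall i : 'I_d, `|x 0 i - qv (nth (qnat 0) g i)| <= m%:R^-1.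
Proof.
move=> m_gt0 x1; pose t i := Num.truncn ((x 0 i + 1) * m%:R).
have m0 : 0 < m%:R :> R by rewrite ltr0n.
have tE i : (t i)%:R <= (x 0 i + 1) * m%:R < (t i).+1%:R.
  apply: truncn_itv; rewrite mulr_ge0 // -lerBlDr sub0r.
  by have := x1 i; rewrite ler_norml => /andP[].
exists [seq ((t i, m), m.-1) | i <- enum 'I_d].
  rewrite mem_grid size_map size_enum_ord eqxx; apply/allP=> _ /mapP[i _ ->] /=.
  apply/mapP; exists (t i) => //; rewrite mem_iota /= add0n ltnS -(ler_nat R).
  have /andP[le_t _] := tE i; apply: (le_trans le_t); rewrite natrM ler_pM2r //.
  by have := x1 i; rewrite ler_norml => /andP[]; lra.
move=> i; rewrite (nth_map i) ?size_enum_ord // nth_ord_enum qvE prednK //.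
have /andP[le_t lt_t] := tE i.
rewrite -[x 0 i](mulfK (lt0r_neq0 m0)) -mulrBl normrM normfV normr_nat.
rewrite ler_pdivrMr // mulVf ?lt0r_neq0 // ler_norml.
by move: le_t lt_t; rewrite -natr1 mulrDl mul1r; lra.
Qed.

End Meaning.

(** * A passed check is correct *)

Section Output.
Variable d : nat.

Definition cube_of (e n : nat) (c : qcube) : cube d :=
  (\row_i qv rat (qcorner e c i), n%:R^-1).

Lemma code_rat_frac (z : int) (D : nat) : coprime `|z| D -> (0 < D)%N ->
  code_rat (z%:~R / D%:R) = code_int z ++ false :: code_nat D.
Proof.
move=> cop D_gt0; rewrite [D%:R]pmulrn /code_rat coprimeq_num // coprimeq_den //.
rewrite gtr0_sg ?ltz_nat // mul1r; congr (_ ++ _).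
by rewrite (negbTE (_ : D%:Z != 0)) // -lt0n.
Qed.

Lemma code_rat_corner e c i : code_rat (qv rat (qcorner e c i)) =
  (0 < (nth (0, 0) c.1 i).1)%N ::
     code_nat ((nth (0, 0) c.1 i).2 * 2 + 1) ++ false :: code_nat (2 ^ e).
Proof.
rewrite /qcorner; case: (nth _ _ _) => s a /=.
have cop : coprime (a * 2 + 1) (2 ^ e).
  by rewrite coprimeXr // coprimen2 oddD oddM andbF.
have e_gt0 : (0 < 2 ^ e)%N by rewrite expn_gt0.
case: ltnP => _; rewrite qvE prednK // ?sub0r ?subr0.
  have -> : - (a * 2 + 1)%:R = (- (a * 2 + 1)%N%:Z)%:~R :> rat.
    by rewrite mulrNz pmulrn.
  rewrite code_rat_frac ?abszN // /code_int abszN absz_nat.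
  by rewrite oppr_lt0 ltz_nat addn1.
by rewrite [X in X / _]pmulrn code_rat_frac // /code_int absz_nat.
Qed.

Lemma code_cube_of e n c : (0 < n)%N -> code_cube (cube_of e n c) = code_qcube d e n c.
Proof.
move=> n_gt0; rewrite /code_cube /code_qcube /code_fam; congr (flatten _ ++ _).
  rewrite -val_enum_ord -map_comp; apply: eq_map => i /=.
  by rewrite mxE code_rat_corner.
rewrite /side /= -[n%:R^-1]mul1r.
by rewrite (code_rat_frac (z := 1)) ?coprime1n.
Qed.

Lemma output_ofE (y : certificate) : let n := y.2.2.1.1 in (0 < n)%N ->
  output_of d y = output_word n (size y.2.2.2.2)
    [seq cube_of y.2.2.2.1 n c | c <- y.2.2.2.2].
Proof.
move=> n n_gt0; rewrite /output_of /output_word -/n; congr (_ ++ _ ++ _).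
rewrite /code_seq size_map -map_comp; congr (_ ++ flatten _).
by apply: eq_map => c /=; rewrite code_cube_of.
Qed.

Variable R : realType.

Lemma cube_setP e n c (x : 'rV[R]_d) : (0 < n)%N ->
  cube_set (cube_of e n c) x <-> `|x - rcenter R d e n c| <= (2 * n)%:R^-1.
Proof.
move=> n_gt0.
have valq q : ratr (qv rat q) = qv R q.
  by rewrite /qv rmorph_div /= ?unitfE ?pnatr_eq0 // rmorphB /= !ratr_nat.
have nE : n%:R^-1 = 2 * (2 * n)%:R^-1 :> R.
  by rewrite natrM; field; rewrite pnatr_eq0 -lt0n.
have xE i : (x - rcenter R d e n c) 0 i = x 0 i - (qv R (qcorner e c i) + (2 * n)%:R^-1).
  by rewrite !mxE.
have cE i : ratr (corner (cube_of e n c) ord0 i) = qv R (qcorner e c i).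
  by rewrite /corner mxE valq.
have sE i : ratr (corner (cube_of e n c) ord0 i + side (cube_of e n c)) =
    qv R (qcorner e c i) + 2 * (2 * n)%:R^-1.
  have sv : ratr (n%:R^-1 : rat) = n%:R^-1 :> R by rewrite fmorphV /= ratr_nat.
  by rewrite -nE -sv -cE; exact: rmorphD.
split=> [xc|xc i].
  apply: mx_norm_le => [|a i]; rewrite ?invr_ge0 // ord1 xE ler_norml.
  by have := xc i; rewrite sE cE; lra.
have := le_trans (coord_le_norm _ 0 i) xc; rewrite xE ler_norml.
by rewrite sE cE; lra.
Qed.

End Output.

(** * From an accepted certificate to the zeros *)

Section Soundness.
Variables (R : realType) (d : nat) (U : set 'rV[R]_d) (f : 'rV[R]_d -> 'rV[R]_d).
Local Notation K := (@unit_ball R d).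
Variables (P : nat -> 'I_d -> mpoly.mpoly d rat) (n0 : nat).
Hypotheses (d_gt0 : (0 < d)%N) (KU : K `<=` U) (fC1 : C1_on U f).
Hypothesis fP : is_C1_name K f P.
Variables (Ps1 Ps2 : seq rawpoly) (k1 k2 n m e : nat) (C : seq qcube).
Hypotheses (Ps1E : forall l : 'I_d, qpoly_of_raw (nth [::] Ps1 l) = name_poly P k1 l)
  (Ps2E : forall l : 'I_d, qpoly_of_raw (nth [::] Ps2 l) = name_poly P k2 l).
Hypothesis Cchk : checked d n0 Ps1 Ps2 k1 k2 n m e C.
Local Notation q := (rcenter R d e n).
Let r : R := (2 * n)%:R^-1.

Lemma checked_n : (0 < n)%N /\ (n0 <= n)%N.
Proof. by case/and5P: Cchk. Qed.

Let n_gt0 : (0 < n)%N := checked_n.1.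

Lemma r_gt0 : 0 < r.
Proof. by rewrite invr_gt0 ltr0n muln_gt0. Qed.

Lemma twice_r : n%:R^-1 = 2 * r.
Proof. by rewrite /r natrM; field; rewrite pnatr_eq0 -lt0n. Qed.

Lemma checked_in_ball c x : c \in C -> `|x - q c| <= r -> K x.
Proof.
move=> cC xq; apply/unit_ballP => i.
have /and5P[_ _ _ /allP/(_ c cC) /and3P[/(cube_in_ballP R d e c n_gt0)/(_ i)]] := Cchk.
rewrite twice_r => -[h1 h2] _ _ _.
have := le_trans (coord_le_norm _ 0 i) xq; rewrite !mxE in h1 h2 *.
by rewrite -/r !ler_norml; lra.
Qed.

Lemma checked_newton_bound c x : c \in C -> `|x - q c| <= r ->
  newton_bound f (rmatrix R d c) 2^-1 x.
Proof.
move=> cC xq j i.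
have /and5P[_ _ _ /allP/(_ c cC) /and3P[_ + _] _] := Cchk.
move=> /(newton_jacobianP R Ps1E k1 e c n_gt0 d_gt0)/(_ i j).
have -> : 2^-1 / d%:R = (2 * d)%:R^-1 :> R by rewrite natrM invfM.
rewrite /jacobian_ok => /(le_trans _); apply.
have Kx := checked_in_ball cC xq.
have Kq : K (q c) by apply: (checked_in_ball cC); rewrite subrr normr0 ltW // r_gt0.
have -> : (1%:M - jacobian f x *m rmatrix R d c) j i =
   ((i == j)%:R - \sum_l rmatrix R d c l i * pv (qderiv d j (name_poly P k1 l)) (q c)) +
   \sum_l rmatrix R d c l i * (pv (qderiv d j (name_poly P k1 l)) (q c) - jacobian f x j l).
  rewrite !mxE eq_sym -addrA; congr (_ + _); rewrite -sumrN -[in RHS]sumrN -big_split /=.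
  by apply: eq_bigr => l _; ring.
rewrite (le_trans (ler_normD _ _)) // lerD2l (le_trans (ler_norm_sum _ _ _)) //.
apply: ler_sum => l _; rewrite normrM ler_wpM2l //.
have := (name_approx KU fC1 fP k1 l Kx).2 j.
have := @pv_lipschitz R d (qderiv d j (name_poly P k1 l)) x (q c) r.
move=> /(_ (iffLR (unit_ballP _) Kx) (iffLR (unit_ballP _) Kq)).
have xq' i' : `|x 0 i' - q c 0 i'| <= r.
  by have := le_trans (coord_le_norm _ 0 i') xq; rewrite !mxE.
move=> /(_ xq') h1 h2.
(* The polynomial derivative at [x] lies between the two compared quantities: its distance to the
   Jacobian entry at [x] is the error of the name, its distance to the value at the center a
   Lipschitz bound. *)
rewrite -(subrKA (pv (qderiv d j (name_poly P k1 l)) x)) addrC.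
by rewrite (le_trans (ler_normD _ _)) // lerD 1?distrC // mulrC.
Qed.

Lemma checked_newton_value c : c \in C -> `|f (q c) *m rmatrix R d c| <= r / 2.
Proof.
move=> cC; apply: mx_norm_le => [|a i]; first by rewrite divr_ge0 // ltW // r_gt0.
have /and5P[_ _ _ /allP/(_ c cC) /and3P[_ _ +] _] := Cchk.
move=> /(newton_valueP R Ps2E k2 e c n_gt0)/(_ i).
have <- : (4 * n)%:R^-1 = r / 2.
  by rewrite /r !natrM; field; rewrite pnatr_eq0 -lt0n.
rewrite /value_ok => /(le_trans _); apply; rewrite {a}ord1 mxE.
have Kq : K (q c) by apply: (checked_in_ball cC); rewrite subrr normr0 ltW // r_gt0.
have -> : \sum_j f (q c) 0 j * rmatrix R d c j i =
   \sum_l rmatrix R d c l i * pv (name_poly P k2 l) (q c) +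
   \sum_l rmatrix R d c l i * (f (q c) 0 l - pv (name_poly P k2 l) (q c)).
  by rewrite -big_split /=; apply: eq_bigr => l _; ring.
rewrite (le_trans (ler_normD _ _)) // lerD2l (le_trans (ler_norm_sum _ _ _)) //.
apply: ler_sum => l _; rewrite normrM ler_wpM2l //.
exact: (name_approx KU fC1 fP k2 l Kq).1.
Qed.

Lemma checked_zero c : c \in C -> exists x, [/\ `|x - q c| <= r, f x = 0
  & forall y, `|y - q c| <= r -> f y = 0 -> y = x].
Proof.
move=> cC; apply: (newton_zero (A := rmatrix R d c)); first exact: r_gt0.
- by move=> x /(checked_in_ball cC)/KU/fC1[].
- by move=> x; exact: checked_newton_bound.
- exact: checked_newton_value.
Qed.

Lemma checked_cover x : K x -> f x = 0 -> exists2 c, c \in C & `|x - q c| <= r.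
Proof.
move=> Kx fx; have /and5P[_ _ m_gt0 _ /andP[_ /allP gridP]] := Cchk.
have x1 := iffLR (unit_ballP _) Kx.
have [g gm xg] := grid_cover m_gt0 x1; pose y : 'rV[R]_d := \row_i qv R (nth (qnat 0) g i).
have gy (i : 'I_d) : qv R (nth (qnat 0) g i) = y 0 i by rewrite mxE.
have y1 i : `|y 0 i| <= 1 by rewrite -gy (grid_coord R m_gt0 gm).
have /(grid_point_okP Ps2E k2 e C n_gt0 m_gt0 gy)[[l]|[c cC yc]] := gridP g gm.
  rewrite ltNge => /negP[].
  have := (name_approx KU fC1 fP k2 l Kx).1; rewrite fx mxE sub0r normrN => h1.
  have : `|pv (name_poly P k2 l) y - pv (name_poly P k2 l) x|
      <= lip R d (name_poly P k2 l) * m%:R^-1.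
    by apply: pv_lipschitz => // i; rewrite -gy distrC.
  move=> h2; rewrite -(subrK (pv (name_poly P k2 l) x) (pv _ y)).
  by rewrite (le_trans (ler_normD _ _)) // addrC lerD.
exists c => //; apply: mx_norm_le => [|a i]; first by rewrite ltW // r_gt0.
have -> : (x - q c) a i = x 0 i - q c 0 i by rewrite ord1 [LHS]mxE [X in _ + X]mxE.
apply: le_trans (yc i).
rewrite -(subrKA (y 0 i)) addrC (le_trans (ler_normD _ _)) // lerD2l -gy.
exact: xg.
Qed.

Lemma checked_zeros :
  [/\ (zeros K f #= `I_(size C))%card,
      forall c, c \in [seq cube_of d e n c | c <- C] ->
          side c = n%:R^-1 /\
          exists2 x, zeros K f x & zeros U f `&` @cube_set R d c = [set x],
      zeros K f `<=` @cubes_union R d [seq cube_of d e n c | c <- C]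
    & (hausdorff_dist (zeros K f) (@cubes_union R d [seq cube_of d e n c | c <- C])
           <= (n%:R^-1)%:E)%E].
Proof.
have /boolp.choice[z zP] c : exists x, c \in C -> [/\ `|x - q c| <= r, f x = 0
    & forall y, `|y - q c| <= r -> f y = 0 -> y = x].
  by have [/checked_zero[x xP]|] := boolP (c \in C); [exists x|exists 0].
have cubeP c x := @cube_setP d R e n c x n_gt0.
have sub_cubes : zeros K f `<=` @cubes_union R d [seq cube_of d e n c | c <- C].
  move=> x [Kx fx]; have [c cC xc] := checked_cover Kx fx.
  by exists (cube_of d e n c); [exact: map_f|exact/cubeP].
have zero_z c : c \in C -> zeros K f (z c).
  by move=> cC; have [zc fz _] := zP c cC; split=> //; exact: checked_in_ball zc.
split=> //.
(* The zero of the cube at position [t]. This map is onto by covering, and one-to-one since a zero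
   common to two cubes would bring their corners within one side of each other in every
   coordinate. *)
- pose h t := z (nth ([::], [::]) C t).
  have -> : zeros K f = h @` `I_(size C).
    apply/seteqP; split=> [x [Kx fx]|_ [t lt_t <-]]; last exact/zero_z/mem_nth.
    have [c cC xc] := checked_cover Kx fx; exists (index c C); first by rewrite /= index_mem.
    by rewrite /h nth_index //; have [_ _ uniq] := zP c cC; rewrite -(uniq x).
  apply: inj_card_eq => t u; rewrite !inE /= => lt_t lt_u tu.
  have [//|/eqP neq] := eqVneq t u.
  have /and5P[_ _ _ _ /andP[/(cubes_separatedP R d e C n_gt0) sep _]] := Cchk.
  have [i] := sep t u lt_t lt_u neq.
  have [ht _ _] := zP _ (mem_nth ([::], [::]) lt_t).
  have [hu _ _] := zP _ (mem_nth ([::], [::]) lt_u).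
  move: tu ht hu; rewrite /h => -> ht hu.
  have := le_trans (coord_le_norm _ 0 i) ht; have := le_trans (coord_le_norm _ 0 i) hu.
  rewrite !mxE -/r twice_r !ler_norml => h1 h2; rewrite ltNge => /negP[].
  by rewrite ler_norml; lra.
- move=> _ /mapP[c cC ->]; split=> //; exists (z c); first exact: zero_z.
  have [zc fz uniq] := zP c cC.
  apply/seteqP; split=> [x [[_ fx] /cubeP xc]|_ ->]; first exact: uniq.
  by split; [split=> //; exact/KU/(checked_in_ball cC)|exact/cubeP].
(* Zeros lie in the union, so one excess vanishes; a point of a cube and the zero in it are both
   within [r] of the center, hence within one side of each other. *)
rewrite /hausdorff_dist !ge_max lee_fin invr_ge0 ler0n /=; apply/andP; split.
  apply: ge_ereal_sup => _ [x zx <-]; apply: ge_ereal_inf; exists (`|x - x|%:E).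
    by exists x => //; exact: sub_cubes.
  by rewrite subrr normr0 lee_fin invr_ge0.
apply: ge_ereal_sup => _ [x [_ /mapP[c cC ->] /cubeP xc] <-].
apply: ge_ereal_inf; exists (`|x - z c|%:E); first by exists (z c) => //; exact: zero_z.
have [zc _ _] := zP c cC; rewrite lee_fin twice_r.
rewrite -(subrKA (q c)) (le_trans (ler_normD _ _)) // mulr2n mulrDl mul1r lerD //.
by rewrite distrC.
Qed.

End Soundness.

(** * Some check is passed *)

Section Limits.
Variable R : realType.
Implicit Types c e : R.

(** Each parameter of a certificate is picked from the filter at infinity: finitely many
    requirements that hold for large indices are met at once. *)
Lemma near_inv c e : 0 < e -> \forall n \near \oo, c * n%:R^-1 <= e.
Proof.
move=> e_gt0; exists (Num.truncn (`|c| / e)).+1 => // n /= lt_n.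
have n_gt0 : 0 < n%:R :> R by rewrite ltr0n (leq_ltn_trans _ lt_n).
rewrite ler_pdivrMr // (le_trans (ler_norm c)) // mulrC -ler_pdivrMr //.
by rewrite ltW // (lt_le_trans (truncnS_gt _)) ?ler_nat // divr_ge0 // ltW.
Qed.

Lemma near_exp c e : 0 < e -> \forall n \near \oo, c * 2 ^- n <= e.
Proof.
move=> e_gt0; have [N _ HN] := near_inv `|c| e_gt0.
exists N.+1 => // n /= lt_n; have n_gt0 : (0 < n)%N by rewrite (leq_ltn_trans _ lt_n).
apply: le_trans (HN n (ltnW lt_n)); apply: (@le_trans _ _ (`|c| * 2 ^- n)).
  by rewrite ler_wpM2r ?ler_norm // invr_ge0 exprn_ge0.
rewrite ler_wpM2l // lef_pV2 ?posrE ?ltr0n ?exprn_gt0 //.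
by rewrite -natrX ler_nat ltnW // ltn_expl.
Qed.

Lemma near_seq (T : eqType) (s : seq T) (P : T -> nat -> Prop) :
  (forall x, x \in s -> \forall n \near \oo, P x n) ->
  \forall n \near \oo, forall x, x \in s -> P x n.
Proof.
elim: s => [|x s IHs] Ps; first exact: nearW.
have [N _ HN] := Ps x (mem_head _ _).
have [|M _ HM] := IHs; first by move=> y ys; apply: Ps; rewrite inE ys orbT.
exists (N + M)%N => // n /= le_n y; rewrite inE => /orP[/eqP ->|ys].
  by apply: HN; rewrite /= (leq_trans _ le_n) // leq_addr.
by apply: HM => //=; rewrite (leq_trans _ le_n) // leq_addl.
Qed.

Lemma near_fin (I : finType) (P : I -> nat -> Prop) :
  (forall i, \forall n \near \oo, P i n) -> \forall n \near \oo, forall i, P i n.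
Proof. by move=> HP; exact: (@filter_forall _ _ P \oo _ HP). Qed.

(** Odd integers are 2 apart, so one of them lies within 1 of [|x| * 2 ^+ e]; the sign is stored
    separately. *)
Lemma odd_approx (e : nat) (x : R) : exists b : nat * nat, forall (c : qcube) i,
  nth (0, 0)%N c.1 i = b -> `|qv R (qcorner e c i) - x| <= 2 ^- e.
Proof.
have E0 : 0 < 2 ^+ e :> R by rewrite exprn_gt0.
pose y := `|x| * 2 ^+ e; pose k := Num.truncn y.
have /andP[k_le k_gt] : k%:R <= y < k.+1%:R.
  by apply: truncn_itv; rewrite mulr_ge0 // ltW.
have half_k : (k./2 * 2 <= k)%N && (k <= k./2 * 2 + 1)%N.
  have := odd_double_half k; rewrite -muln2.
  by case: (odd k) => /=; move: (k./2) => a; move: (k) => b; lia.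
have [kE1 kE2] : (k./2 * 2)%:R <= k%:R :> R /\ k%:R <= (k./2 * 2 + 1)%:R :> R.
  by rewrite !ler_nat; apply/andP.
exists (nat_of_bool (x < 0), k./2) => c i cE.
have near_y : `|(k./2 * 2 + 1)%:R - y| <= 1.
  by move: kE1 kE2 k_le k_gt; rewrite -natr1 natrD ler_norml; lra.
have valE : qv R (qcorner e c i) - x =
    (if x < 0 then -1 else 1) * ((k./2 * 2 + 1)%:R - y) / 2 ^+ e.
  rewrite /qcorner cE /= lt0b /y; case: ltP => x0; rewrite qvE prednK ?expn_gt0 //.
    rewrite ltr0_norm // natrX; field; exact: lt0r_neq0.
  rewrite ger0_norm // natrX; field; exact: lt0r_neq0.
rewrite valE normrM normfV (gtr0_norm E0) normrM ler_pdivrMr // mulVf ?lt0r_neq0 //.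
by rewrite (_ : `|if _ then _ else _| = 1) ?mul1r //; case: ifP; rewrite ?normrN normr1.
Qed.

End Limits.

(** * Newton maps near a zero, finiteness of the zero set *)

Section Local.
Variables (R : realType) (d : nat) (U : set 'rV[R]_d) (f : 'rV[R]_d -> 'rV[R]_d).
Local Notation K := (@unit_ball R d).
Hypotheses (d_gt0 : (0 < d)%N) (KU : K `<=` U) (fC1 : C1_on U f).
Hypothesis simple_zeros : forall a, K a -> f a = 0 ->
  \det (jacobian f a) != 0 /\ ~ boundary K a.

(** Dominates all row and column sums; the added 1 allows division by it even when [M] is zero. *)
Let msum (M : 'M[R]_d) : R := 1 + \sum_i \sum_j `|M i j|.

Lemma msum_gt0 M : 0 < msum M.
Proof. by rewrite ltr_pwDl // sumr_ge0 // => i _; apply: sumr_ge0. Qed.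

Lemma mulmx_le_msum (M N : 'M[R]_d) (h : R) i j : 0 <= h ->
  (forall a b, `|M a b| <= h) -> `|(M *m N) i j| <= h * msum N.
Proof.
move=> h0 Mh; rewrite mxE (le_trans (ler_norm_sum _ _ _)) //.
have -> : h * msum N = h + \sum_l h * \sum_k `|N l k|.
  by rewrite mulrDr mulr1 mulr_sumr.
apply: (@le_trans _ _ (\sum_l h * \sum_k `|N l k|)); last by rewrite lerDr.
apply: ler_sum => l _; rewrite normrM ler_pM // (bigD1 j) //= lerDl.
by apply: sumr_ge0.
Qed.

Lemma msum_mulmx_le (M N : 'M[R]_d) (h : R) i j : 0 <= h ->
  (forall a b, `|M a b| <= h) -> `|(N *m M) i j| <= h * msum N.
Proof.
move=> h0 Mh; rewrite mxE (le_trans (ler_norm_sum _ _ _)) //.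
apply: (@le_trans _ _ (h * \sum_l `|N i l|)).
  by rewrite mulr_sumr; apply: ler_sum => l _; rewrite normrM mulrC ler_wpM2r.
rewrite ler_wpM2l // /msum [X in 1 + X](bigD1 i) //= addrCA lerDl addr_ge0 //.
by apply: sumr_ge0 => k _; apply: sumr_ge0.
Qed.

Definition matrix_seq (a : 'I_d -> 'I_d -> Q) : seq (seq Q) :=
  [seq [seq a i l | l <- enum 'I_d] | i <- enum 'I_d].

Lemma rmatrix_seq b a : rmatrix R d (b, matrix_seq a) = \matrix_(l, i) qv R (a i l).
Proof.
apply/matrixP=> l i; rewrite !mxE /qentry /= (nth_map i) ?size_enum_ord //.
by rewrite (nth_map l) ?size_enum_ord // !nth_ord_enum.
Qed.

(** Separates the change of the Jacobian matrix between two points from the rounding of its inverse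
    [B] to a rational matrix [A]. *)
Lemma newton_defect (J J' A B : 'M[R]_d) : J *m B = 1%:M ->
  1%:M - J' *m A = (J - J') *m A + J *m (B - A).
Proof.
by move=> JB; rewrite mulmxBl mulmxBr JB [RHS]addrC addrA subrK.
Qed.

(** The matrix is fixed before the radius, since the tolerated drift of the Jacobian matrix depends
    on the size of [A]. The zero being interior keeps the neighborhood inside the ball. *)
Lemma local_newton x : K x -> f x = 0 -> exists A : seq (seq Q), exists2 rho : R, 0 < rho &
  forall y b, `|y - x| < rho -> K y /\ newton_bound f (rmatrix R d (b, A)) 4^-1 y.
Proof.
move=> Kx fx; have [detJ bndK] := simple_zeros Kx fx.
have unitJ : jacobian f x \in unitmx by rewrite unitmxE unitfE.
pose B := invmx (jacobian f x).
have d_pos : 0 < d%:R :> R by rewrite ltr0n.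
(* Rounding of the inverse and drift of the Jacobian matrix each get half of [4^-1 / d]. *)
pose h : R := 8^-1 / d%:R; have h_gt0 : 0 < h by rewrite divr_gt0.
have /boolp.choice[a aP] i : exists a : 'I_d -> Q, forall l,
    `|qv R (a l) - B l i| <= h / msum (jacobian f x).
  have /boolp.choice[g gP] l : exists g, `|qv R g - B l i| < h / msum (jacobian f x).
    by apply: qv_dense; rewrite divr_gt0 // msum_gt0.
  by exists g => l; exact: ltW.
pose A : 'M[R]_d := \matrix_(l, i) qv R (a i l).
have close : \forall y \near x, K y /\
    forall j l, `|jacobian f x j l - jacobian f y j l| <= h / msum A.
  have nearK : \forall y \near x, K y.
    have : closure K x by apply: subset_closure.
    by move=> cKx; apply: contrapT => nK; apply: bndK; split.
  have nearJ : \forall y \near x, forall j l,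
      `|jacobian f x j l - jacobian f y j l| <= h / msum A.
    apply: (@filter_forall _ _ (fun j y => forall l,
      `|jacobian f x j l - jacobian f y j l| <= h / msum A) (nbhs x)) => j.
    apply: (@filter_forall _ _ (fun l y =>
      `|jacobian f x j l - jacobian f y j l| <= h / msum A) (nbhs x)) => l.
    have := @continuous_jacobian _ _ _ _ KU fC1 x l j Kx.
    by move=> /cvgrPdist_le; apply; rewrite divr_gt0 // msum_gt0.
  by apply: filterS2 nearK nearJ => y.
have /nbhs_ballP[rho rho_gt0 near_x] := close.
exists (matrix_seq a), rho => // y b yx; rewrite rmatrix_seq -/A.
have [|Ky Jy] := near_x y; first by rewrite -ball_normE /= distrC.
split=> // j i.
rewrite (newton_defect (jacobian f y) A (mulmxV unitJ)).
rewrite mxE (le_trans (ler_normD _ _)) //.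
have -> : 4^-1 / d%:R = h + h.
  by rewrite /h; field; exact: lt0r_neq0.
rewrite lerD //.
  rewrite -[leRHS](divfK (lt0r_neq0 (msum_gt0 A))).
  apply: mulmx_le_msum => [|p q]; first by rewrite divr_ge0 // ltW // msum_gt0.
  by have := Jy p q; congr (`|_| <= _); rewrite [RHS]mxE; congr (_ + _); rewrite [RHS]mxE.
rewrite -[leRHS](divfK (lt0r_neq0 (msum_gt0 (jacobian f x)))).
apply: msum_mulmx_le => [|p q]; first by rewrite divr_ge0 // ltW // msum_gt0.
by have := aP q p; rewrite distrC; congr (`|_| <= _); rewrite [RHS]mxE; congr (_ + _); rewrite [RHS]mxE mxE.
Qed.

Lemma newton_bound_le A (h k : R) y : h <= k -> newton_bound f A h y -> newton_bound f A k y.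
Proof.
move=> hk fA j i; apply: le_trans (fA j i) _.
by rewrite ler_wpM2r // invr_ge0.
Qed.

Lemma quarter_le_half : 4^-1 <= 2^-1 :> R.
Proof. by rewrite lef_pV2 ?posrE // ler_nat. Qed.

(** Every point of the ball has a neighborhood with at most one zero: by continuity if it is not a
    zero, by uniqueness for a contracting Newton map if it is. Compactness leaves finitely many
    neighborhoods. *)
Lemma finite_zeros : finite_set (zeros K f).
Proof.
have iso x : exists2 rho : R, 0 < rho & K x -> forall y z, `|y - x| < rho -> `|z - x| < rho ->
    zeros K f y -> zeros K f z -> y = z.
  have [Kx|nK] := pselect (K x); last by exists 1.
  have [fx|/eqP fx] := eqVneq (f x) 0; last first.
    have [/differentiable_continuous/cvgrPdist_lt cf _] := fC1 (KU Kx).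
    have /nbhs_ballP[rho rho_gt0 near_x] : \forall y \near x, `|f x - f y| < `|f x|.
      by apply: cf; rewrite normr_gt0; exact/eqP.
    exists rho => // _ y z yx _ [_ fy] _; have := near_x y.
    by rewrite -ball_normE /= distrC fy subr0 ltxx => /(_ yx).
  have [A [rho rho_gt0 Arho]] := local_newton Kx fx; exists rho => // _ y z yx zx [_ fy] [_ fz].
  (* The closed box just large enough for both points is convex and stays inside the open ball of
     radius [rho]. *)
  have lt_rho : Num.max `|y - x| `|z - x| < rho by rewrite gt_max yx zx.
  set t := Num.max _ _ in lt_rho; pose S := [set u : 'rV[R]_d | `|u - x| <= t].
  have inS u : S u -> `|u - x| < rho by move=> Su; apply: le_lt_trans lt_rho.
  apply: (newton_zero_unique (f := f) (A := rmatrix R d ([::], A)) (S := S)) => //.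
  - by move=> u v s; exact: closed_box_convex.
  - by move=> u /inS /(Arho _ [::])[/KU/fC1[]].
  - by move=> u /inS /(Arho _ [::])[_ bu]; exact: (newton_bound_le quarter_le_half bu).
  - by rewrite /S /= /t le_max lexx.
  - by rewrite /S /= /t le_max lexx orbT.
have /boolp.choice[rho rhoP] x : exists rho : R, 0 < rho /\ (K x -> forall y z,
    `|y - x| < rho -> `|z - x| < rho -> zeros K f y -> zeros K f z -> y = z).
  by have [rho] := iso x; exists rho.
have := @compact_unit_ball R d; rewrite compact_cover => /(_ _ K (fun x => ball x (rho x))).
case=> [x _|x Kx|D DK cov]; first exact: ball_open.
  by exists x => //; apply: ballxx; exact: (rhoP x).1.
move: DK cov; have := finite_fset D; set E := [set` _] => finE DK cov.
pose Z (x : 'rV[R]_d) := zeros K f `&` ball x (rho x).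
have sub : zeros K f `<=` \bigcup_(x in E) Z x.
  by move=> y zy; have [x Dx xy] := cov y zy.1; exists x.
apply: (sub_finite_set sub); apply: bigcup_finite => // x Dx.
have [[y [zy xy]]|nZ] := pselect (Z x !=set0); last first.
  by apply: (@sub_finite_set _ _ set0) => // y Zy; apply: nZ; exists y.
apply: (@sub_finite_set _ _ [set y]); last exact: finite_set1.
move=> z [zz xz]; have Kx : K x by have := DK x Dx; rewrite inE.
move: xy xz; rewrite -ball_normE /= !(distrC x) => xy xz.
exact: (rhoP x).2.
Qed.

End Local.

(** * Choice of the constants of a certificate *)

Section Completeness.
Variables (R : realType) (d : nat) (U : set 'rV[R]_d) (f : 'rV[R]_d -> 'rV[R]_d).
Local Notation K := (@unit_ball R d).
Variables (P : nat -> 'I_d -> mpoly.mpoly d rat) (n0 : nat).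
Hypotheses (d_gt0 : (0 < d)%N) (KU : K `<=` U) (fC1 : C1_on U f).
Hypothesis fP : is_C1_name K f P.
Hypothesis simple_zeros : forall a, K a -> f a = 0 ->
  \det (jacobian f a) != 0 /\ ~ boundary K a.

Lemma away_from_zeros (zs : seq 'rV[R]_d) (r : R) : 0 < r ->
  (forall x, K x -> f x = 0 -> x \in zs) ->
  exists2 delta : R, 0 < delta & forall x, K x ->
    (forall z, z \in zs -> r <= `|x - z|) -> delta <= `|f x|.
Proof.
move=> r_gt0 zsP; pose S := K `&` \bigcap_(z in [set` zs]) [set x | r <= `|x - z|].
have cS : compact S.
  apply: (subclosed_compact _ (@compact_unit_ball R d)); last exact: subIsetl.
  apply: closedI; first exact: closed_ball_closed.
  apply: closed_bigI => z _.
  have cn : continuous (fun x : 'rV[R]_d => `|x - z|).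
    by move=> x; exact: (cvg_norm (cvgB cvg_id (cvg_cst z))).

  by apply: (preimage_closed _ (@closed_ge _ r)) => x _; exact: cn.
have [S0|S0] := pselect (S !=set0); last first.
  by exists 1 => // x Kx xz; case: S0; exists x; split=> // z; exact: xz.
have [|c] := @EVT_min_rV _ _ (fun x => `|f x|) S S0 cS.
  apply: continuous_in_subspaceT => x; rewrite inE => -[Kx _].
  have [/differentiable_continuous cf _] := fC1 (KU Kx).
  exact: (continuous_comp cf (@norm_continuous _ _ _)).
rewrite inE => -[Kc cz] cmin; exists `|f c|.
  rewrite normr_gt0; apply/eqP => fc; have := cz c (zsP c Kc fc).
  by rewrite /= subrr normr0 leNgt r_gt0.
by move=> x Kx xz; apply: cmin; rewrite inE; split=> // z; exact: xz.
Qed.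

(* The zeros determine the matrices and their domains of validity [rho]; then
   the constants are chosen in the order [k1], [n], [e], [k2], [m], each one
   large enough for the previous ones. *)
Lemma checked_exists : exists k1 k2 n m e C, forall Ps1 Ps2 : seq rawpoly,
  (forall l : 'I_d, qpoly_of_raw (nth [::] Ps1 l) = name_poly P k1 l) ->
  (forall l : 'I_d, qpoly_of_raw (nth [::] Ps2 l) = name_poly P k2 l) ->
  checked d n0 Ps1 Ps2 k1 k2 n m e C.
Proof.
have d_pos : 0 < d%:R :> R by rewrite ltr0n.
have /finite_seqP[zs0 zs0E] := finite_zeros d_gt0 KU fC1 simple_zeros.
(* Repetitions are removed because separation is tested by position. *)
pose zs := undup zs0.
have zsP z : z \in zs <-> zeros K f z by rewrite zs0E /= mem_undup.
have /boolp.choice[Ar ArP] z : exists Ar : seq (seq Q) * R, zeros K f z ->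
    0 < Ar.2 /\ forall y b, `|y - z| < Ar.2 ->
      K y /\ newton_bound f (rmatrix R d (b, Ar.1)) 4^-1 y.
  have [[Kz fz]|nz] := pselect (zeros K f z); last by exists ([::], 0).
  have [A [rho rho_gt0 Arho]] := local_newton d_gt0 KU fC1 simple_zeros Kz fz.
  by exists (A, rho).
pose A z := (Ar z).1; pose rho z := (Ar z).2.
pose M z := rmatrix R d ([::], A z).
have ME b z : rmatrix R d (b, A z) = M z by apply/matrixP=> l i; rewrite !mxE.
have rho_gt0 z : z \in zs -> 0 < rho z by move=> /zsP/ArP[].
have near_zero z y : z \in zs -> `|y - z| < rho z -> K y /\ newton_bound f (M z) 4^-1 y.
  by move=> /zsP/ArP[_ h] /(h _ [::]).
pose S z i : R := \sum_l `|M z l i|.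
have S_ge0 z i : 0 <= S z i by apply: sumr_ge0.
(* Unit of the error budget per entry. The test allows [8 * D]; the Newton bound 1/4 takes [4 * D],
   the error of the name [D] twice (in the polynomial and in the test itself), the Lipschitz term
   [D] once. *)
pose D : R := (16 * d)%:R^-1.
have D_gt0 : 0 < D by rewrite invr_gt0 ltr0n muln_gt0.
have [k1 k1P] : exists k, forall z, z \in zs -> forall i, S z i * 2 ^- k <= D.
  apply: (@filter_ex _ \oo); apply: near_seq => z zz.
  by apply: near_fin => i; exact: near_exp.
pose p1 l := name_poly P k1 l.
pose L z (i j : 'I_d) : R := \sum_l `|M z l i| * lip R d (qderiv d j (p1 l)).
(* A side at most [rho] keeps the cube, even with rounded corner, where the matrix is valid; zeros
   at least three sides apart keep the rounded cubes disjoint; the last condition is the Lipschitz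
   share [D] of the budget. *)
have [n [[n0_le n_gt0] [n_rho [n_sep n_lip]]]] : exists n, [/\ (n0 <= n)%N & (0 < n)%N] /\
    ((forall z, z \in zs -> 1 * n%:R^-1 <= rho z) /\
    ((forall z, z \in zs -> forall y, y \in zs -> y != z -> 3 * n%:R^-1 <= `|y - z|) /\
    (forall z, z \in zs -> forall i j, L z i j * n%:R^-1 <= D))).
  apply: (@filter_ex _ \oo); apply: filterI.
    by exists (n0 + 1)%N => // k /= le_k; split; lia.
  apply: filterI; first by apply: near_seq => z zz; apply: near_inv; exact: rho_gt0.
  apply: filterI.
    apply: near_seq => z zz; apply: near_seq => y yy.
    have [->|yz] := eqVneq y z; first exact: nearW.
    have : 0 < `|y - z| by rewrite normr_gt0 subr_eq0.
    by move=> /(near_inv 3); apply: filterS.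
  apply: near_seq => z zz; apply: near_fin => i.
  apply: near_fin => j.
  exact: near_inv.
pose r : R := (2 * n)%:R^-1.
have r_gt0 : 0 < r by rewrite invr_gt0 ltr0n muln_gt0.
have nE : n%:R^-1 = 2 * r :> R by rewrite /r natrM; field; rewrite pnatr_eq0 -lt0n.
have [e eP] : exists e, 1 * 2 ^- e <= r / 16.
  by apply: (@filter_ex _ \oo); apply: near_exp; rewrite divr_gt0.
have /boolp.choice[corner0 cornerP] (x : R) := odd_approx e x.
pose cube0 (z : 'rV[R]_d) : qcube := ([seq corner0 (z 0 i - r) | i <- enum 'I_d], A z).
pose C := [seq cube0 z | z <- zs].
have corner_near z i : `|rcorner R d e (cube0 z) 0 i - (z 0 i - r)| <= r / 16.
  rewrite mxE (le_trans (cornerP (z 0 i - r) (cube0 z) i _)) //.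
    by rewrite /= (nth_map i) ?size_enum_ord // nth_ord_enum.
  by rewrite -[leLHS]mul1r.
pose q z := rcenter R d e n (cube0 z).
have qE z i : q z 0 i = rcorner R d e (cube0 z) 0 i + r by rewrite /q !mxE.
have q_near z : `|q z - z| <= r / 16.
  apply: mx_norm_le => [|a i]; first by rewrite divr_ge0 // ltW.
  have -> : (q z - z) a i = rcorner R d e (cube0 z) 0 i - (z 0 i - r).
    by rewrite ord1 [LHS]mxE [X in _ + X]mxE qE; ring.
  exact: corner_near.
have box_rho z y : z \in zs -> `|y - z| <= r + r / 16 -> `|y - z| < rho z.
  move=> zz /le_lt_trans; apply; apply: lt_le_trans (n_rho z zz).
  by rewrite mul1r nE; move: r_gt0; lra.
have [delta delta_gt0 deltaP] : exists2 delta : R, 0 < delta & forall x, K x ->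
    (forall z, z \in zs -> r / 2 <= `|x - z|) -> delta <= `|f x|.
  apply: away_from_zeros => [|x Kx fx]; first by rewrite divr_gt0.
  by apply/zsP; split.
have [k2 [k2_delta k2_S]] : exists k, 1 * 2 ^- k <= delta / 8 /\
    (forall z, z \in zs -> forall i, S z i * 2 ^- k <= r / 8).
  apply: (@filter_ex _ \oo); apply: filterI; first by apply: near_exp; rewrite divr_gt0.
  apply: near_seq => z zz; apply: near_fin => i.
  by apply: near_exp; rewrite divr_gt0.
pose p2 l := name_poly P k2 l.
have [m [m_gt0 [m_r m_lip]]] : exists m, (0 < m)%N /\ (1 * m%:R^-1 <= r / 4 /\
    forall l, lip R d (p2 l) * m%:R^-1 <= delta / 4).
  apply: (@filter_ex _ \oo); apply: filterI; first by exists 1%N.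
  apply: filterI; first by apply: near_inv; rewrite divr_gt0.
  by apply: near_fin => l; apply: near_inv; rewrite divr_gt0.
exists k1, k2, n, m, e, C => Ps1 Ps2 Ps1E Ps2E.
have in_ball c : c \in C -> cube_in_ball d e n c.
  move=> /mapP[z zz ->]; apply/(cube_in_ballP R) => // i.
  have corner_K (s : R) : 0 <= s <= 2 * r ->
      `|rcorner R d e (cube0 z) 0 i + s| <= 1.
    move=> /andP[s0 s1]; pose y : 'rV[R]_d := \row_k (rcorner R d e (cube0 z) 0 k + s).
    have [|/unit_ballP/(_ i) + _] := near_zero z y zz; last by rewrite mxE.
    apply: box_rho => //; apply: mx_norm_le => [|a k]; first by move: r_gt0; lra.
    have -> : (y - z) a k = rcorner R d e (cube0 z) 0 k + s - z 0 k.
      by rewrite ord1 [LHS]mxE [X in _ + X]mxE [y 0 k]mxE.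
    by have := corner_near z k; rewrite !ler_norml; lra.
  have twice_ge0 : 0 <= 2 * r by rewrite mulr_ge0 // ltW.
  have twice_r : 0 <= 2 * r <= 2 * r by rewrite twice_ge0 lexx.
  have zero_r : 0 <= (0 : R) <= 2 * r by rewrite twice_ge0 lexx.
  have := corner_K _ twice_r; have := corner_K _ zero_r.
  by rewrite -nE addr0 !ler_norml => /andP[h1 _] /andP[_ h2].
have SD z i : z \in zs -> forall h, S z i * h = \sum_l `|M z l i| * h.
  by move=> _ h; rewrite mulr_suml.
have jac c : c \in C -> newton_jacobian d k1 Ps1 e n c.
  move=> /mapP[z zz ->]; apply/(newton_jacobianP R Ps1E) => // i j.
  have qz : `|q z - z| < rho z.
    by apply: box_rho => //; apply: le_trans (q_near z) _; rewrite lerDr ltW.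
  have [Kq bq] := near_zero z (q z) zz qz.
  rewrite /jacobian_ok ME -/(q z).
  have -> : (i == j)%:R - \sum_l M z l i * pv (qderiv d j (p1 l)) (q z) =
     (1%:M - jacobian f (q z) *m M z) j i +
     \sum_l M z l i * (jacobian f (q z) j l - pv (qderiv d j (p1 l)) (q z)).
    have -> : (1%:M - jacobian f (q z) *m M z) j i =
        (j == i)%:R - \sum_l jacobian f (q z) j l * M z l i.
      rewrite [LHS]mxE; congr (_ + _); first by rewrite [LHS]mxE.
      by rewrite [LHS]mxE; congr (- _); rewrite [LHS]mxE.
    rewrite eq_sym -addrA; congr (_ + _); rewrite -sumrN -[in RHS]sumrN -big_split /=.
    by apply: eq_bigr => l _; ring.
  have h1 : `|\sum_l M z l i * (jacobian f (q z) j l - pv (qderiv d j (p1 l)) (q z))|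
      <= D.
    apply: le_trans (k1P z zz i); rewrite (SD z i zz) (le_trans (ler_norm_sum _ _ _)) //.
    apply: ler_sum => l _; rewrite normrM ler_wpM2l //.
    exact: (name_approx KU fC1 fP k1 l Kq).2.
  have h2 : \sum_l `|M z l i| * (2 ^- k1 + (2 * n)%:R^-1 * lip R d (qderiv d j (p1 l)))
      <= D + D.
    have -> : \sum_l `|M z l i| * (2 ^- k1 + (2 * n)%:R^-1 * lip R d (qderiv d j (p1 l)))
        = S z i * 2 ^- k1 + L z i j * r.
      rewrite (SD z i zz) /L mulr_suml -big_split /=.
      by apply: eq_bigr => l _; rewrite -/r; ring.
    rewrite lerD ?k1P //; apply: le_trans (n_lip z zz i j); rewrite ler_wpM2l //.
      by apply: sumr_ge0 => l _; rewrite mulr_ge0 // lip_ge0.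
    by rewrite nE; move: r_gt0; lra.
  have h3 := bq j i.
  have dE : (2 * d)%:R^-1 = 8 * D :> R.
    by rewrite /D !natrM; field; rewrite lt0r_neq0.
  have dE' : 4^-1 / d%:R = 4 * D :> R.
    by rewrite /D !natrM; field; rewrite lt0r_neq0.
  rewrite dE' in h3; rewrite dE.
  move: (ler_normD ((1%:M - jacobian f (q z) *m M z) j i) (\sum_l M z l i *
    (jacobian f (q z) j l - pv (qderiv d j (p1 l)) (q z)))) h1 h2 h3 D_gt0.
  move: `|_ + _| `|(1%:M - _) j i| `|\sum_l _| (\sum_l `|_| * _) => a b c' g.
  by lra.
have value c : c \in C -> newton_value d k2 Ps2 e n c.
  move=> /mapP[z zz ->]; apply/(newton_valueP R Ps2E) => // i.
  have [Kz fz] := iffLR (zsP z) zz.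
  have qz : `|q z - z| < rho z.
    by apply: box_rho => //; apply: le_trans (q_near z) _; rewrite lerDr ltW.
  have [Kq bq] := near_zero z (q z) zz qz.
  rewrite /value_ok ME -/(q z).
  have -> : \sum_l M z l i * pv (p2 l) (q z) = (f (q z) *m M z) 0 i -
      \sum_l M z l i * (f (q z) 0 l - pv (p2 l) (q z)).
    by rewrite mxE -sumrB; apply: eq_bigr => l _; ring.
  have h1 : `|\sum_l M z l i * (f (q z) 0 l - pv (p2 l) (q z))| <= r / 8.
    apply: le_trans (k2_S z zz i); rewrite (SD z i zz) (le_trans (ler_norm_sum _ _ _)) //.
    apply: ler_sum => l _; rewrite normrM ler_wpM2l //.
    exact: (name_approx KU fC1 fP k2 l Kq).1.
  have h2 : `|(f (q z) *m M z) 0 i| <= (3 / 2) * (r / 16).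
    apply: le_trans (coord_le_norm _ _ _) _.
    pose B := [set y : 'rV[R]_d | `|y - z| <= r / 16].
    have B_rho y : B y -> `|y - z| < rho z.
      by move=> By; apply: box_rho => //; apply: le_trans By _; rewrite lerDr ltW.
    have Bz : B z by rewrite /B /= subrr normr0 divr_ge0 // ltW.
    have convB x y (t : R) : B x -> B y -> 0 <= t <= 1 -> B (y + t *: (x - y)).
      exact: closed_box_convex.
    have dB y : B y -> differentiable f y.
      by move=> /B_rho /(near_zero z y zz)[/KU/fC1[]].
    have bB y : B y -> newton_bound f (M z) 2^-1 y.
      move=> /B_rho /(near_zero z y zz)[_ bu].
      exact: (newton_bound_le (quarter_le_half R) bu).
    have := newton_contraction convB dB bB (q_near z) Bz.
    rewrite (newton_fixed _ fz) => h.
    have -> : f (q z) *m M z = (q z - z) - (newton f (M z) (q z) - z).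
      by rewrite /newton opprB addrA subrK opprB addrC subrK.
    have := q_near z; have := ler_normB (q z - z) (newton f (M z) (q z) - z).
    move: h; move: `|_ - (_ - _)| `|newton _ _ _ - _| `|q z - z| => a b c'; lra.
  have -> : (4 * n)%:R^-1 = r / 2.
    by rewrite /r !natrM; field; rewrite pnatr_eq0 -lt0n.
  have h3 := k2_S z zz i; rewrite (SD z i zz) in h3.
  have := ler_normB ((f (q z) *m M z) 0 i) (\sum_l M z l i * (f (q z) 0 l - pv (p2 l) (q z))).
  move: h1 h2 h3 r_gt0.
  move: `|_ - \sum_l _| `|(_ *m _) 0 i| `|\sum_l _| (\sum_l `|_| * _) => a b c' g.
  by lra.
apply/and5P; split=> //.
  by apply/allP=> c cC; rewrite in_ball ?jac ?value.
apply/andP; split.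
  apply/(cubes_separatedP R) => // t u; rewrite size_map => lt_t lt_u /eqP tu.
  rewrite !(nth_map 0) //; set x := nth 0 zs t; set y := nth 0 zs u.
  have xy : x != y by rewrite nth_uniq // undup_uniq.
  have h := n_sep y (mem_nth 0 lt_u) x (mem_nth 0 lt_t) xy.
  apply: contrapT => /forallNP close; move: h; apply/negP; rewrite -ltNge.
  apply: (@le_lt_trans _ _ (2 * r + r / 16 + r / 16)); last by rewrite nE; move: r_gt0; lra.
  apply: mx_norm_le => [|a i]; first by move: r_gt0; lra.
  have := close i => /negP; rewrite -leNgt nE.
  have := corner_near x i; have := corner_near y i.
  have -> : (x - y) a i = x 0 i - y 0 i by rewrite ord1 [LHS]mxE [X in _ + X]mxE.
  by rewrite !ler_norml; lra.
apply/allP => g gm; pose y : 'rV[R]_d := \row_i qv R (nth (qnat 0) g i).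
have gy (i : 'I_d) : qv R (nth (qnat 0) g i) = y 0 i by rewrite mxE.
have Ky : K y by apply/unit_ballP => i; rewrite -gy (grid_coord R m_gt0 gm).
apply/(grid_point_okP Ps2E k2 e C n_gt0 m_gt0 gy).
have [[z zz yz]|far] := pselect (exists2 z, z \in zs & `|y - z| < r / 2).
  right; exists (cube0 z); first exact: map_f.
  move=> i; rewrite -/(q z) -/r.
  have := coord_le_norm (y - z) 0 i; have := coord_le_norm (q z - z) 0 i.
  have -> : (y - z) 0 i = y 0 i - z 0 i by rewrite [LHS]mxE [X in _ + X]mxE.
  have -> : (q z - z) 0 i = q z 0 i - z 0 i by rewrite [LHS]mxE [X in _ + X]mxE.
  have := q_near z.
  have := ler_normB (y 0 i - z 0 i) (q z 0 i - z 0 i).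
  rewrite opprB addrA subrK.
  move: yz m_r r_gt0; rewrite mul1r.
  move: `|y 0 i - q z 0 i| `|y 0 i - z 0 i| `|q z 0 i - z 0 i| `|y - z| `|q z - z|.
  move=> a b c' g' h; lra.
left; have le_delta : delta <= `|f y|.
  apply: deltaP => // z zz.
  by rewrite leNgt; apply/negP => lt; apply: far; exists z.
apply: contrapT => /forallNP small.
have : `|f y| <= delta / 2.
  apply: mx_norm_le => [|a l]; first by rewrite divr_ge0 // ltW.
  have := small l => /negP; rewrite -leNgt => small_l.
  have := (name_approx KU fC1 fP k2 l Ky).1; rewrite ord1.
  have := ler_normD (f y 0 l - pv (p2 l) y) (pv (p2 l) y); rewrite subrK.
  move: small_l (m_lip l) k2_delta delta_gt0; rewrite mul1r.
  move: `|f y 0 l| `|_ - _| `|pv _ _| (2 ^- k2) (lip _ _ _ * _) => a' b c' g' h; lra.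
by move: le_delta delta_gt0; move: `|f y| => a; lra.
Qed.

End Completeness.

Theorem mainTheorem2 (R : realType) (d : nat) (d_ge1 : (1 <= d)%N) :
  let K := @unit_ball R d in
  exists M : machine,
  forall (U : set 'rV[R]_d) (f : 'rV[R]_d -> 'rV[R]_d),
    open U -> K `<=` U -> C1_on U f ->
    (forall a, K a -> f a = 0 ->
       \det (jacobian f a) != 0 /\ ~ boundary K a) ->
  forall (P : nat -> 'I_d -> mpoly.mpoly d rat) (n0 : nat),
    is_C1_name K f P ->
  exists (n N : nat) (C : seq (cube d)),
    [/\ halts_with M (input_seq n0 P) (output_word n N C),
        (0 < n)%N && (n0 <= n)%N,
        (zeros K f #= `I_N)%card,
        forall c, c \in C ->
          side c = n%:R^-1 /\
          exists2 x, zeros K f x & zeros U f `&` @cube_set R d c = [set x] &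
        zeros K f `<=` @cubes_union R d C /\
        (hausdorff_dist (zeros K f) (@cubes_union R d C)
           <= (n%:R^-1)%:E)%E].
Proof.
move=> K; have [M MP] := checker_machine d; exists M => U f _ KU fC1 simple P n0 fP.
have [|y [s [ys halt]]] := MP (input_seq n0 P).
  have [k1 [k2 [n [m [e [C Cchk]]]]]] := checked_exists n0 d_ge1 KU fC1 fP simple.
  pose x := raw_input n0 P (k1 + k2).+1.
  exists (x, ((k1, k2), ((n, m), (e, C)))), (size (code_input x)).
  have nthx k : (k <= k1 + k2)%N -> forall l : 'I_d,
      qpoly_of_raw (nth [::] (nth [::] x.2 k) l) = name_poly P k l.
    move=> le_k l; rewrite (nth_map 0%N) ?size_iota // nth_iota // add0n.
    by rewrite (nth_map l) ?size_enum_ord // nth_ord_enum.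
  rewrite /check revK input_seq_prefix // take_size eqxx raw_input_ok /=.
  rewrite !size_map size_iota !ltnS leq_addr leq_addl /=.
  by apply: Cchk; apply: nthx; rewrite ?leq_addr ?leq_addl.
have [n0E PsE] := check_input d_ge1 ys.
have /and5P[_ ok k1_lt k2_lt chk] := ys.
have nthy k : (k < size y.1.2)%N -> forall l : 'I_d,
    qpoly_of_raw (nth [::] (nth [::] y.1.2 k) l) = name_poly P k l.
  move=> lt_k l; have := congr1 (fun t => nth [::] (nth [::] t k) l) PsE.
  rewrite /= (nth_map [::]) // (nth_map 0%N) ?size_iota // nth_iota // add0n.
  have szk : size (nth [::] y.1.2 k) = d.
    by have /allP/(_ _ (mem_nth [::] lt_k))/andP[/eqP] := ok.
  by rewrite (nth_map [::]) ?szk // (nth_map l) ?size_enum_ord // nth_ord_enum.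
rewrite n0E in chk.
have [n_gt0 n0_le] := checked_n chk.
have [cardN cubeP sub dist] := checked_zeros d_ge1 KU fC1 fP (nthy _ k1_lt) (nthy _ k2_lt) chk.
exists y.2.2.1.1, (size y.2.2.2.2), [seq cube_of d y.2.2.2.1 y.2.2.1.1 c | c <- y.2.2.2.2].
by split=> //; [rewrite -output_ofE|rewrite n_gt0].
Qed.
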